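(* Let $(V,\|\cdot\|)$ be a Minkowski plane and let $n\ge 3$ be an integer. Among all $n$-gons of a fixed perimeter (measured in the norm $\|\cdot\|$), the ones of largest area are the Zenodorus $n$-gons. That is, for every $L>0$, an $n$-gon $P$ with $\operatorname{per}(P)=L$ satisfies $\operatorname{area}(P)\ge\operatorname{area}(P')$ for all $n$-gons $P'$ with $\operatorname{per}(P')=L$ if and only if $P$ is a Zenodorus $n$-gon.
   Context: A Minkowski plane is a two-dimensional real vector space $V$ with a norm $\|\cdot\|$. Fix a non-degenerate alternating (symplectic) bilinear form $[\cdot,\cdot]$ on $V$, with area normalized so that the parallelogram spanned by $u,v$ has area $|[u,v]|$. The antinorm is $\|x\|_{\mathrm a}=\sup\{[x,y]:\|y\|=1\}$, and an anticircle is (the boundary of) a set $\{z:\|z-c\|_{\mathrm a}\le\rho\}$ with $c\in V$, $\rho>0$. An $n$-gon is a simple polygon (closed polygonal region with non-empty interior) with at most $n$ sides, i.e. degenerate sides are allowed; $\operatorname{per}(P)$ is the sum of the lengths of its sides in the norm $\|\cdot\|$. A convex polygon is circumscribed about an anticircle if it contains it and each line containing a side of the polygon supports it. A Zenodorus $n$-gon is a convex $n$-gon $P$ circumscribed about some anticircle $I'$ that has the smallest area among all $n$-gons circumscribed about $I'$. *)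

(* Defs.v *)
From HB Require Import structures.
From mathcomp Require Import all_boot all_order all_algebra.
From mathcomp Require Import sesquilinear.
From mathcomp Require Import all_classical all_reals all_analysis.

Set Implicit Arguments.
Unset Strict Implicit.
Unset Printing Implicit Defensive.

Import Order.TTheory GRing.Theory Num.Theory.
Import numFieldNormedType.Exports.

Local Open Scope classical_set_scope.
Local Open Scope ring_scope.

Definition lincomb2 (R : realType) (V : normedModType R) (e1 e2 : V)
  (st : R * R) : V := st.1 *: e1 + st.2 *: e2.

Definition is_basis2 (R : realType) (V : normedModType R) (e1 e2 : V) : Prop :=
  bijective (lincomb2 e1 e2).

(* Lebesgue measure read in the coordinates (e1, e2), scaled so that the
   parallelogram spanned by u and v has area `|om u v|; for a bilinear
   alternating om it does not depend on the choice of the basis. *)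
Definition area (R : realType) (V : normedModType R) (e1 e2 : V)
    (om : V -> V -> R) (A : set V) : \bar R :=
  (`|om e1 e2|%:E *
    (@lebesgue_measure R \x @lebesgue_measure R) (lincomb2 e1 e2 @^-1` A))%E.

Definition antinorm (R : realType) (V : normedModType R) (om : V -> V -> R)
  (x : V) : R := sup [set om x y | y in [set y : V | `|y| = 1]].

(* The closed region bounded by an anticircle. *)
Definition antidisc (R : realType) (V : normedModType R) (om : V -> V -> R)
  (c : V) (rho : R) : set V := [set z | antinorm om (z - c) <= rho].

(* A polygon is given by the cyclic list p of its vertices; its i-th side joins
   vertex i to vertex i + 1 mod (size p). *)
Definition vertex (R : realType) (V : normedModType R) (p : seq V) (i : nat)
  : V := p`_(i %% size p).

Definition side_point (R : realType) (V : normedModType R) (p : seq V)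
  (i : nat) (t : R) : V := (1 - t) *: vertex p i + t *: vertex p i.+1.

Definition polyline (R : realType) (V : normedModType R) (p : seq V) : set V :=
  [set x | exists (i : nat) (t : R),
     [/\ (i < size p)%N, 0 <= t <= 1 & x = side_point p i t]].

(* Injectivity of the closed polygonal path: it forces consecutive vertices to
   differ, but vertices with a straight angle are allowed. *)
Definition simple_closed (R : realType) (V : normedModType R) (p : seq V)
    : Prop :=
  forall (i j : nat) (s t : R), (i < size p)%N -> (j < size p)%N ->
    0 <= s < 1 -> 0 <= t < 1 ->
    side_point p i s = side_point p j t -> i = j /\ s = t.

Definition region (R : realType) (V : normedModType R) (p : seq V) : set V :=
  polyline p `|`
  [set x | ~ polyline p x /\
           bounded_set (connected_component (~` polyline p) x)].

Definition perimeter (R : realType) (V : normedModType R) (p : seq V) : R :=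
  \sum_(i < size p) `|vertex p i.+1 - vertex p i|.

Definition ngon (R : realType) (V : normedModType R) (n : nat) (p : seq V)
    : Prop :=
  [/\ (3 <= size p <= n)%N, simple_closed p & (region p)° !=set0].

(* For a <> b and om non-degenerate alternating on a plane, the line through
   a and b is the zero set of om (b - a) (_ - a). *)
Definition line_supports (R : realType) (V : normedModType R)
    (om : V -> V -> R) (a b : V) (A : set V) : Prop :=
  (exists t : R, A ((1 - t) *: a + t *: b)) /\
  ((forall z, A z -> 0 <= om (b - a) (z - a)) \/
   (forall z, A z -> om (b - a) (z - a) <= 0)).

Definition circumscribed (R : realType) (V : normedModType R)
    (om : V -> V -> R) (p : seq V) (A : set V) : Prop :=
  [/\ convex_set (region p), A `<=` region p &
      forall i, (i < size p)%N ->
        line_supports om (vertex p i) (vertex p i.+1) A].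

Definition zenodorus (R : realType) (V : normedModType R) (e1 e2 : V)
    (om : V -> V -> R) (n : nat) (p : seq V) : Prop :=
  exists (c : V) (rho : R),
    [/\ 0 < rho, ngon n p, circumscribed om p (antidisc om c rho) &
        forall q : seq V, ngon n q -> circumscribed om q (antidisc om c rho) ->
          (area e1 e2 om (region p) <= area e1 e2 om (region q))%E].

(* Main.v *)
(** A polygon [p] is first replaced by a convex one: among the cyclic lists of
    vertices that still span the hull of [p] and are not longer than [p], one
    with the fewest vertices and then of least Euclidean length bounds a convex
    polygon [q]; the area does not decrease, and strictly increases if the
    region of [p] was not already convex.

    The anticircle of radius 1 is the polar body of the unit ball, so the polygon
    [h] circumscribed about it whose sides are parallel to those of [q] has
    supporting numbers equal to the norms of the sides: the mixed area of [q] and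
    [h] is half the perimeter of [q], and the area of [h] is half its own
    perimeter. Minkowski's inequality gives
    4 area(q) area(h) <= per(q) ^ 2, with equality only if [q] is homothetic to
    [h], that is, circumscribed about an anticircle. A polygon circumscribed
    about an anticircle of radius rho has area rho * per / 2, and the two
    implications follow by rescaling competitors to the given perimeter. *)

Require Import Defs.
From mathcomp Require Import all_boot all_order all_algebra.
From mathcomp Require Import sesquilinear.
From mathcomp Require Import all_classical all_reals all_analysis.
From mathcomp Require Import measurable_realfun.
From mathcomp Require Import zify ring lra.

Set Implicit Arguments.
Unset Strict Implicit.
Unset Printing Implicit Defensive.

Import Order.TTheory GRing.Theory Num.Theory.
Import numFieldNormedType.Exports.

Local Open Scope classical_set_scope.
Local Open Scope ring_scope.

(** * Symplectic planes *)

Section SymplecticPlane.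
Context (R : realType) (V : normedModType R) (e1 e2 : V).
Hypothesis basis_e : is_basis2 e1 e2.
Context (om : {biscalar V}).
Hypothesis om_alt : forall x : V, om x x = 0.
Hypothesis om_nondeg : forall x : V, (forall y : V, om x y = 0) -> x = 0.

(** Minkowski's inequality is obtained without mixed volumes: subtracting from [q] a multiple of its
    polar polygon leaves a closed polygon whose sides have the same directions and signed lengths,
    and for one scale its signed area is nonpositive; completing the square in the scale does the
    rest.

    The Jordan curve theorem is avoided. For an arbitrary simple polygon only the inclusion of its
    region in its hull is used; the two agree when the region is convex or has the area of the hull.
    But [circumscribed] speaks of the sides of [p] itself, which may have straight angles and either
    orientation, so it must be shown that a simple path bounding a convex region runs along the
    boundary of the hull.

    Sides of the polar polygon may degenerate, so its vertices pass through the hull construction a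
    second time. This bounds its perimeter only from above, which is the direction that both
    implications use. *)

Lemma omDl x y z : om (x + y) z = om x z + om y z. Proof. exact: linearDl. Qed.
Lemma omDr x y z : om x (y + z) = om x y + om x z. Proof. exact: linearDr. Qed.
Lemma omZl a x z : om (a *: x) z = a * om x z. Proof. exact: linearZl_LR. Qed.
Lemma omZr a x z : om x (a *: z) = a * om x z. Proof. exact: linearZr_LR. Qed.
Lemma omNl x z : om (- x) z = - om x z. Proof. exact: linearNl. Qed.
Lemma omNr x z : om x (- z) = - om x z. Proof. exact: linearNr. Qed.
Let omE := (omDl, omDr, omZl, omZr, omNl, omNr, om_alt).

Lemma omC x y : om x y = - om y x.
Proof.
have := om_alt (x + y); rewrite !omE => h; apply/eqP; rewrite -addr_eq0.
by rewrite -h add0r addr0.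
Qed.

Lemma om_sumr (I : Type) (r : seq I) (P : pred I) (F : I -> V) x :
  om x (\sum_(i <- r | P i) F i) = \sum_(i <- r | P i) om x (F i).
Proof. by rewrite linear_sumr. Qed.

Lemma basis_coord x : exists a b, x = a *: e1 + b *: e2.
Proof.
case: basis_e => g _ /(_ x) <-; rewrite /lincomb2.
by exists (g x).1, (g x).2.
Qed.

Lemma om_basis a b c d :
  om (a *: e1 + b *: e2) (c *: e1 + d *: e2) = (a * d - b * c) * om e1 e2.
Proof. rewrite !omE (omC e2 e1); ring. Qed.

Lemma basis_om_neq0 : om e1 e2 != 0.
Proof.
apply/eqP => h.
have om0 x y : om x y = 0.
  have [a [b ->]] := basis_coord x; have [c [d ->]] := basis_coord y.
  by rewrite om_basis h mulr0.
have e0 (x : V) : x = 0 by apply: om_nondeg => y; exact: om0.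
have [g gK _] := basis_e.
have h1 : (1 : R, 0 : R) = (0, 0).
  by rewrite -(gK (1, 0)) -[RHS]gK (e0 (lincomb2 _ _ (1, 0))) (e0 (lincomb2 _ _ (0, 0))).
by have /eqP := congr1 fst h1; rewrite /= oner_eq0.
Qed.

(** Cramer's rule without division: any three vectors of the plane are linearly dependent, with
    these coefficients. *)
Lemma om_decomp f g x : om f g *: x = om x g *: f + om f x *: g.
Proof.
have [a [b ->]] := basis_coord x; have [c [d ->]] := basis_coord f.
have [i [j ->]] := basis_coord g.
rewrite !om_basis !scalerDr !scalerA addrACA -!scalerDl.
by congr (_ *: _ + _ *: _); ring.
Qed.

Lemma om_coord f g x : om f g != 0 ->
  x = (om x g / om f g) *: f + (om f x / om f g) *: g.
Proof.
move=> fg; rewrite ![_ / om f g]mulrC -!scalerA -scalerDr -om_decomp scalerA.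
by rewrite mulVf // scale1r.
Qed.

Lemma om_inj f g x y : om f g != 0 -> om f x = om f y -> om g x = om g y -> x = y.
Proof.
move=> fg h1 h2; rewrite (om_coord x fg) (om_coord y fg) h1.
by rewrite (omC x) (omC y) h2.
Qed.

Lemma om_exists f : f != 0 -> exists h, om f h = 1.
Proof.
move=> f0; have [|] := pselect (exists y, om f y != 0).
  by move=> [y fy]; exists ((om f y)^-1 *: y); rewrite omZr mulVf.
move=> h; exfalso; move/eqP: f0; apply; apply: om_nondeg => y.
by apply/eqP; apply: contrapT => /negP fy; apply: h; exists y.
Qed.

Lemma om0l x : om 0 x = 0. Proof. exact: linear0l. Qed.
Lemma om0r x : om x 0 = 0. Proof. exact: linear0r. Qed.

Lemma om_parallel f x : f != 0 -> om f x = 0 -> exists l, x = l *: f.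
Proof.
move=> f0 fx; have [h fh] := om_exists f0.
by exists (om x h); have := om_decomp f h x; rewrite fh fx scale1r scale0r addr0.
Qed.

(* Hahn-Banach in the plane: the value of the extension on [h] is the supremum
   of the lower bounds forced by the norm. *)
Lemma om_dual_norm f : exists z, om f z = `|f| /\ forall y, `|om z y| <= `|y|.
Proof.
have [->|f0] := eqVneq f 0.
  by exists 0; rewrite om0l normr0; split=> // y; rewrite om0l normr0.
have [h fh] := om_exists f0.
pose A := [set - s * `|f| - `|s *: f - h| | s in [set: R]].
have A0 : A !=set0 by exists (- 0 * `|f| - `|0 *: f - h|), 0.
(* Each lower bound for the value at [h] lies below each upper bound, by the triangle inequality for
   [(s + s') *: f]. *)
have key s s' : - s * `|f| - `|s *: f - h| <= `|s' *: f + h| + s' * `|f|.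
  have : - (s + s') * `|f| <= `|s *: f - h| + `|s' *: f + h|.
    apply: (@le_trans _ _ `|(s + s') *: f|).
      by rewrite normrZ ler_wpM2r // -normrN ler_norm.
    rewrite (_ : (s + s') *: f = (s *: f - h) + (s' *: f + h)) ?ler_normD //.
    by rewrite scalerDl addrACA addNr addr0.
  by move: (`|_|) (`|_|) (`|_|) => a b c; lra.
have uA s' : ubound A (`|s' *: f + h| + s' * `|f|) by move=> _ [s _ <-].
have sA : has_sup A by split => //; exists (`|0 *: f + h| + 0 * `|f|).
(* With this [z], the form [om z] takes the value [sup A] at [h] and minus the norm of [f] at
   [f]. *)
exists (sup A *: f + `|f| *: h).
split; first by rewrite omDr !omZr om_alt fh; ring.
have half y : om (sup A *: f + `|f| *: h) y <= `|y|.
  rewrite {2}(om_coord y (f := f) (g := h)) ?fh ?oner_eq0 // !divr1.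
  set s := om y h; set t := om f y.
  rewrite omDl !omZl (omC h y) -/s -/t.
  have [t0|t0|->] := ltgtP t 0; last first.
  - rewrite scale0r addr0 normrZ mulr0 add0r mulrN.
    by rewrite -mulrN mulrC ler_wpM2r // -normrN ler_norm.
  - have /ge_sup : ubound A (`|(s / t) *: f + h| + (s / t) * `|f|) by exact: uA.
    move=> /(_ A0) le.
    have -> : s *: f + t *: h = t *: ((s / t) *: f + h).
      by rewrite scalerDr scalerA mulrCA divff ?mulr1 // gt_eqF.
    rewrite normrZ gtr0_norm // -(ler_pM2l t0) in le *.
    move: le; rewrite mulrDr (mulrA t (s / t)) (mulrCA t s) divff ?gt_eqF // mulr1.
    move: (`|_|) (`|_|) => a b; lra.
  - have /(ub_le_sup (proj2 sA)) le : A (- (s / - t) * `|f| - `|(s / - t) *: f - h|).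
      by exists (s / - t).
    have -> : s *: f + t *: h = (- t) *: ((s / - t) *: f - h).
      rewrite scalerBr scalerA mulrCA divff ?mulr1 ?oppr_eq0 ?lt_eqF //.
      by rewrite scaleNr opprK.
    have t0' : 0 < - t by rewrite oppr_gt0.
    rewrite normrZ gtr0_norm // -(ler_pM2l t0') in le *.
    move: le; rewrite mulrBr mulNr mulrN (mulrA (- t) (s / - t)) (mulrCA (- t) s).
    rewrite divff ?gt_eqF // mulr1.
    move: (`|_|) (`|_|) => a b; lra.
by move=> y; rewrite ler_norml half andbT lerNl -omNr -[`|y|]normrN half.
Qed.

(** [om_dual_norm], applied to [e1] and then to the vector it yields, gives two independent vectors
    whose forms are bounded by the norm, and [x] is a combination of them. *)
Lemma om_bounded x : exists M, forall y, `|om x y| <= M * `|y|.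
Proof.
have e0 : e1 != 0.
  by apply/eqP => h; have := basis_om_neq0; rewrite h om0l eqxx.
have [z1 [ez1 z1b]] := om_dual_norm e1.
have z10 : z1 != 0.
  by apply/eqP => h; move/eqP: ez1; rewrite h om0r eq_sym normr_eq0 (negPf e0).
have [z2 [z12 z2b]] := om_dual_norm z1.
have z120 : om z1 z2 != 0 by rewrite z12 normr_eq0.
rewrite (om_coord x z120); set a := _ / _; set b := _ / _.
exists (`|a| + `|b|) => y; rewrite omDl !omZl (le_trans (ler_normD _ _)) //.
by rewrite !normrM mulrDl lerD // ler_wpM2l.
Qed.

Lemma om_continuous x : continuous (om x).
Proof.
have [M Mb] := om_bounded x.
apply/linear_bounded_continuous/linear_boundedP.
near=> r => y; rewrite (le_trans (Mb y)) // ler_wpM2r //.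
Unshelve. all: by end_near. Qed.

End SymplecticPlane.

(** * Minkowski's inequality for a convex polygon and its polar polygon *)

Section Cyclic.
Context (T : Type) (m : nat).

Lemma sum_cyclic_shift (U : nmodType) (F : nat -> U) :
  F m = F 0%N -> \sum_(i < m) F i.+1 = \sum_(i < m) F i.
Proof.
case: m => [|k] Fk; first by rewrite !big_ord0.
by rewrite big_ord_recr big_ord_recl /= Fk addrC.
Qed.

Lemma sum_cyclic_telescope (U : zmodType) (F : nat -> U) :
  F m = F 0%N -> \sum_(i < m) (F i.+1 - F i) = 0.
Proof. by move=> Fm; rewrite sumrB sum_cyclic_shift // subrr. Qed.

Lemma periodic_addMn (F : nat -> T) : (forall i, F (i + m)%N = F i) ->
  forall k i, F (i + k * m)%N = F i.
Proof.
by move=> Fm; elim=> [|k IH] i; rewrite ?mul0n ?addn0 // mulSn addnCA addnC Fm IH.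
Qed.

Lemma periodic_modn (F : nat -> T) : (forall i, F (i + m)%N = F i) ->
  forall i, F (i %% m)%N = F i.
Proof. by move=> Fm i; rewrite {2}(divn_eq i m) addnC periodic_addMn. Qed.

Lemma periodic_change (P : pred nat) : (0 < m)%N -> (forall i, P (i + m)%N = P i) ->
  forall a b, P a -> ~~ P b -> exists i, P i && ~~ P i.+1.
Proof.
move=> m0 Pm a b Pa.
have PM : forall k i, P (i + k * m)%N = P i.
  by elim=> [|k IH] i; rewrite ?mul0n ?addn0 // mulSn addnCA addnC Pm IH.
rewrite -(PM a b) => nPb.
have : (a <= b + a * m)%N.
  by rewrite (leq_trans _ (leq_addl _ _)) // leq_pmulr.
move: (b + a * m)%N nPb => c nPc ac; rewrite -(subnKC ac) in nPc.
elim: (c - a)%N nPc => [|k IH]; first by rewrite addn0 Pa.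
rewrite addnS => nP; have [Pk|] := boolP (P (a + k)%N); last exact: IH.
by exists (a + k)%N; rewrite Pk.
Qed.

End Cyclic.

Section Minkowski.
Context (R : realType) (V : normedModType R) (e1 e2 : V).
Hypothesis basis_e : is_basis2 e1 e2.
Context (om : {biscalar V}).
Hypothesis om_alt : forall x : V, om x x = 0.
Hypothesis om_nondeg : forall x : V, (forall y : V, om x y = 0) -> x = 0.

Let omE := (omDl om, omDr om, omZl om, omZr om, omNl om, omNr om, om_alt).
Let omC := omC om_alt.
Let om_decomp := om_decomp basis_e om_alt.
Let om_inj := om_inj basis_e om_alt.

Lemma om_plucker a b c d :
  om a b * om c d + om b c * om a d + om c a * om b d = 0.
Proof.
have /(congr1 (fun x => om x d)) := om_decomp a b c.
rewrite !omE (omC c b) (omC a c) => ->; ring.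
Qed.

Lemma exists_transversal (l : seq V) : (forall x, x \in l -> x != 0) ->
  exists g : V, forall x, x \in l -> om g x != 0.
Proof.
(* For each [x] with [om e2 x != 0], the affine function [k => om (e1 + k *: e2) x] vanishes only at
   minus the quotient summed here; [B + 1] exceeds all these roots. When [om e2 x] is 0 the quotient
   is 0 by convention and adds nothing. *)
move=> l0; pose B : R := \sum_(x <- l) `|om e1 x / om e2 x|.
exists (e1 + (B + 1) *: e2) => x xl; rewrite omDl omZl; apply/eqP => h.
have [z|nz] := eqVneq (om e2 x) 0.
  move: h; rewrite z mulr0 addr0 => z'; have /eqP := l0 _ xl; apply.
  apply: (om_inj (f := e1) (g := e2)); rewrite ?om0r //.
  exact: (basis_om_neq0 basis_e om_alt om_nondeg).
have : B + 1 <= `|om e1 x / om e2 x|.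
  have -> : B + 1 = - (om e1 x / om e2 x).
    by apply: (mulIf nz); rewrite mulNr divfK //; lra.
  by rewrite -normrN ler_norm.
rewrite leNgt; move/negP; apply; rewrite (@le_lt_trans _ _ B) ?ltrDl //.
by rewrite /B (big_rem x xl) /= lerDl sumr_ge0.
Qed.

Context (m : nat) (v : nat -> V).
Hypothesis m_gt0 : (0 < m)%N.
Hypothesis v_per : forall i, v (i + m)%N = v i.
Context (f : nat -> V).
Hypothesis f_edge : forall i, f i = v i.+1 - v i.
Hypothesis turn : forall i, 0 < om (f i) (f i.+1).
Hypothesis support : forall i k, 0 <= om (f i) (v k - v i).

Let s i := om (f i) (f i.+1).
Let b i := `|f i|.

Let f_per i : f (i + m)%N = f i.
Proof. by rewrite !f_edge -addSn !v_per. Qed.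

Let f_neq0 i : f i != 0.
Proof. by apply/eqP => h; have := turn i; rewrite h om0l ltxx. Qed.

Let b_gt0 i : 0 < b i. Proof. by rewrite normr_gt0. Qed.

Let supportS i k : 0 <= om (f i) (v k - v i.+1).
Proof.
have -> : v k - v i.+1 = (v k - v i) - f i by rewrite f_edge opprB addrA subrK.
by rewrite omDr omNr om_alt oppr0 addr0.
Qed.

(** If [f i] were strictly between [f k] and [f k.+1], the form [om (f i)] would attain its least
    value over the vertices at [v k.+1] alone; but it is least at both ends of side [i]. *)
Lemma no_edge_between i k : ~ (0 < om (f k) (f i) /\ 0 < om (f i) (f k.+1)).
Proof.
move=> [ki ik].
have dec x : s k * om (f i) x = om (f i) (f k.+1) * om (f k) x
                                + om (f k) (f i) * om (f k.+1) x.
  by rewrite -!omZl -omDl -om_decomp.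
have atv j : 0 = om (f i) (v j - v k.+1) -> v j = v k.+1.
  move=> h; apply/eqP; rewrite -subr_eq0; apply/eqP.
  have := dec (v j - v k.+1); rewrite -h mulr0 => /esym/eqP.
  rewrite paddr_eq0 ?mulr_ge0 // 1?ltW // !mulf_eq0 (gt_eqF ki) (gt_eqF ik) /=.
  case/andP => /eqP z1 /eqP z2.
  have tk : om (f k) (f k.+1) != 0 by rewrite gt_eqF.
  by apply: (om_inj tk); rewrite om0r.
have vi : 0 = om (f i) (v i - v k.+1).
  apply/eqP; rewrite eq_le; apply/andP; split; last first.
    by rewrite -opprB omNr oppr_le0.
  rewrite -(pmulr_rge0 _ (turn k)) dec.
  by rewrite addr_ge0 ?mulr_ge0 // ltW.
have vi1 : 0 = om (f i) (v i.+1 - v k.+1).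
  by rewrite {1}vi (_ : v i.+1 - v k.+1 = f i + (v i - v k.+1)) ?omDr ?om_alt
    ?add0r // f_edge addrA subrK.
by have := f_neq0 i; rewrite f_edge (atv _ vi) (atv _ vi1) subrr eqxx.
Qed.

(* The [y i] are the vertices of the polygon circumscribed about the unit
   anticircle whose sides have the directions [f i]; a side may degenerate. *)
Context (y : nat -> V).
Hypothesis om_polar_vertex : forall i, om (f i) (y i) = - `|f i|.
Hypothesis om_polar_vertexS : forall i, om (f i.+1) (y i) = - `|f i.+1|.

Lemma polar_vertex_per i : y (i + m)%N = y i.
Proof.
have t : om (f i) (f i.+1) != 0 by rewrite gt_eqF.
apply: (om_inj t); first by rewrite -{1}f_per !om_polar_vertex f_per.
by rewrite -{1}f_per addSn !om_polar_vertexS -addSn f_per.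
Qed.

(** In [s k *: f i = A *: f k + B *: f k.+1], two positive coefficients would make the triangle
    inequality point the wrong way; [no_edge_between] excludes them. Once a nonpositive term is
    moved to the other side, the triangle inequality is exactly the claim. *)
Lemma polar_vertex_support i k : - `|f i| <= om (f i) (y k).
Proof.
have dec : s k *: f i = om (f i) (f k.+1) *: f k + om (f k) (f i) *: f k.+1.
  exact: om_decomp.
rewrite -(ler_pM2l (turn k)) -[X in _ <= X]omZl dec !omE om_polar_vertex om_polar_vertexS.
have sf : `|s k *: f i| = om (f k) (f k.+1) * `|f i| by rewrite normrZ gtr0_norm ?turn.
have nb := @no_edge_between i k.
move: dec sf nb; set A := om (f i) _; set B := om (f k) (f i).
move=> dec sf nb.
have [A0|A0] := leP A 0.
  have : B * b k.+1 <= om (f k) (f k.+1) * b i + - A * b k.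
    rewrite (@le_trans _ _ `|B *: f k.+1|) //; first by rewrite normrZ /b ler_wpM2r ?ler_norm.
    rewrite -sf -(ler0_norm A0) -normrZ -[`|A *: _|]normrN (le_trans _ (ler_normD _ _)) //.
    by rewrite dec addrC addKr.
  rewrite /b; lra.
have [B0|B0] := leP B 0; last by case: nb.
have : A * b k <= om (f k) (f k.+1) * b i + - B * b k.+1.
  rewrite (@le_trans _ _ `|A *: f k|) //; first by rewrite normrZ /b ler_wpM2r ?ler_norm.
  rewrite -sf -(ler0_norm B0) -normrZ -[`|B *: _|]normrN (le_trans _ (ler_normD _ _)) //.
  by rewrite dec addrK.
rewrite /b; lra.
Qed.

(** The sign of [l] comes from the supporting line of direction [f i], on whose good side [y i.+1]
    lies; [l = 0] is a degenerate side. *)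
Lemma polar_edge i : exists2 l, 0 <= l & y i.+1 - y i = l *: f i.+1.
Proof.
have [|l hl] := om_parallel basis_e om_alt om_nondeg (f_neq0 i.+1) (x := y i.+1 - y i).
  by rewrite !omE om_polar_vertex om_polar_vertexS subrr.
exists l => //.
have : 0 <= om (f i) (y i.+1 - y i).
  by rewrite !omE om_polar_vertex opprK -lerBlDr sub0r polar_vertex_support.
by rewrite hl omZr pmulr_lge0.
Qed.

Lemma polar_perimeter :
  \sum_(i < m) `|y i.+1 - y i| = \sum_(i < m) om (y i) (y i.+1).
Proof.
apply: eq_bigr => i _; have [l l0 hl] := polar_edge i.
rewrite -[y i.+1](subrK (y i)) omDr om_alt addr0 addrK hl omZr omC.
by rewrite om_polar_vertexS opprK normrZ ger0_norm.
Qed.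

Let sv := \sum_(i < m) om (v i) (v i.+1).
Let sy := \sum_(i < m) om (y i) (y i.+1).
Let per := \sum_(i < m) b i.

(** The shift of index matches corners: [v i.+1] and [y i] are both the corner between the sides of
    directions [f i] and [f i.+1]. The mixed terms reduce to the norms of the sides up to a
    telescoping sum. *)
Lemma mixed_area_expansion r :
  \sum_(i < m) om (v i.+1 - r *: y i) (v i.+2 - r *: y i.+1) =
  sv - 2 * r * per + r ^+ 2 * sy.
Proof.
pose H i := om (v i.+1) (y i).
have step i : om (v i.+1 - r *: y i) (v i.+2 - r *: y i.+1) =
   om (v i.+1) (v i.+2) - r * (H i.+1 - H i + 2 * b i.+1) + r ^+ 2 * om (y i) (y i.+1).
  rewrite /H !omE.
  have h1 := om_polar_vertex i.+1; have h2 := om_polar_vertexS i.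
  rewrite (omC (y i) (v i.+2)) /b.
  have h3 : om (v i.+2) (y i.+1) = om (v i.+1) (y i.+1) - `|f i.+1|.
    by move: h1; rewrite f_edge !omE => h1; lra.
  have h4 : om (v i.+2) (y i) = om (v i.+1) (y i) - `|f i.+1|.
    by move: h2; rewrite f_edge !omE => h2; lra.
  by rewrite h3 h4; ring.
under eq_bigr do rewrite step.
rewrite big_split /= sumrB -!mulr_sumr big_split /= -mulr_sumr.
rewrite sum_cyclic_telescope; last by rewrite /H -[m]add0n polar_vertex_per -addSn v_per.
rewrite (@sum_cyclic_shift m _ (fun i => om (v i) (v i.+1))); last first.
  by rewrite -[m]add0n v_per -addSn v_per.
rewrite (@sum_cyclic_shift m _ b); last by rewrite /b -[m]add0n f_per.
by rewrite /sv /per /sy; ring.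
Qed.

Section Sector.
Context (g : V).
Hypothesis g_gen : forall i, om g (f i) != 0.
Let phi i := om g (f i).

(* Abel summation along the heights [om g (x i) - c] over a line of direction
   [g]. *)
Lemma area_parallel_polygon (x : nat -> V) (c : R) :
  (forall i, x (i + m)%N = x i) ->
  (forall i, om (f i.+1) (x i.+1 - x i) = 0) ->
  \sum_(i < m) om (x i) (x i.+1) =
  - \sum_(i < m) (om g (x i) - c) ^+ 2 * (s i / (phi i * phi i.+1)).
Proof.
move=> x_per x_par.
have g0 : g != 0 by apply/eqP => h; have := g_gen 0; rewrite h om0l eqxx.
have [h gh] := om_exists om_nondeg g0.
pose xi i := om (x i) h; pose eta i := om g (x i) - c.
(* [sg i] is the inverse slope of [f i] in the coordinates given by [om _ h] and [om g _]. Below,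
   [tau] recognizes the weights as the drops of [sg], and [G] is the discrete primitive left by
   summation by parts. *)
pose sg i := om (f i) h / phi i.
pose G i := xi i * eta i - sg i * eta i ^+ 2 - c * xi i.
have G_per : G m = G 0%N.
  by rewrite /G /xi /eta /sg /phi -[m]add0n x_per f_per.
have tau i : s i / (phi i * phi i.+1) = sg i - sg i.+1.
  have := om_plucker g h (f i) (f i.+1).
  rewrite gh mul1r (omC h) (omC (f i) g) (omC h) -/(phi _) -/(phi _) -/(s i) /sg => e.
  have pi0 := g_gen i; have pi1 := g_gen i.+1; rewrite -!/(phi _) in pi0 pi1.
  by rewrite (_ : s i = om (f i) h * phi i.+1 - om (f i.+1) h * phi i) ?[RHS]mulrC; [field; rewrite pi0 pi1|lra].
have step i : om (x i) (x i.+1) =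
    (G i.+1 - G i) - eta i ^+ 2 * (s i / (phi i * phi i.+1)).
  have dx : xi i.+1 - xi i = sg i.+1 * (eta i.+1 - eta i).
    have := om_plucker g h (f i.+1) (x i.+1 - x i).
    rewrite gh x_par (omC h (f i.+1)) (omC (f i.+1) g) -/(phi _) /sg.
    have pi1 := g_gen i.+1; rewrite -!/(phi _) in pi1.
    rewrite !omE (omC h (x i.+1)) (omC h (x i)) -/(xi _) -/(xi _) => e.
    apply: (mulIf pi1); rewrite /eta mulrAC divfK //; lra.
  have -> : om (x i) (x i.+1) = xi i * (eta i.+1 + c) - (eta i + c) * xi i.+1.
    have := om_plucker g h (x i) (x i.+1).
    rewrite gh (omC h (x i)) (omC h (x i.+1)) (omC (x i) g) -/(xi _) -/(xi _) /eta.
    by lra.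
  rewrite tau /G; move: dx; move: (xi i.+1) (xi i) (eta i) (eta i.+1) (sg i) (sg i.+1).
  by move=> p q t u w z /eqP; rewrite subr_eq => /eqP ->; ring.
under eq_bigr do rewrite step.
by rewrite sumrB sum_cyclic_telescope // sub0r.
Qed.

End Sector.

(* With [r] chosen so that [v - r y] has the same height over a line of direction
   [g] at the two sign changes of [om g (f i)], every term of the Abel summation
   has the same sign: the area of [v - r y] is nonpositive. *)
Lemma minkowski_polar : 0 < sy /\ sv * sy <= per ^+ 2 /\
  (sv * sy = per ^+ 2 -> exists r t,
     [/\ 0 < r, r * sy = per & forall i, v i.+1 = t + r *: y i]).
Proof.
have [g g_gen0] := @exists_transversal [seq f i | i <- iota 0 m]
  (fun x => ltac:(by move=> /mapP[i _ ->])).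
have g_gen i : om g (f i) != 0.
  rewrite -(periodic_modn f_per) g_gen0 //; apply/mapP; exists (i %% m)%N => //.
  by rewrite mem_iota add0n ltn_pmod.
pose phi i := om g (f i).
have phi_per i : phi (i + m)%N = phi i by rewrite /phi f_per.
have phi_sum : \sum_(i < m) phi i = 0.
  rewrite -om_sumr; under eq_bigr do rewrite f_edge.
  rewrite sum_cyclic_telescope ?om0r //.
  by rewrite -[m]add0n v_per.
have phi_neg : exists i, phi i < 0.
  apply: contrapT => h; have pos i : 0 < phi i.
    by rewrite lt_neqAle eq_sym g_gen /= leNgt; apply/negP => ?; apply: h; exists i.
  move: phi_sum; case: (m) m_gt0 => // k _; rewrite big_ord_recl => /eqP.
  by rewrite gt_eqF // ltr_pwDl // sumr_ge0 // => i _; exact/ltW.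
have phi_pos : exists i, 0 < phi i.
  apply: contrapT => h; have neg i : phi i < 0.
    by rewrite lt_neqAle g_gen /= leNgt; apply/negP => ?; apply: h; exists i.
  move: phi_sum; case: (m) m_gt0 => // k _; rewrite big_ord_recl => /eqP.
  by rewrite lt_eqF // ltr_nwDl // sumr_le0 // => i _; exact/ltW.
have [ip pp] := phi_pos; have [jn pn] := phi_neg.
have nlt i : ~~ (0 < phi i) -> phi i < 0.
  by rewrite -leNgt lt_neqAle g_gen.
(* At the sign change [i0] from plus to minus, [v i0.+1] and [y i0] are the highest points over a
   line of direction [g]; at the opposite change [i1], [v i1.+1] and [y i1] are the lowest. *)
have [i0 /andP[i0p /nlt i0n]] : exists i, (0 < phi i) && ~~ (0 < phi i.+1).
  apply: (@periodic_change m (fun i => 0 < phi i) m_gt0 _ ip jn) => //.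
    by move=> i; rewrite phi_per.
  by rewrite -leNgt ltW.
have nlt' i : ~~ (phi i < 0) -> 0 < phi i.
  by rewrite -leNgt lt_neqAle eq_sym g_gen.
have [i1 /andP[i1n /nlt' i1p]] : exists i, (phi i < 0) && ~~ (phi i.+1 < 0).
  apply: (@periodic_change m (fun i => phi i < 0) m_gt0 _ jn ip) => //.
    by move=> i; rewrite phi_per.
  by rewrite -leNgt ltW.
have dec i x : s i * om g x = phi i.+1 * om (f i) x - phi i * om (f i.+1) x.
  by rewrite -!omZl -omNl -omDl om_decomp (omC (f i) g) scaleNr.
have gmaxv i k : 0 < phi i -> phi i.+1 < 0 -> om g (v k) <= om g (v i.+1).
  move=> h1 h2; rewrite -subr_le0 -omNr -omDr -(pmulr_rle0 _ (turn i)) dec.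
  rewrite subr_le0 (@le_trans _ _ 0) //.
    by rewrite mulr_le0_ge0 ?supportS // ltW.
  by rewrite mulr_ge0 // ltW.
have gminv i k : phi i < 0 -> 0 < phi i.+1 -> om g (v i.+1) <= om g (v k).
  move=> h1 h2; rewrite -subr_ge0 -omNr -omDr -(pmulr_rge0 _ (turn i)) dec.
  rewrite subr_ge0 (@le_trans _ _ 0) //.
    by rewrite mulr_le0_ge0 // ltW.
  by rewrite mulr_ge0 ?supportS // ltW.
have gmaxy i k : 0 < phi i -> phi i.+1 < 0 -> om g (y k) <= om g (y i).
  move=> h1 h2; rewrite -(ler_pM2l (turn i)) !dec om_polar_vertex om_polar_vertexS.
  by apply: lerB; [apply: ler_wnM2l|apply: ler_wpM2l]; rewrite ?polar_vertex_support // ltW.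
have gminy i k : phi i < 0 -> 0 < phi i.+1 -> om g (y i) <= om g (y k).
  move=> h1 h2; rewrite -(ler_pM2l (turn i)) !dec om_polar_vertex om_polar_vertexS.
  by apply: lerB; [apply: ler_wpM2l|apply: ler_wnM2l]; rewrite ?polar_vertex_support // ltW.
have y0 : 0 < om g (y i0).
  rewrite -(pmulr_rgt0 _ (turn i0)) dec om_polar_vertex om_polar_vertexS.
  have h1 : phi i0.+1 * `|f i0| < 0 by rewrite nmulr_rlt0 // b_gt0.
  have h2 : 0 < phi i0 * `|f i0.+1| by rewrite mulr_gt0 // b_gt0.
  lra.
have y1 : om g (y i1) < 0.
  rewrite -(pmulr_rlt0 _ (turn i1)) dec om_polar_vertex om_polar_vertexS.
  have h1 : 0 < phi i1.+1 * `|f i1| by rewrite mulr_gt0 // b_gt0.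
  have h2 : phi i1 * `|f i1.+1| < 0 by rewrite nmulr_rlt0 // b_gt0.
  lra.
pose d := om g (y i0) - om g (y i1); have d0 : 0 < d by rewrite /d; lra.
pose r := (om g (v i0.+1) - om g (v i1.+1)) / d.
have r0 : 0 < r.
  rewrite divr_gt0 // subr_gt0 (le_lt_trans (gminv _ i0 i1n i1p)) //.
  by rewrite -subr_gt0 -omNr -omDr -f_edge.
pose x i := v i.+1 - r *: y i; pose c := om g (x i0).
have x_per i : x (i + m)%N = x i by rewrite /x -addSn v_per polar_vertex_per.
have x_par i : om (f i.+1) (x i.+1 - x i) = 0.
  have e1' : om (f i.+1) (v i.+2) = om (f i.+1) (v i.+1).
    by apply/eqP; rewrite -subr_eq0 -omNr -omDr -f_edge om_alt.
  by rewrite /x !omE om_polar_vertex om_polar_vertexS e1'; ring.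
have gx1 : om g (x i1) = c.
  rewrite /c /x !omE; apply/eqP; rewrite -subr_eq0; apply/eqP.
  have : r * d = om g (v i0.+1) - om g (v i1.+1) by rewrite /r divfK // gt_eqF.
  by rewrite /d; lra.
(* Any sign change of [phi] occurs at a highest or at a lowest point, and the extreme heights are
   unique as values; so [i0] and [i1] stand for all of them. *)
have gx i : phi i * phi i.+1 < 0 -> om g (x i) = c.
  have [p|p|] := ltgtP (phi i) 0; last by move=> ->; rewrite mul0r ltxx.
    rewrite nmulr_rlt0 // => q; rewrite -gx1 /x !omE.
    have -> : om g (v i.+1) = om g (v i1.+1) by apply: le_anti; rewrite !gminv.
    by have -> : om g (y i) = om g (y i1) by apply: le_anti; rewrite !gminy.
  rewrite pmulr_rlt0 // => q; rewrite /c /x !omE.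
  have -> : om g (v i.+1) = om g (v i0.+1) by apply: le_anti; rewrite !gmaxv.
  by have -> : om g (y i) = om g (y i0) by apply: le_anti; rewrite !gmaxy.
have E := area_parallel_polygon g_gen c x_per x_par.
rewrite mixed_area_expansion in E.
have t_ge0 i : 0 <= (om g (x i) - c) ^+ 2 * (s i / (om g (f i) * om g (f i.+1))).
  rewrite -/(phi _) -/(phi _); have [p|p|p] := ltgtP (phi i * phi i.+1) 0.
  - by rewrite gx // subrr expr0n mul0r.
  - by rewrite mulr_ge0 ?sqr_ge0 // divr_ge0 // ltW // turn.
  - by rewrite p invr0 !mulr0.
have sy0 : 0 < sy.
  rewrite lt_neqAle; apply/andP; split; last first.
    by rewrite /sy -polar_perimeter sumr_ge0.
  (* A polar polygon of perimeter 0 would have all its [y i] equal, against the positive height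
     [d]. *)
  apply/eqP => z; have := z; rewrite /sy -polar_perimeter => /esym/eqP.
  rewrite psumr_eq0 // => /allP yeq.
  have ystep i : y i.+1 = y i.
    have yq j : (j < m)%N -> y j.+1 = y j.
      move=> jm; have := yeq (Ordinal jm) (mem_index_enum _).
      by rewrite /= normr_eq0 subr_eq0 => /eqP.
    have := yq (i %% m)%N (ltn_pmod _ m_gt0).
    rewrite (periodic_modn polar_vertex_per) => <-.
    rewrite {1}(divn_eq i m) -addnS addnC.
    by rewrite (periodic_addMn polar_vertex_per).
  have yc i : y i = y 0%N by elim: i => // i <-.
  by move: d0; rewrite /d !yc subrr ltxx.
have le0 : sv - 2 * r * per + r ^+ 2 * sy <= 0.
  by rewrite E oppr_le0 sumr_ge0.
split=> //.
(* Completion of the square in the scale: the first product is nonpositive by the choice of [r]. *)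
have sq : sv * sy = (sv - 2 * r * per + r ^+ 2 * sy) * sy + per ^+ 2 - (r * sy - per) ^+ 2.
  by ring.
have h1 : (sv - 2 * r * per + r ^+ 2 * sy) * sy <= 0 by rewrite pmulr_lle0.
split; first by rewrite sq; have := sqr_ge0 (r * sy - per); lra.
move=> eq; have h2 := sqr_ge0 (r * sy - per).
have z1 : (r * sy - per) ^+ 2 = 0 by apply: le_anti; rewrite h2; lra.
have z2 : (sv - 2 * r * per + r ^+ 2 * sy) * sy = 0 by lra.
exists r, (x 0%N); split => //.
  by apply/eqP; rewrite -subr_eq0 -sqrf_eq0 z1.
have {}z2 : sv - 2 * r * per + r ^+ 2 * sy = 0.
  by move/eqP: z2; rewrite mulf_eq0 (gt_eqF sy0) orbF => /eqP.
(* In the equality case every square in the Abel sum vanishes, so all [x i] have height [c].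
   Consecutive ones also differ by a multiple of [f i.+1], which is transversal to [g]; hence they
   coincide. *)
move: E; rewrite z2 => /esym/eqP; rewrite oppr_eq0 psumr_eq0 // => /allP E.
have gxc i : om g (x i) = c.
  have gq j : (j < m)%N -> om g (x j) = c.
    move=> jm; have := E (Ordinal jm) (mem_index_enum _); rewrite /= mulf_eq0 sqrf_eq0.
    rewrite subr_eq0 => /orP[/eqP //|].
    by rewrite mulf_eq0 invr_eq0 mulf_eq0 !(negPf (g_gen _)) (gt_eqF (turn _)).
  by rewrite -(periodic_modn x_per) gq // ltn_pmod.
have xstep i : x i.+1 = x i.
  apply/eqP; rewrite -subr_eq0; apply/eqP.
  apply: (om_inj (g_gen i.+1)); rewrite om0r ?x_par //.
  by rewrite omDr omNr !gxc subrr.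
have xc i : x i = x 0%N by elim: i => // i <-.
by move=> i; rewrite -(xc i) /x subrK.
Qed.

End Minkowski.

(** * A shortest convex polygon with a given hull *)

Section ConvexHull.
Context (R : realType) (V : normedModType R).

Definition cvx (C : set V) := forall x y (k : R), 0 <= k <= 1 ->
  C x -> C y -> C ((1 - k) *: x + k *: y).

(** As an intersection of convex sets, the hull is shown to lie in a given convex set by mere
    instantiation. *)
Definition hull (s : seq V) : set V :=
  [set x | forall C : set V, cvx C -> (forall v, v \in s -> C v) -> C x].

Lemma cvx_hull s : cvx (hull s).
Proof. by move=> x y k k01 hx hy C cC sC; exact: (cC _ _ _ k01 (hx C cC sC) (hy C cC sC)). Qed.

Lemma conv_shift (a b : V) (k : R) : (1 - k) *: a + k *: b = a + k *: (b - a).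
Proof. by rewrite scalerBl scale1r scalerBr addrAC addrA. Qed.

Lemma mem_hull s v : v \in s -> hull s v.
Proof. by move=> vs C _ /(_ v vs). Qed.

Lemma hull_sub s (C : set V) : cvx C -> (forall v, v \in s -> C v) -> hull s `<=` C.
Proof. by move=> cC sC x /(_ C cC sC). Qed.

Lemma hull_le s t : (forall v, v \in s -> hull t v) -> hull s `<=` hull t.
Proof. by move=> st; apply: hull_sub => //; exact: cvx_hull. Qed.

Lemma hull_nil x : ~ hull [::] x.
Proof. by move=> /(_ set0) h; apply: h => // ? ? ? ?. Qed.

End ConvexHull.

(** * Lengths of closed paths, measured by the norm or by a Euclidean length *)

Section ClosedPathLength.
Context (R : realType) (V : normedModType R) (N : V -> R).

Definition cper (p : seq V) : R :=
  \sum_(i < size p) N (vertex p i.+1 - vertex p i).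

Fixpoint pathlen (x : V) (s : seq V) : R :=
  if s is y :: s' then N (y - x) + pathlen y s' else 0.

Lemma pathlen_cat x s1 s2 :
  pathlen x (s1 ++ s2) = pathlen x s1 + pathlen (last x s1) s2.
Proof. by elim: s1 x => [|y s IH] x /=; rewrite ?add0r // IH addrA. Qed.

Lemma pathlen_nth x s :
  pathlen x s = \sum_(i < size s) N (s`_i - (x :: s)`_i).
Proof.
elim: s x => [|y s IH] x /=; first by rewrite big_ord0.
by rewrite big_ord_recl IH.
Qed.

Lemma cper_pathlen x s : cper (x :: s) = pathlen x (rcons s x).
Proof.
rewrite pathlen_nth size_rcons /cper /=; apply: eq_bigr => i _; congr (N (_ - _)).
  rewrite /vertex /= nth_rcons; have [lt|ge] := ltnP i (size s).
    by rewrite modn_small.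
  have -> : nat_of_ord i = size s by apply/eqP; rewrite eqn_leq ge -ltnS ltn_ord.
  by rewrite modnn eqxx.
by rewrite /vertex /= modn_small ?ltn_ord // -rcons_cons nth_rcons ltn_ord.
Qed.

Lemma cper_catC s1 s2 : cper (s1 ++ s2) = cper (s2 ++ s1).
Proof.
case: s1 => [|x a]; first by rewrite cats0.
case: s2 => [|y b]; first by rewrite cats0.
rewrite !cat_cons !cper_pathlen !rcons_cat !pathlen_cat /= -!cats1 !pathlen_cat /=.
by rewrite !addr0; ring.
Qed.

Lemma cper_rot k s : cper (rot k s) = cper s.
Proof. by rewrite /rot cper_catC cat_take_drop. Qed.

Hypothesis N_sym : forall v, N (- v) = N v.

Lemma pathlen_rev x s y :
  pathlen x (rcons s y) = pathlen y (rcons (rev s) x).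
Proof.
elim: s x y => [|z s IH] x y /=; first by rewrite !addr0 -N_sym opprB.
by rewrite IH rev_cons -!cats1 !pathlen_cat /= cats1 last_rcons !addr0 addrC
  -(N_sym (z - x)) opprB.
Qed.

Lemma cper_rev s : cper (rev s) = cper s.
Proof.
case: s => [|x s] //; rewrite rev_cons -cats1 cper_catC /= !cper_pathlen.
by rewrite [RHS]pathlen_rev.
Qed.

Hypothesis N_tri : forall u v, N (u + v) <= N u + N v.

Lemma cper_behead x y s : cper (y :: s) <= cper (x :: y :: s).
Proof.
rewrite !cper_pathlen /= -!cats1 !pathlen_cat /= !addr0.
have := N_tri (y - x) (x - last y s); rewrite addrA subrK; lra.
Qed.

Hypothesis N_scale : forall k v, N (k *: v) = `|k| * N v.

(* The 2-opt move: the sides [a, b] and [c, d] cross at [x]. *)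
Lemma cper_uncross a b c d x l1 l2 (k m : R) : 0 <= k <= 1 -> 0 <= m <= 1 ->
  x = (1 - m) *: a + m *: b -> x = (1 - k) *: c + k *: d ->
  cper (a :: c :: rev l1 ++ b :: d :: l2) <=
  cper (a :: b :: l1 ++ c :: d :: l2) + N (c - a) - N (c - x) - N (x - a).
Proof.
move=> /andP[k0 k1] /andP[m0 m1] xab xcd.
have xa : x - a = m *: (b - a) by rewrite xab conv_shift addrC addKr.
have bx : b - x = (1 - m) *: (b - a).
  by rewrite xab conv_shift scalerBl scale1r opprD addrA.
have dx : d - x = (1 - k) *: (d - c).
  by rewrite xcd conv_shift scalerBl scale1r opprD addrA.
have xc : x - c = k *: (d - c) by rewrite xcd conv_shift addrC addKr.
have ab : N (b - a) = N (x - a) + N (b - x).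
  rewrite xa bx !N_scale !ger0_norm ?subr_ge0 //; ring.
have cd : N (d - c) = N (c - x) + N (d - x).
  rewrite -(N_sym (c - x)) opprB xc dx !N_scale !ger0_norm ?subr_ge0 //; ring.
(* Only the new side from [b] to [d] is estimated through [x]. The side from [a] to [c] is kept
   exact in the statement, so that a strict triangle inequality there can still be exploited. *)
have tr : N (d - b) <= N (d - x) + N (b - x).
  by rewrite -(N_sym (b - x)) opprB; have := N_tri (d - x) (x - b); rewrite addrA subrK.
rewrite !cper_pathlen /= !rcons_cat !pathlen_cat /=.
have := pathlen_rev c (rev l1) b; rewrite revK -!cats1 !pathlen_cat /= !addr0.
by rewrite -(N_sym (b - _)) opprB; move: ab cd tr; lra.
Qed.

End ClosedPathLength.

Lemma exists_min_seq (R : realDomainType) (T : eqType) (s : seq T) (f : T -> R) x0 :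
  x0 \in s -> exists2 x, x \in s & forall y, y \in s -> f x <= f y.
Proof.
elim: s x0 => // a s IH x0 _.
case: s IH => [_|b s IH].
  by exists a; rewrite ?mem_head // => y; rewrite inE => /eqP ->.
have [x xs xmin] := IH b (mem_head _ _).
have [le|lt] := leP (f a) (f x).
  exists a; first exact: mem_head.
  by move=> y; rewrite inE => /predU1P[->//|/xmin]; exact: le_trans.
exists x; first by rewrite inE xs orbT.
by move=> y; rewrite inE => /predU1P[->|/xmin//]; exact: ltW.
Qed.

Lemma seq_change (T : eqType) (P : pred T) (s : seq T) c d :
  c \in s -> d \in s -> P c -> ~~ P d ->
  exists l1 x y l2, s = l1 ++ x :: y :: l2 /\ P x != P y.
Proof.
elim: s c d => // a s IH c d cs ds Pc Pd.
have [[c' [d' [c's d's]]]|] := pselect (exists c d, [/\ c \in s, d \in s, P c & ~~ P d]).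
  move=> Pc' Pd'; have [l1 [x [y [l2 [-> H]]]]] := IH _ _ c's d's Pc' Pd'.
  by exists (a :: l1), x, y, l2.
move=> no; case: s {IH} cs ds no => [|b s] cs ds no.
  by move: cs ds Pc Pd; rewrite !inE => /eqP -> /eqP -> ->.
exists [::], a, b, s; split=> //; apply/eqP => Pab.
have bs : b \in b :: s := mem_head _ _.
move: cs ds; rewrite ![_ \in a :: _]inE => /predU1P[ca|cs] /predU1P[da|ds].
- by move: Pd; rewrite da -ca Pc.
- by apply: no; exists b, d; split=> //; rewrite -Pab -ca.
- by apply: no; exists c, b; split=> //; rewrite -Pab -da.
- by apply: no; exists c, d.
Qed.

Section VertexLists.
Context (R : realType) (V : normedModType R).
Implicit Types p : seq V.

Lemma vertexD p i : vertex p (i + size p) = vertex p i.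
Proof. by rewrite /vertex modnDr. Qed.

Lemma vertex_mod p i : vertex p (i %% size p) = vertex p i.
Proof. by rewrite /vertex modn_mod. Qed.

Lemma vertexS_mod p i : vertex p (i %% size p).+1 = vertex p i.+1.
Proof. by rewrite /vertex -addn1 modnDml addn1. Qed.

Lemma mem_vertex p i : (0 < size p)%N -> vertex p i \in p.
Proof. by move=> p0; rewrite mem_nth // ltn_pmod. Qed.

Lemma vertexP p v : v \in p -> exists2 i, (i < size p)%N & vertex p i = v.
Proof.
move=> vp; exists (index v p); rewrite ?index_mem //.
by rewrite /vertex modn_small ?index_mem // nth_index.
Qed.

Lemma vertex_rot p n k : (n <= size p)%N -> vertex (rot n p) k = vertex p (n + k).
Proof.
case: (posnP (size p)) => [/size0nil ->|p0] np.
  by rewrite /vertex !nth_nil.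
rewrite /vertex size_rot; have := ltn_pmod k p0; set j := (k %% size p)%N => jp.
have -> : ((n + k) %% size p = (n + j) %% size p)%N by rewrite modnDmr.
rewrite /rot nth_cat size_drop; have [lt|ge] := ltnP j (size p - n).
  by rewrite nth_drop modn_small // -ltn_subRL.
rewrite nth_take; last by rewrite ltn_subLR // subnK.
have -> : (n + j = (j - (size p - n)) + size p)%N by lia.
by rewrite modnDr modn_small //; lia.
Qed.

End VertexLists.

(** * Extreme points and crossings of a minimal tour *)

Section ConvexPolygon.
Context (R : realType) (V : normedModType R) (e1 e2 : V).
Hypothesis basis_e : is_basis2 e1 e2.
Context (om : {biscalar V}).
Hypothesis om_alt : forall x : V, om x x = 0.
Hypothesis om_nondeg : forall x : V, (forall y : V, om x y = 0) -> x = 0.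

Let omE := (omDl om, omDr om, omZl om, omZr om, omNl om, omNr om, om_alt).
Let omC := omC om_alt.

(** The condition ranges over all pairs of a side and a vertex: left turns at consecutive sides
    alone would also admit polygons that wind several times, such as a pentagram. Strictness
    excludes straight angles. *)
Definition ccw (q : seq V) : Prop :=
  [/\ (2 < size q)%N, uniq q & forall i k : nat,
    (k != i %[mod size q])%N -> (k != i.+1 %[mod size q])%N ->
    0 < om (vertex q i.+1 - vertex q i) (vertex q k - vertex q i)].

Lemma om_ext x y : (forall z, om x z = om y z) -> x = y.
Proof.
move=> h; apply/eqP; rewrite -subr_eq0; apply/eqP; apply: om_nondeg => z.
by rewrite !omE h subrr.
Qed.

(** Up to signs and the common factor [om e1 e2], the two numbers squared are the coordinates of [v]
    in the basis, so this is a Euclidean norm. *)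
Definition euclid (v : V) : R := Num.sqrt (om v e1 ^+ 2 + om v e2 ^+ 2).

Lemma euclidN v : euclid (- v) = euclid v.
Proof. by rewrite /euclid !omE !sqrrN. Qed.

Lemma euclidZ k v : euclid (k *: v) = `|k| * euclid v.
Proof. by rewrite /euclid !omE !exprMn -mulrDr sqrtrM ?sqr_ge0 // sqrtr_sqr. Qed.

Let sqE v : euclid v ^+ 2 = om v e1 ^+ 2 + om v e2 ^+ 2.
Proof. by rewrite sqr_sqrtr // addr_ge0 ?sqr_ge0. Qed.

Let euclid_ge0 v : 0 <= euclid v. Proof. exact: sqrtr_ge0. Qed.

(** Lagrange's identity. The term with [om u v] is the defect in the Cauchy-Schwarz inequality, and
    makes [euclidD_lt] strict for independent vectors. *)
Let lagrange u v :
  (om u e1 * om v e1 + om u e2 * om v e2) ^+ 2 + (om u v * om e1 e2) ^+ 2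
  = (euclid u * euclid v) ^+ 2.
Proof.
have -> : om u v * om e1 e2 = om u e1 * om v e2 - om u e2 * om v e1.
  have := om_plucker basis_e om_alt u v e1 e2.
  by rewrite (omC e1 u) => h; move: h; rewrite (omC v e1); lra.
by rewrite exprMn !sqE; ring.
Qed.

Lemma euclidD u v : euclid (u + v) <= euclid u + euclid v.
Proof.
rewrite -ler_sqr ?nnegrE ?addr_ge0 // sqrrD !sqE !omE.
have h := lagrange u v; set X := (X in X ^+ 2 + _ = _) in h.
have : X <= euclid u * euclid v.
  rewrite (le_trans (ler_norm _)) // -ler_sqr ?nnegrE ?mulr_ge0 // -h.
  by rewrite real_normK ?num_real // lerDl sqr_ge0.
rewrite /X; lra.
Qed.

Lemma euclidD_lt u v : om u v != 0 -> euclid (u + v) < euclid u + euclid v.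
Proof.
move=> uv; rewrite -ltr_sqr ?nnegrE ?addr_ge0 // sqrrD !sqE !omE.
have h := lagrange u v; set X := (X in X ^+ 2 + _ = _) in h.
have : X < euclid u * euclid v.
  rewrite (le_lt_trans (ler_norm _)) // -ltr_sqr ?nnegrE ?mulr_ge0 // -h.
  rewrite real_normK ?num_real // ltrDl exprn_even_gt0 //= mulf_neq0 //.
  exact: (basis_om_neq0 basis_e om_alt om_nondeg).
rewrite /X; lra.
Qed.

Context (p : seq V).
Hypothesis p_spanning : forall d k, d != 0 -> exists2 x, x \in p & om d x != k.

Let nm (v : V) : R := `|v|.

Definition hull_tour (t : seq V) : Prop :=
  [/\ (forall v, v \in t -> v \in p), (forall v, v \in p -> hull t v)
    & cper nm t <= cper nm p].

(* The least number of vertices makes every vertex extreme; the least Euclidean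
   length excludes crossings, for which the norm of [V] would not do, since it need
   not be strictly convex. *)
Definition minimal_tour (t : seq V) : Prop :=
  [/\ hull_tour t, (forall t', hull_tour t' -> (size t <= size t')%N)
    & forall t', perm_eq t' t -> hull_tour t' -> cper euclid t <= cper euclid t'].

Lemma exists_minimal_tour : exists t, minimal_tour t.
Proof.
pose P k := `[< exists2 t, hull_tour t & size t = k >].
have exP : exists k, P k.
  by exists (size p); apply/asboolP; exists p => //; split=> // v; exact: mem_hull.
case: (ex_minnP exP) => m /asboolP[t0 t0G t0m] mmin.
(* The Euclidean length is minimized over the permutations of one list only: finitely many
   candidates, hence a minimum without any compactness. *)
pose cand := [seq t <- permutations t0 | `[< hull_tour t >]].
have t0c : t0 \in cand.
  by rewrite mem_filter mem_permutations perm_refl andbT; apply/asboolP.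
have [t tc tmin] := exists_min_seq (cper euclid) t0c.
move: tc; rewrite mem_filter mem_permutations => /andP[/asboolP tG tt0].
exists t; split=> //.
  by move=> t' t'G; rewrite (perm_size tt0) t0m mmin //; apply/asboolP; exists t'.
move=> t' t't t'G; apply: tmin; rewrite mem_filter mem_permutations.
by rewrite (perm_trans t't tt0) andbT; apply/asboolP.
Qed.

Lemma hull_tour_perm t t' : perm_eq t' t -> cper nm t' <= cper nm t ->
  hull_tour t -> hull_tour t'.
Proof.
move=> tt' ct [t1 t2 t3]; have E := perm_mem tt'; split.
- by move=> v; rewrite E; exact: t1.
- move=> v vp; apply: (hull_le _ (t2 _ vp)) => w wt; apply: mem_hull; by rewrite E.
- exact: le_trans t3.
Qed.

Lemma minimal_tour_perm t t' : perm_eq t' t -> cper nm t' <= cper nm t ->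
  cper euclid t' <= cper euclid t -> minimal_tour t -> minimal_tour t'.
Proof.
move=> tt' c1 c2 [t1 t2 t3]; split; first exact: hull_tour_perm t1.
  by move=> s /t2; rewrite (perm_size tt').
by move=> s st' sG; rewrite (le_trans c2) // t3 // (perm_trans st').
Qed.

Lemma minimal_tour_catC s1 s2 : minimal_tour (s1 ++ s2) -> minimal_tour (s2 ++ s1).
Proof.
by apply: minimal_tour_perm; [rewrite perm_catC|rewrite cper_catC|rewrite cper_catC].
Qed.

Lemma minimal_tour_rot n t : minimal_tour t -> minimal_tour (rot n t).
Proof. by apply: minimal_tour_perm; rewrite ?perm_rot ?cper_rot. Qed.

(** Such a vertex could be deleted: the hull is unchanged and the perimeter does not grow, against
    the least number of vertices. *)
Lemma minimal_tour_head a s : minimal_tour (a :: s) -> ~ hull s a.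
Proof.
move=> [[t1 t2 t3] tmin _] ha.
suff /tmin : hull_tour s by rewrite /= ltnn.
split.
- by move=> v vs; apply: t1; rewrite inE vs orbT.
- move=> v vp; apply: (hull_le _ (t2 _ vp)) => w; rewrite inE => /predU1P[->//|].
  exact: mem_hull.
- case: s ha t3 {t1 t2 tmin} => [/hull_nil //|y s] _; apply: le_trans.
  by apply: cper_behead => u v; exact: ler_normD.
Qed.

Lemma minimal_tour_extreme t v s : minimal_tour t -> v \in t ->
  (forall w, w \in s -> w \in t /\ w != v) -> ~ hull s v.
Proof.
move=> tM /path.splitPr vt; case: vt tM => s1 s2 /minimal_tour_catC /minimal_tour_head nh st hv.
apply: nh; apply: (hull_le _ hv) => w /st [wt wv]; apply: mem_hull.
by move: wt; rewrite !mem_cat inE (negPf wv) orbC.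
Qed.

Lemma minimal_tour_uniq t : minimal_tour t -> uniq t.
Proof.
move=> tM; apply: count_mem_uniq => v; have [|vt] := boolP (v \in t); last first.
  exact/count_memPn.
move=> /path.splitPr vt; case: vt tM => s1 s2 /minimal_tour_catC /minimal_tour_head nh.
have : v \notin s2 ++ s1 by apply/negP => /(@mem_hull R V).
by rewrite mem_cat negb_or => /andP[/count_memPn h2 /count_memPn h1]; rewrite count_cat /= h1 h2 eqxx.
Qed.

Lemma hull2 (a b x : V) (k : R) : 0 <= k <= 1 -> x = a + k *: (b - a) ->
  forall s, a \in s -> b \in s -> hull s x.
Proof.
move=> k01 -> s sa sb; rewrite -conv_shift.
by apply: cvx_hull => //; exact: mem_hull.
Qed.

(** Of three collinear vertices the middle one is in the hull of the other two. The position [l] of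
    [x] on the line tells which one that is: [a] for [l < 0], [x] for [0 <= l <= 1], [b] for
    [1 < l]. *)
Lemma minimal_tour_noncollinear t a b x : minimal_tour t ->
  a \in t -> b \in t -> x \in t -> a != b -> a != x -> b != x ->
  om (b - a) (x - a) != 0.
Proof.
move=> tM at_ bt xt ab ax bx; apply/eqP => h.
have ba0 : b - a != 0 by rewrite subr_eq0 eq_sym.
have [l xl] := om_parallel basis_e om_alt om_nondeg ba0 h.
have {xl} xE : x = a + l *: (b - a) by rewrite -xl addrC subrK.
have [l0|l0] := ltP l 0.
  apply: (@minimal_tour_extreme t a [:: x; b]) => //.
    by move=> w; rewrite !inE => /orP[] /eqP ->; rewrite eq_sym.
  apply: (@hull2 x b a (- l / (1 - l))); rewrite ?inE ?eqxx ?orbT //.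
    rewrite divr_ge0 ?oppr_ge0 ?subr_ge0 /=; [|lra|lra].
    by rewrite ler_pdivrMr; lra.
  apply: om_ext => z; rewrite xE !omE; field; lra.
have [l1|l1] := leP l 1.
  apply: (@minimal_tour_extreme t x [:: a; b]) => //.
    by move=> w; rewrite !inE => /orP[] /eqP ->.
  by apply: (@hull2 a b x l); rewrite ?inE ?eqxx ?orbT // l0.
apply: (@minimal_tour_extreme t b [:: a; x]) => //.
  by move=> w; rewrite !inE => /orP[] /eqP ->; rewrite // eq_sym.
apply: (@hull2 a x b l^-1); rewrite ?inE ?eqxx ?orbT //.
  by rewrite invr_ge0 l0 invf_le1 ?ltW // (le_lt_trans _ l1).
apply: om_ext => z; rewrite xE !omE; field; lra.
Qed.

(** With vertices on both sides of the line of [a] and [b], some side from [c] to [d] crosses that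
    line at a point [x]. If [x] is not strictly between [a] and [b], one of these is in the hull of
    the other and [c], [d]; if it is, uncrossing the two sides shortens the Euclidean length. *)
Lemma minimal_tour_edge a b s : minimal_tour (a :: b :: s) ->
  (forall x, x \in s -> 0 < om (b - a) (x - a)) \/
  (forall x, x \in s -> om (b - a) (x - a) < 0).
Proof.
move=> tM; have /= /and3P[] := minimal_tour_uniq tM.
rewrite inE negb_or => /andP[ab as_] bs us.
have nz x : x \in s -> om (b - a) (x - a) != 0.
  move=> xs; apply: (minimal_tour_noncollinear tM); rewrite ?inE ?eqxx ?xs ?orbT //.
    by apply: contraNneq as_ => ->.
  by apply: contraNneq bs => ->.
pose P x := 0 < om (b - a) (x - a).
have Pn x : x \in s -> ~~ P x -> om (b - a) (x - a) < 0.
  by move=> xs; rewrite /P -leNgt lt_neqAle nz.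
have [allP|/existsNP[d /not_implyP[ds Pd]]] := pselect (forall x, x \in s -> P x).
  by left.
have [|/existsNP[c /not_implyP[cs Pc]]] := pselect (forall x, x \in s -> ~~ P x).
  by move=> h; right=> x xs; exact: Pn xs (h _ xs).
exfalso; move/negP: Pc; rewrite negbK => Pc; move/negP: Pd => Pd.
have [l1 [c' [d' [l2 [sE]]]]] := seq_change cs ds Pc Pd.
move: {c d cs ds Pc Pd} c' d' sE => c d sE Pcd.
have cs : c \in s by rewrite sE mem_cat inE eqxx orbT.
have ds : d \in s by rewrite sE mem_cat !inE eqxx !orbT.
pose al := om (b - a) (c - a); pose be := om (b - a) (d - a).
have abe : al * be < 0.
  move: Pcd; have [Pc|nPc] := boolP (P c); have [Pd|nPd] := boolP (P d) => // _.
    by rewrite pmulr_rlt0 // Pn.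
  by rewrite nmulr_rlt0 // Pn.
have ab0 : al - be != 0.
  by apply/eqP => /eqP; rewrite subr_eq0 => /eqP h; move: abe; rewrite h -expr2 ltNge sqr_ge0.
pose k := al / (al - be).
have k01 : 0 < k < 1.
  have [a0|a0|a0] := ltgtP al 0; last by move: abe; rewrite a0 mul0r ltxx.
    have b0 : 0 < be by move: abe; rewrite nmulr_rlt0.
    rewrite /k -mulrNN -invrN opprB divr_gt0 /=; [|lra|lra].
    by rewrite ltr_pdivrMr; lra.
  have b0 : be < 0 by move: abe; rewrite pmulr_rlt0.
  rewrite /k divr_gt0 /=; [|lra|lra].
  by rewrite ltr_pdivrMr; lra.
pose x := (1 - k) *: c + k *: d.
have xline : om (b - a) (x - a) = 0.
  rewrite (_ : x - a = (1 - k) *: (c - a) + k *: (d - a)); last first.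
    by apply: om_ext => z; rewrite /x !omE; ring.
  rewrite omDr !omZr -/al -/be /k; move: (al) (be) ab0 => u w uw; by field.
have ba0 : b - a != 0 by rewrite subr_eq0 eq_sym.
have [m xm] := om_parallel basis_e om_alt om_nondeg ba0 xline.
have {xm} xE : x = a + m *: (b - a) by rewrite -xm addrC subrK.
have cvxx t : c \in t -> d \in t -> hull t x.
  move=> ct dt; apply: (@hull2 c d x k) => //; last by rewrite /x conv_shift.
  by case/andP: k01 => /ltW -> /ltW ->.
have ac : a != c by apply: contraNneq as_ => ->.
have ad : a != d by apply: contraNneq as_ => ->.
have bc : b != c by apply: contraNneq bs => ->.
have bd : b != d by apply: contraNneq bs => ->.
have [m0|m0] := leP m 0.
  apply: (@minimal_tour_extreme _ a [:: b; c; d] tM); first exact: mem_head.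
    by move=> w; rewrite !inE => /or3P[] /eqP ->; rewrite ?cs ?ds ?eqxx ?orbT // eq_sym.
  have -> : a = (1 - (- m / (1 - m))) *: x + (- m / (1 - m)) *: b.
    by apply: om_ext => z; rewrite xE !omE; field; rewrite subr_eq0 eq_sym lt_eqF // (le_lt_trans m0).
  apply: cvx_hull; [|by apply: cvxx; rewrite !inE eqxx ?orbT|by apply: mem_hull; exact: mem_head].
  have m1 : 0 < 1 - m by rewrite subr_gt0 (le_lt_trans m0).
  by rewrite divr_ge0 ?oppr_ge0 ?(ltW m1) //= ler_pdivrMr // mul1r lerDr.
have [m1|m1] := leP 1 m.
  apply: (@minimal_tour_extreme _ b [:: a; c; d] tM); first by rewrite !inE eqxx orbT.
    by move=> w; rewrite !inE => /or3P[] /eqP ->; rewrite ?cs ?ds ?eqxx ?orbT // eq_sym.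
  have -> : b = (1 - m^-1) *: a + m^-1 *: x.
    by apply: om_ext => z; rewrite xE !omE; field; rewrite gt_eqF.
  apply: cvx_hull; [|by apply: mem_hull; exact: mem_head|by apply: cvxx; rewrite !inE eqxx ?orbT].
  by rewrite invr_ge0 ltW //= invf_le1.
(* The two sides now cross at interior points: [a] is joined to [c], [b] to [d], and the stretch
   between them is reversed. *)
pose t' := a :: c :: rev l1 ++ b :: d :: l2.
have pt : perm_eq t' (a :: b :: s).
  apply/seq.permP => Q; rewrite sE /= !count_cat /= count_rev.
  move: (nat_of_bool (Q a)) (nat_of_bool (Q b)) (nat_of_bool (Q c)) (nat_of_bool (Q d)).
  by move: (count Q l1) (count Q l2) => *; clear; lia.
have k01' : 0 <= k <= 1 by case/andP: k01 => /ltW -> /ltW ->.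
have m01' : 0 <= m <= 1 by rewrite !ltW.
have xab : x = (1 - m) *: a + m *: b by rewrite conv_shift.
have := @cper_uncross _ _ nm (@normrN _ _) (@ler_normD _ _) (@normrZ _ _)
  a b c d x l1 l2 k m k01' m01' xab erefl.
have := @cper_uncross _ _ euclid euclidN euclidD euclidZ
  a b c d x l1 l2 k m k01' m01' xab erefl.
rewrite -/t' -sE => lt1 lt2.
have [tG _ tmin] := tM.
have t'G : hull_tour t'.
  apply: hull_tour_perm pt _ tG; apply: (le_trans lt2).
  have := ler_normD (c - x) (x - a); rewrite addrA subrK /nm => tr.
  by rewrite -addrA -opprD -addrA gerDl subr_le0.
have := tmin _ pt t'G; apply/negP; rewrite -ltNge; apply: (le_lt_trans lt1).
(* [a], [x] and [c] are not collinear, so the Euclidean detour through [x] is strictly longer. For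
   the norm the weak inequality was enough to keep [t'] among the tours. *)
have : om (c - x) (x - a) != 0.
  have -> : om (c - x) (x - a) = - (m * al).
    have xa : x - a = m *: (b - a) by rewrite xE addrC addKr.
    have cx : c - x = (c - a) - m *: (b - a) by rewrite xE opprD addrA.
    rewrite xa cx omDl omNl !omZr omZl om_alt /al (omC (b - a)); ring.
  rewrite oppr_eq0 mulf_neq0 //; first by rewrite gt_eqF.
  by apply/eqP => h; move: abe; rewrite h mul0r ltxx.
by move/euclidD_lt; rewrite addrA subrK => tr; rewrite -addrA -opprD -addrA gtrDl subr_lt0.
Qed.

Let edge (q : seq V) i := vertex q i.+1 - vertex q i.

Let all_left (q : seq V) i := forall k, (k != i %[mod size q])%N ->
  (k != i.+1 %[mod size q])%N -> 0 < om (edge q i) (vertex q k - vertex q i).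
Let all_right (q : seq V) i := forall k, (k != i %[mod size q])%N ->
  (k != i.+1 %[mod size q])%N -> om (edge q i) (vertex q k - vertex q i) < 0.

Lemma minimal_tour_side q i : (2 < size q)%N -> minimal_tour q ->
  all_left q i \/ all_right q i.
Proof.
move=> q3 /(minimal_tour_rot (i %% size q)%N) qM.
have iq : (i %% size q <= size q)%N by rewrite ltnW // ltn_pmod //; lia.
have vr k := vertex_rot k iq; have sr := size_rot (i %% size q)%N q.
move: qM vr sr; case E : (rot _ q) => [|a [|b s]] qM vr sr; try by rewrite -sr in q3.
have va : vertex q i = a by rewrite -vertex_mod -(addn0 (i %% _)%N) -vr.
have vb : vertex q i.+1 = b.
  by rewrite -vertexS_mod -addn1 -vr /vertex modn_small.
have vs k : (k != i %[mod size q])%N -> (k != i.+1 %[mod size q])%N -> vertex q k \in s.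
  move=> ki ki1; pose j := (k + (size q - i %% size q))%N.
  have vj : vertex q k = vertex (a :: b :: s) j.
    by rewrite vr /j addnCA subnKC // vertexD.
  have jk : (k = i + j %[mod size q])%N.
    by rewrite -modnDml /j addnCA subnKC // modnDr.
  have jm : (j %% size q < size q)%N by rewrite ltn_pmod //; lia.
  rewrite vj /vertex sr; move: jk; rewrite -modnDmr.
  move: (j %% size q)%N jm => l; case: l => [|[|l]] lq.
  - by rewrite addn0 => /eqP; rewrite (negPf ki).
  - by rewrite addn1 => /eqP; rewrite (negPf ki1).
  - by move=> _ /=; apply: mem_nth; move: lq; rewrite -sr.
have [H|H] := minimal_tour_edge qM; [left|right] => k ki ki1;
  by rewrite /edge va vb; apply: H; exact: vs.
Qed.

Lemma exists_hull_polygon : exists q,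
  [/\ ccw q, (forall v, v \in q -> v \in p), (forall v, v \in p -> hull q v),
      (size q <= size p)%N & cper nm q <= cper nm p].
Proof.
have [t tM] := exists_minimal_tour.
have lin d (k : R) : cvx [set x | om d x = k].
  by move=> x y l _ /= hx hy; rewrite !omE hx hy; ring.
have ne0 : e1 != 0.
  apply/eqP => h; have := basis_om_neq0 basis_e om_alt om_nondeg.
  by rewrite h om0l eqxx.
have not_lin d k : d != 0 -> ~ (forall x, x \in t -> om d x = k).
  move=> d0 tl; have [x xp /eqP] := p_spanning k d0; apply.
  by have [[_ th _] _ _] := tM; exact: (hull_sub (lin d k) tl (th _ xp)).
have t3 : (2 < size t)%N.
  case: t tM not_lin => [|a [|b [|c t]]] // tM not_lin; exfalso.
  - exact: (not_lin e1 0).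
  - by apply: (not_lin e1 (om e1 a)) => // x; rewrite inE => /eqP ->.
  - have ab : b - a != 0.
      rewrite subr_eq0; have /= := minimal_tour_uniq tM.
      by rewrite inE eq_sym => /andP[].
    apply: (not_lin (b - a) (om (b - a) a)) => // x.
    rewrite !inE => /orP[] /eqP -> //.
    by apply/eqP; rewrite -subr_eq0 -omNr -omDr om_alt.
(* One side with all other vertices on its left is enough: if side [i] has them on its left and side
   [i.+1] on its right, the two give opposite signs to the turn between them. *)
suff [q [qM q3 qpos]] : exists q, [/\ minimal_tour q, (2 < size q)%N & all_left q 0].
  have [[q1 q2 q4] qmin _] := qM.
  exists q; split=> //; last first.
    by apply: qmin; split=> // v; exact: mem_hull.
  split=> //; first exact: minimal_tour_uniq qM.
  have no2 i j : (0 < j < size q)%N -> (i + j != i %[mod size q])%N.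
    by move=> ij; rewrite -[X in (_ != X %[mod _])%N]addn0 eqn_modDl mod0n modn_small; lia.
  have n2 i : (i.+2 != i %[mod size q])%N by rewrite -addn2; apply: no2.
  have n1 i : (i.+1 != i %[mod size q])%N by rewrite -addn1; apply: no2; lia.
  elim=> [|i IH]; first exact: qpos.
  have [//|neg] := minimal_tour_side i.+1 q3 qM.
  have pos := IH i.+2 (n2 i) (n1 i.+1).
  have eg : vertex q i.+2 - vertex q i = edge q i.+1 + edge q i.
    by rewrite /edge addrA subrK.
  have ef : vertex q i - vertex q i.+1 = - edge q i by rewrite opprB.
  have {}pos : 0 < om (edge q i) (edge q i.+1 + edge q i) by rewrite -eg.
  have {}neg : om (edge q i.+1) (- edge q i) < 0.
    by rewrite -ef; apply: neg; rewrite eq_sym.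
  exfalso; move: pos neg; move: (edge q i.+1) (edge q i) => g f.
  by rewrite omDr om_alt addr0 omNr omC => /lt_trans h /h; rewrite ltxx.
have [pos|neg] := minimal_tour_side 0 t3 tM; first by exists t.
case: t tM t3 neg {not_lin} => [|a [|b [|c s]]] // tM t3 neg.
have cq : om (b - a) (c - a) < 0.
  exact: (neg 2 isT isT).
(* The tour in the opposite sense, rotated so that its first side runs from [b] to [a]. *)
pose q := b :: a :: rev (c :: s).
have qM : minimal_tour q.
  have qE : q = rot (size s).+1 (rev (a :: b :: c :: s)).
    rewrite -[a :: _]/([:: a; b] ++ (c :: s)) rev_cat.
    have -> : (size s).+1 = size (rev (c :: s)) by rewrite size_rev.
    by rewrite rot_size_cat.
  rewrite qE; apply: minimal_tour_rot.
  apply: minimal_tour_perm tM.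
  - by rewrite perm_rev.
  - by rewrite cper_rev // => v; exact: normrN.
  - by rewrite cper_rev //; exact: euclidN.
have q3 : (2 < size q)%N by rewrite /= size_rev.
exists q; split=> //.
have cr : c \in rev (c :: s) by rewrite mem_rev mem_head.
have flip : om (a - b) (c - b) = - om (b - a) (c - a).
  by rewrite !omE (omC b a); ring.
have xr : vertex q 2 \in rev (c :: s).
  rewrite /vertex modn_small // /=; apply: mem_nth; by rewrite size_rev.
have [qpos|qneg] := minimal_tour_edge qM; last first.
  by have := qneg _ cr; rewrite flip oppr_lt0 => /(lt_trans cq); rewrite ltxx.
have [//|qneg] := minimal_tour_side 0 q3 qM.
have c0 : (2 != 0 %[mod size q])%N by rewrite !modn_small //; lia.
have c1 : (2 != 1 %[mod size q])%N by rewrite !modn_small //; lia.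
by have := lt_trans (qpos _ xr) (qneg _ c0 c1); rewrite ltxx.
Qed.

End ConvexPolygon.

(** * Convex polygons as intersections of half-planes *)

Section CcwPolygon.
Context (R : realType) (V : normedModType R) (e1 e2 : V).
Hypothesis basis_e : is_basis2 e1 e2.
Context (om : {biscalar V}).
Hypothesis om_alt : forall x : V, om x x = 0.
Hypothesis om_nondeg : forall x : V, (forall y : V, om x y = 0) -> x = 0.

Let omE := (omDl om, omDr om, omZl om, omZr om, omNl om, omNr om, om_alt).
Let omC := omC om_alt.

Lemma om_convB f x y w (k : R) :
  om f ((1 - k) *: x + k *: y - w) = (1 - k) * om f (x - w) + k * om f (y - w).
Proof. by rewrite !omE; ring. Qed.

Context (q : seq V).
Hypothesis q_ccw : ccw om q.

Local Notation m := (size q).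
Local Notation v := (vertex q).
Local Notation f i := (vertex q i.+1 - vertex q i).

Let m3 : (2 < m)%N. Proof. by case: q_ccw. Qed.
Let m_gt0 : (0 < m)%N. Proof. exact: ltn_trans m3. Qed.

Lemma ccw_support i k : 0 <= om (f i) (v k - v i).
Proof.
have [_ _ qpos] := q_ccw.
have [e|ki] := eqVneq (k %% m)%N (i %% m)%N.
  by rewrite -(vertex_mod q k) e vertex_mod subrr om0r.
have [e|ki1] := eqVneq (k %% m)%N (i.+1 %% m)%N.
  by rewrite -(vertex_mod q k) e vertex_mod om_alt.
by apply/ltW/qpos.
Qed.

Lemma ccw_strict i k : om (f i) (v k - v i) = 0 ->
  (k = i %[mod m])%N \/ (k = i.+1 %[mod m])%N.
Proof.
have [_ _ qpos] := q_ccw => h.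
have [e|ki] := eqVneq (k %% m)%N (i %% m)%N; first by left.
have [e|ki1] := eqVneq (k %% m)%N (i.+1 %% m)%N; first by right.
by have := qpos _ _ ki ki1; rewrite h ltxx.
Qed.

Let modS_neq i j : (0 < j < m)%N -> (i + j != i %[mod m])%N.
Proof.
by move=> ij; rewrite -[X in (_ != X %[mod _])%N]addn0 eqn_modDl mod0n modn_small; lia.
Qed.

Lemma ccw_turn i : 0 < om (f i) (f i.+1).
Proof.
have e : v i.+2 - v i = f i.+1 + f i by rewrite addrA subrK.
have : om (f i) (v i.+2 - v i) = om (f i) (f i.+1).
  by rewrite e; move: (f i.+1) (f i) => g h; rewrite omDr om_alt addr0.
move=> <-; have [_ _ qpos] := q_ccw; apply: qpos.
  by rewrite -addn2 modS_neq.
by rewrite -addn1 modS_neq //; lia.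
Qed.

Lemma ccw_edge_neq0 i : f i != 0.
Proof. by apply/eqP => h; have := ccw_turn i; rewrite h om0l ltxx. Qed.

(** If points of sides [i] and [j] with parameters below 1 coincide, the start of each side lies on
    the line of the other. By strictness, either [i = j] or each index is the successor of the
    other, which three vertices exclude. *)
Lemma ccw_simple_closed : simple_closed q.
Proof.
move=> i j s t im jm /andP[s0 s1] /andP[t0 t1] st.
have mem a b (r u : R) : side_point q a r = side_point q b u -> 0 <= u < 1 ->
    (b = a %[mod m])%N \/ (b = a.+1 %[mod m])%N.
  move=> /(congr1 (fun z => om (f a) (z - v a))); rewrite /side_point !om_convB.
  rewrite subrr om0r om_alt !mulr0 addr0 => /esym/eqP h /andP[u0 u1].
  move: h; rewrite paddr_eq0 ?mulr_ge0 ?ccw_support ?subr_ge0 ?(ltW u1) //.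
  by rewrite mulf_eq0 subr_eq0 (gt_eqF u1) /= => /andP[/eqP /ccw_strict].
have e : i = j.
  have [] := mem i j s t st; rewrite ?t0 // => h1.
    by move: h1; rewrite !modn_small.
  have [] := mem j i t s (esym st); rewrite ?s0 // => h2.
    by move: h2; rewrite !modn_small.
  have : (i + 2 != i %[mod m])%N by apply: modS_neq; lia.
  by rewrite addn2 -addn1 -modnDml -h1 modnDml addn1 -h2 eqxx.
split=> //; move: st; rewrite -e /side_point !conv_shift => /addrI /eqP.
rewrite -subr_eq0 -scalerBl scaler_eq0 (negPf (ccw_edge_neq0 i)) orbF subr_eq0.
by move/eqP.
Qed.

Definition centroid : V := locked ((m%:R)^-1 *: \sum_(i < m) v i).
Local Notation c := centroid.

Let m_neq0 : m%:R != 0 :> R. Proof. by rewrite pnatr_eq0 -lt0n. Qed.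

Lemma centroid_sum x y : \sum_(k < m) om x (v k - y) = m%:R * om x (c - y).
Proof.
transitivity (\sum_(k < m) (om x (v k) - om x y)).
  by apply: eq_bigr => k _; rewrite omDr omNr.
rewrite sumrB sumr_const card_ord -om_sumr omDr omNr /centroid -lock omZr.
by rewrite mulrDr mulrA divff // mul1r mulrN mulr_natl.
Qed.

Lemma centroid_gt0 i : 0 < om (f i) (c - v i).
Proof.
rewrite -(pmulr_rgt0 _ (x := m%:R)) ?ltr0n // -centroid_sum.
have i2 : (i.+2 %% m < m)%N by rewrite ltn_pmod.
rewrite (bigD1 (Ordinal i2)) //= ltr_pwDl ?sumr_ge0 //; last first.
  by move=> k _; exact: ccw_support.
rewrite vertex_mod; have [_ _ qpos] := q_ccw; apply: qpos.
  by rewrite -addn2 modS_neq.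
by rewrite -addn1 modS_neq //; lia.
Qed.

Lemma om_fan i : om (v i - c) (v i.+1 - c) = om (f i) (c - v i).
Proof. by rewrite !omE (omC c (v i.+1)) (omC (v i) (v i.+1)) (omC (v i) c); ring. Qed.

Definition halfplanes : set V := [set z | forall i, 0 <= om (f i) (z - v i)].

(** The numbers [th i] sum to zero because the vectors [v i - c] do, so they pass somewhere from
    nonnegative to negative. There [z - c] lies in the cone of [v i - c] and [v i.+1 - c], and the
    half-plane of side [i] bounds the sum of the coefficients by 1. *)
Lemma fan_cover z : halfplanes z -> exists i (a b : R),
  [/\ (i < m)%N, 0 <= a, 0 <= b, a + b <= 1 & z - c = a *: (v i - c) + b *: (v i.+1 - c)].
Proof.
move=> zH; pose th i := om (v i - c) (z - c).
have [->|zc] := eqVneq z c.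
  by exists 0%N, 0, 0; rewrite subrr !scale0r !addr0 ler01.
have dz : z - c != 0 by rewrite subr_eq0.
have th_per i : th (i + m)%N = th i by rewrite /th vertexD.
have th_sum : \sum_(i < m) th i = 0.
  transitivity (- \sum_(k < m) om (z - c) (v k - c)).
    by rewrite -sumrN; apply: eq_bigr => i _; rewrite /th omC.
  by rewrite centroid_sum subrr om0r mulr0 oppr0.
have [ip pp] : exists i, 0 <= th i.
  apply: contrapT => h; have neg i : th i < 0.
    by rewrite ltNge; apply/negP => ?; apply: h; exists i.
  move: th_sum; case: (m) m_gt0 => // k _; rewrite big_ord_recl => /eqP.
  by rewrite lt_eqF // ltr_nwDl // sumr_le0 // => i _; exact/ltW.
have [jn pn] : exists i, th i < 0.
  apply: contrapT => h; have pos i : 0 <= th i.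
    by rewrite leNgt; apply/negP => ?; apply: h; exists i.
  move/eqP: th_sum; rewrite psumr_eq0 // => /allP th0.
  have z0 i : (i < m)%N -> th i = 0.
    by move=> im; have /eqP := th0 (Ordinal im) (mem_index_enum _).
  have par i : (i < m)%N -> exists l, v i - c = l *: (z - c).
    move=> im; have := om_parallel basis_e om_alt om_nondeg dz (x := v i - c).
    by apply; rewrite omC; apply/eqP; rewrite oppr_eq0; apply/eqP; exact: z0.
  have := centroid_gt0 0; rewrite -om_fan.
  have [l ->] := par 0%N m_gt0; have [l' ->] := par 1%N (ltnW m3).
  by rewrite omZl omZr om_alt !mulr0 ltxx.
have [i /andP[i0]] : exists i, (0 <= th i) && ~~ (0 <= th i.+1).
  apply: (@periodic_change m (fun i => 0 <= th i) m_gt0 _ ip jn) => //.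
    by move=> i; rewrite th_per.
  by rewrite -ltNge.
rewrite -ltNge => i1; have D0 := centroid_gt0 i.
have dec := om_decomp basis_e om_alt (v i - c) (v i.+1 - c) (z - c).
rewrite om_fan in dec; set D := om (f i) _ in D0 dec.
pose a := - th i.+1 / D; pose b := th i / D.
have zE : z - c = a *: (v i - c) + b *: (v i.+1 - c).
  apply: (scalerI (lt0r_neq0 D0)); rewrite dec [RHS]scalerDr !scalerA /a /b.
  by rewrite ![D * _]mulrC !divfK ?lt0r_neq0 // /th (omC (z - c)).
exists (i %% m)%N, a, b; rewrite ltn_pmod // vertexS_mod vertex_mod; split=> //.
- by rewrite /a divr_ge0 // ltW // oppr_gt0.
- by rewrite /b divr_ge0 // ltW.
have := zH i; rewrite -[z](subrK c) zE.
have -> : om (f i) (a *: (v i - c) + b *: (v i.+1 - c) + c - v i) = D * (1 - a - b).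
  by rewrite /D !omE (omC (v i) (v i.+1)); ring.
by rewrite pmulr_rge0 // -subr_ge0 => h; rewrite -subr_ge0 opprD addrA; rewrite subr0 in h.
Qed.

Lemma cvx_halfplanes : cvx halfplanes.
Proof.
move=> x y k /andP[k0 k1] hx hy i; rewrite om_convB.
by rewrite addr_ge0 // mulr_ge0 // ?subr_ge0.
Qed.

Lemma hull_mean (s : seq V) : (0 < size s)%N -> hull s ((size s)%:R^-1 *: \sum_(i < size s) s`_i).
Proof.
elim/last_ind: s => [//|s x IH] _.
have [s0|s0] := posnP (size s).
  rewrite (size0nil s0) /= big_ord_recl big_ord0 addr0 invr1 scale1r.
  exact: mem_hull (mem_head _ _).
have ss : hull (rcons s x) ((size s)%:R^-1 *: \sum_(i < size s) s`_i).
  apply: (hull_le _ (IH s0)) => w ws; apply: mem_hull.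
  by rewrite mem_rcons inE ws orbT.
rewrite size_rcons big_ord_recr /= nth_rcons ltnn eqxx.
under eq_bigr do rewrite nth_rcons ltn_ord.
have n0 : (size s)%:R != 0 :> R by rewrite pnatr_eq0 -lt0n.
have n1 : (size s).+1%:R != 0 :> R by rewrite pnatr_eq0.
have -> : (size s).+1%:R^-1 *: (\sum_(i < size s) s`_i + x) =
   (1 - (size s).+1%:R^-1) *: ((size s)%:R^-1 *: \sum_(i < size s) s`_i) +
   (size s).+1%:R^-1 *: x.
  rewrite scalerDr scalerA; congr (_ *: _ + _); field.
  by rewrite n0 nat1r n1.
apply: cvx_hull => //; last by apply: mem_hull; rewrite mem_rcons mem_head.
by rewrite invr_ge0 ler0n /= invf_le1 ?ltr0n // ler1n.
Qed.

Lemma hull_centroid : hull q c.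
Proof.
rewrite /centroid -lock (eq_bigr (fun i : 'I_m => q`_i)); first exact: hull_mean.
by move=> i _; rewrite /vertex modn_small.
Qed.

Lemma hull_halfplanes : hull q = halfplanes.
Proof.
apply/seteqP; split.
  apply: hull_sub cvx_halfplanes _ => w /vertexP[k km <-] i; exact: ccw_support.
move=> z /fan_cover[i [a [b [im a0 b0 ab zE]]]].
have hv k : hull q (v k) by apply: mem_hull; exact: mem_vertex.
have [ab0|ab0] := eqVneq (a + b) 0.
  have /andP[/eqP a00 /eqP b00] : (a == 0) && (b == 0) by rewrite -paddr_eq0 // ab0.
  move/eqP: zE; rewrite a00 b00 !scale0r addr0 subr_eq0 => /eqP ->.
  exact: hull_centroid.
have ab_gt0 : 0 < a + b by rewrite lt_neqAle eq_sym ab0 addr_ge0.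
have -> : z = (1 - (a + b)) *: c + (a + b) *:
    ((1 - b / (a + b)) *: v i + (b / (a + b)) *: v i.+1).
  apply: (om_ext om_nondeg) => w; move/(congr1 (fun z => om z w)): zE.
  by rewrite !omE => h; rewrite -[om z w](subrK (om c w)) h; field.
apply: cvx_hull; first by rewrite ltW.
  exact: hull_centroid.
apply: cvx_hull => //; apply/andP; split; first exact: divr_ge0 b0 (ltW ab_gt0).
by rewrite ler_pdivrMr // mul1r lerDr.
Qed.

Definition interior_halfplanes : set V := [set z | forall i, 0 < om (f i) (z - v i)].

(** In the fan triangle containing [z], the value at [z] of the form of side [j] is a sum of
    nonnegative terms in which the centroid counts strictly. If it vanishes, the centroid has weight
    0 and [z] is on the outer side of that triangle. *)
Lemma halfplanes_boundary z : halfplanes z -> ~ polyline q z -> interior_halfplanes z.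
Proof.
move=> zH nz; have [i [a [b [im a0 b0 ab zE]]]] := fan_cover zH.
move=> j; rewrite lt_neqAle zH andbT; apply/negP => /eqP /esym h0; apply: nz.
have vj k := ccw_support j k; have cj := centroid_gt0 j.
have : om (f j) (z - v j) = (1 - a - b) * om (f j) (c - v j) + a * om (f j) (v i - v j)
    + b * om (f j) (v i.+1 - v j).
  by rewrite -[z](subrK c) zE !(omDr om, omNr om, omZr om); ring.
have n1 : 0 <= (1 - a - b) * om (f j) (c - v j) by rewrite mulr_ge0 ?(ltW cj) //; lra.
have n2 : 0 <= a * om (f j) (v i - v j) by rewrite mulr_ge0.
have n3 : 0 <= b * om (f j) (v i.+1 - v j) by rewrite mulr_ge0.
rewrite h0 => /esym/eqP; rewrite paddr_eq0 ?addr_ge0 // paddr_eq0 //.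
rewrite !mulf_eq0 (gt_eqF cj) orbF => /andP[/andP[/eqP ab1 _] _].
exists i, b; split => //; first by rewrite b0; lra.
have -> : b = 1 - a by lra.
rewrite /side_point; apply: (om_ext om_nondeg) => w.
move/(congr1 (fun z => om z w)): zE; rewrite !omE => h.
by rewrite -[om z w](subrK (om c w)) h (_ : b = 1 - a); [ring|lra].
Qed.

End CcwPolygon.

(** * Areas of triangles *)

Section TriangleMeasure.
Context (R : realType).
Local Notation leb := (@lebesgue_measure R).
Local Notation mu2 := (leb \x leb)%E.

Lemma integral_affine (p q a b : R) : p < q ->
  (\int[leb]_(x in `]p, q[) (a + b * x)%:E =
    (a * (q - p) + b * (q ^+ 2 - p ^+ 2) / 2)%:E)%E.
Proof.
move=> pq.
have cf : continuous (fun x : R => a + b * x).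
  by move=> x; apply: cvgD; [exact: cvg_cst|apply: cvgM; [exact: cvg_cst|exact: cvg_id]].
rewrite -(@integral_itv_bndoo _ p q _ true false); last first.
  apply/measurable_EFinP; apply: measurable_funTS.
  exact: continuous_measurable_fun.
pose F (x : R) := a * x + b * x ^+ 2 / 2.
have dF (x : R) : is_derive x 1 F (a + b * x).
  have -> : F = a \*: (@id R) + (b / 2) \*: ((@id R) * (@id R)).
    apply/funext => z; change (a * z + b * z ^+ 2 / 2 = a * z + (b / 2) * (z * z)).
    by field.
  by apply: is_derive_eq; rewrite /GRing.scale /=; field.
rewrite (@continuous_FTC2 _ _ F) //.
- by rewrite -EFinB /F; congr EFin; field.
- exact: continuous_subspaceT.
- have cF : continuous F.
    by move=> x; apply: differentiable_continuous; apply/derivable1_diffP; exact: ex_derive.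
  split; first by move=> x _; exact: ex_derive.
    by apply: cvg_at_right_filter; exact: cF.
  by apply: cvg_at_left_filter; exact: cF.
- by move=> x _; rewrite derive1E; exact: derive_val.
Qed.

(** Each section is squeezed between an open and a closed interval of the same length, so boundary
    points never matter and open and closed triangles are handled at once. *)
Lemma measure_between (A : set (R * R)) (p q l0 l1 u0 u1 : R) : p < q ->
  measurable A ->
  (forall x, p < x < q -> l0 + l1 * x <= u0 + u1 * x) ->
  (forall x y, A (x, y) -> p <= x <= q) ->
  (forall x y, p < x < q -> A (x, y) -> l0 + l1 * x <= y <= u0 + u1 * x) ->
  (forall x y, p < x < q -> l0 + l1 * x < y < u0 + u1 * x -> A (x, y)) ->
  mu2 A = ((u0 - l0) * (q - p) + (u1 - l1) * (q ^+ 2 - p ^+ 2) / 2)%:E.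
Proof.
move=> pq mA lu Apq Alu luA; rewrite /product_measure1.
rewrite -integral_affine //.
transitivity (\int[leb]_(x in `[p, q]) (leb \o xsection A) x)%E.
  rewrite [RHS]integral_mkcond; apply: eq_integral => x _.
  rewrite patchE; case: ifPn => // /negP xpq /=.
  suff -> : xsection A x = set0 by rewrite measure0.
  apply/seteqP; split=> // y; rewrite /xsection /= inE => /Apq xpq'; apply: xpq.
  by rewrite inE /= in_itv.
have mf : measurable_fun `]p, q[ (leb \o xsection A).
  by apply: measurable_funTS; exact: measurable_fun_xsection.
rewrite integral_itv_bndoo //; apply: eq_integral => x; rewrite inE /= in_itv /= => xpq.
have -> : u0 - l0 + (u1 - l1) * x = (u0 + u1 * x) - (l0 + l1 * x) by ring.
have lux := lu _ xpq.
have mo : leb `](l0 + l1 * x), (u0 + u1 * x)[%classic = (u0 + u1 * x - (l0 + l1 * x))%:E.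
  rewrite lebesgue_measure_itv /= lte_fin; case: ltP => // h.
  by congr EFin; apply/eqP; rewrite eq_sym subr_eq0 eq_le h lux.
have mc : leb `[(l0 + l1 * x), (u0 + u1 * x)]%classic = (u0 + u1 * x - (l0 + l1 * x))%:E.
  rewrite lebesgue_measure_itv /= lte_fin; case: ltP => // h.
  by congr EFin; apply/eqP; rewrite eq_sym subr_eq0 eq_le h lux.
have mx : measurable (xsection A x) by exact: measurable_xsection.
apply/eqP; rewrite eq_le; apply/andP; split.
  rewrite -mc; apply: le_measure; rewrite ?inE //=.
  by move=> y; rewrite /xsection /= inE in_itv => /(Alu _ _ xpq).
rewrite -mo; apply: le_measure; rewrite ?inE //=.
by move=> y; rewrite /xsection /= inE in_itv => /(luA _ _ xpq).
Qed.

Lemma measurable_halfplane (b : bool) (k0 k1 k2 : R) :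
  measurable [set z : R * R | 0 < k0 + k1 * z.1 + k2 * z.2 ?<= if b].
Proof.
pose f (z : R * R) : R := k0 + k1 * z.1 + k2 * z.2.
have mf : measurable_fun setT f.
  by do ?[exact: measurable_fst|exact: measurable_snd|exact: measurable_cst
         |apply: measurable_funD|apply: measurable_funM].
rewrite (_ : [set _ | _] = f @^-1` [set` Interval (BSide b 0) +oo%O]).
  by rewrite -[_ @^-1` _]setTI; apply: mf => //; exact: measurable_itv.
by apply/seteqP; split=> z /=; rewrite in_itv /= andbT.
Qed.

(* [b = true] gives the closed triangle and [b = false] its interior. *)
Definition tri (b : bool) (p q r : R * R) : set (R * R) :=
  [set z | exists l1 l2 l3, [/\ 0 < l1 ?<= if b, 0 < l2 ?<= if b, 0 < l3 ?<= if b,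
    l1 + l2 + l3 = 1 &
    z = (l1 * p.1 + l2 * q.1 + l3 * r.1, l1 * p.2 + l2 * q.2 + l3 * r.2)]].

Definition det3 (p q r : R * R) : R :=
  (q.1 - p.1) * (r.2 - p.2) - (q.2 - p.2) * (r.1 - p.1).

Lemma triC b p q r : tri b p q r = tri b q p r.
Proof.
by apply/seteqP; split=> z [l1 [l2 [l3 [h1 h2 h3 h4 ->]]]]; exists l2, l1, l3;
  (split=> //; [rewrite -h4|congr pair]; ring).
Qed.

Lemma triCA b p q r : tri b p q r = tri b p r q.
Proof.
by apply/seteqP; split=> z [l1 [l2 [l3 [h1 h2 h3 h4 ->]]]]; exists l1, l3, l2;
  (split=> //; [rewrite -h4|congr pair]; ring).
Qed.

(** The three half-planes express the signs of the barycentric coordinates, which are affine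
    functions of the point by Cramer's rule. *)
Lemma measurable_tri b p q r : det3 p q r != 0 -> measurable (tri b p q r).
Proof.
move=> d0; rewrite /det3 in d0; set D := (X in X != 0) in d0.
pose H (k0 k1 k2 : R) := [set z : R * R | 0 < k0 / D + k1 / D * z.1 + k2 / D * z.2 ?<= if b].
rewrite (_ : tri _ _ _ _ =
  H (q.1 * r.2 - q.2 * r.1) (q.2 - r.2) (r.1 - q.1) `&`
  H (r.1 * p.2 - r.2 * p.1) (r.2 - p.2) (p.1 - r.1) `&`
  H (p.1 * q.2 - p.2 * q.1) (p.2 - q.2) (q.1 - p.1)).
  by apply: measurableI; [apply: measurableI|]; exact: measurable_halfplane.
apply/seteqP; split=> [z [l1 [l2 [l3 [h1 h2 h3 h4 ->]]]]|z [[h1 h2] h3]].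
  rewrite /H /=.
  have -> : l1 = 1 - l2 - l3 by rewrite -h4; ring.
  split; [split|].
  - apply: (eq_rect _ (fun t => is_true (0 < t ?<= if b)) h1).
    rewrite (_ : l1 = 1 - l2 - l3); last by rewrite -h4; ring.
    by move: d0; rewrite /D => d0; field.
  - by apply: (eq_rect _ (fun t => is_true (0 < t ?<= if b)) h2);
    move: d0; rewrite /D => d0; field.
  - by apply: (eq_rect _ (fun t => is_true (0 < t ?<= if b)) h3);
    move: d0; rewrite /D => d0; field.
do 3!eexists; split; [exact: h1|exact: h2|exact: h3| |].
  by move: d0; rewrite /D => d0; field.
by rewrite [LHS]surjective_pairing; congr pair; move: d0; rewrite /D => d0; field.
Qed.

Lemma measure_tri_vertical b p q r : p.1 = q.1 -> p.2 != q.2 -> r.1 != p.1 ->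
  mu2 (tri b p q r) = (`|det3 p q r| / 2)%:E.
Proof.
move=> pq1; wlog pq2 : p q pq1 / p.2 < q.2.
  move=> H pq2 rp; have [|le] := ltP p.2 q.2; first by move=> h; exact: H.
  rewrite triC H // ?lt_neqAle ?le 1?eq_sym ?pq2 -?pq1 1?eq_sym //.
  by rewrite -normrN; congr (`|_| / _)%:E; rewrite /det3 pq1; ring.
move=> _ rp.
have pr0 : p.1 - r.1 != 0 by rewrite subr_eq0 eq_sym.
have qp0 : q.2 - p.2 != 0 by rewrite subr_eq0 gt_eqF.
have qp : 0 < q.2 - p.2 by rewrite subr_gt0.
have mT : measurable (tri b p q r).
  apply: measurable_tri; rewrite /det3 -pq1 subrr mul0r sub0r oppr_eq0 mulf_neq0 //.
  by rewrite subr_eq0.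
(* The lines [l0 + l1 * x] and [u0 + u1 * x] join [r] to [p] and to [q]; the parameter [k] is 0 at
   [r] and 1 on the vertical side. *)
pose l1 := (p.2 - r.2) / (p.1 - r.1); pose u1 := (q.2 - r.2) / (p.1 - r.1).
pose l0 := r.2 - l1 * r.1; pose u0 := r.2 - u1 * r.1.
pose k (x : R) := (x - r.1) / (p.1 - r.1).
have lk x : l0 + l1 * x = r.2 + k x * (p.2 - r.2) by rewrite /l0 /l1 /k; field.
have uk x : u0 + u1 * x = r.2 + k x * (q.2 - r.2) by rewrite /u0 /u1 /k; field.
have kx x : k x * p.1 + (1 - k x) * r.1 = x by rewrite /k; field.
have kl (a c : R) : k (a * p.1 + c * r.1) = a + (a + c - 1) * r.1 / (p.1 - r.1).
  by rewrite /k; field.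
have H (m M : R) : m < M ->
   (forall x, m < x < M -> 0 < k x < 1) -> (forall x, 0 <= k x <= 1 -> m <= x <= M) ->
   mu2 (tri b p q r) = ((u0 - l0) * (M - m) + (u1 - l1) * (M ^+ 2 - m ^+ 2) / 2)%:E.
  move=> mM k01 k01'; apply: measure_between => //.
  - by move=> x /k01 /andP[k0 _]; rewrite lk uk lerD2l ler_wpM2l ?lerD2r // ltW.
  - move=> x y [a [c [d [a0 c0 d0 acd [-> _]]]]]; apply: k01'.
    rewrite -pq1 -mulrDl kl acd subrr !mul0r addr0.
    have := lteifW a0; have := lteifW c0; have := lteifW d0; lra.
  - move=> x y _ [a [c [d [a0 c0 d0 acd [-> ->]]]]]; rewrite lk uk.
    rewrite -pq1 -mulrDl kl acd subrr !mul0r addr0.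
    have := lteifW a0; have := lteifW c0 => c0' a0'.
    have h1 : 0 <= a * (q.2 - p.2) by rewrite mulr_ge0 // ltW.
    have h2 : 0 <= c * (q.2 - p.2) by rewrite mulr_ge0 // ltW.
    have -> : d = 1 - a - c by rewrite -acd; ring.
    by lra.
  - move=> x y /k01 /andP[k0 k1]; rewrite lk uk => /andP[yl yu].
    exists ((r.2 + k x * (q.2 - r.2) - y) / (q.2 - p.2)),
           ((y - (r.2 + k x * (p.2 - r.2))) / (q.2 - p.2)), (1 - k x).
    have W (t : R) : 0 < t -> 0 < t ?<= if b by case: b {mT} => //= /ltW.
    split; rewrite ?W ?divr_gt0 ?subr_gt0 //; first by field.
    congr pair; last by field.
    by rewrite -pq1 -{1}(kx x); field.
have dE : det3 p q r = (q.2 - p.2) * (p.1 - r.1) by rewrite /det3 pq1; ring.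
have [rp'|pr'|e] := ltgtP r.1 p.1; last by move: rp; rewrite e eqxx.
- rewrite (H r.1 p.1) //.
  + rewrite dE gtr0_norm ?mulr_gt0 ?subr_gt0 //; congr EFin.
    by rewrite /u0 /l0 /u1 /l1; field.
  + move=> x /andP[h1 h2]; rewrite /k divr_gt0 ?subr_gt0 //=.
    by rewrite ltr_pdivrMr ?subr_gt0 // mul1r ltrD2r.
  + move=> x; rewrite /k => /andP[]; rewrite pmulr_lge0 ?invr_gt0 ?subr_gt0 // => h1.
    by rewrite ler_pdivrMr ?subr_gt0 // mul1r; lra.
- have e x : k x = (r.1 - x) / (r.1 - p.1).
    rewrite /k -opprB -(opprB r.1 p.1) invrN mulrNN //.
  rewrite (H p.1 r.1) //.
  + rewrite dE ltr0_norm ?nmulr_llt0 ?subr_gt0 ?subr_lt0 //; congr EFin.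
    by rewrite /u0 /l0 /u1 /l1; field.
  + move=> x /andP[h1 h2]; rewrite e divr_gt0 ?subr_gt0 //=.
    by rewrite ltr_pdivrMr ?subr_gt0 // mul1r; lra.
  + move=> x; rewrite e => /andP[]; rewrite pmulr_lge0 ?invr_gt0 ?subr_gt0 // => h1.
    by rewrite ler_pdivrMr ?subr_gt0 // mul1r; lra.
Qed.

Lemma triS p q r : tri false p q r `<=` tri true p q r.
Proof.
move=> z [l1 [l2 [l3 [/ltW h1 /ltW h2 /ltW h3 h4 ->]]]].
by exists l1, l2, l3.
Qed.

Lemma det3C p q r : det3 q p r = - det3 p q r.
Proof. by rewrite /det3; ring. Qed.

Lemma det3CA p q r : det3 p r q = - det3 p q r.
Proof. by rewrite /det3; ring. Qed.

(** The triangle is cut along the vertical line through the vertex of middle abscissa, which meets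
    the opposite side at [d]. The closed halves cover the closed triangle and the open halves are
    disjoint in the open one; so both bounds follow from triangles with a vertical side. *)
Lemma measure_tri b p q r : det3 p q r != 0 ->
  mu2 (tri b p q r) = (`|det3 p q r| / 2)%:E.
Proof.
have main p' q' r' : p'.1 <= q'.1 -> q'.1 <= r'.1 -> det3 p' q' r' != 0 ->
    mu2 (tri b p' q' r') = (`|det3 p' q' r'| / 2)%:E.
  move: p' q' r' => {}p {}q {}r pq qr d0.
  have [e|/eqP npq] := eqVneq p.1 q.1.
    apply: measure_tri_vertical => //; apply: contraNneq d0; rewrite /det3 -e => ->;
      rewrite ?subrr; apply/eqP; ring.
  have [e|/eqP nqr] := eqVneq q.1 r.1.
    have E : det3 q r p = det3 p q r by rewrite /det3; ring.
    rewrite triC triCA -E measure_tri_vertical //; apply: contraNneq d0; rewrite /det3 -?e => ->;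
      rewrite ?subrr; apply/eqP; ring.
  have {npq}pq' : p.1 < q.1 by rewrite lt_neqAle pq andbT; apply/eqP.
  have {nqr}qr' : q.1 < r.1 by rewrite lt_neqAle qr andbT; apply/eqP.
  have pr : 0 < r.1 - p.1 by lra.
  pose t := (q.1 - p.1) / (r.1 - p.1).
  have t0 : 0 < t by rewrite divr_gt0 // subr_gt0.
  have t1 : 0 < 1 - t by rewrite subr_gt0 ltr_pdivrMr // mul1r; lra.
  have tE : t * (r.1 - p.1) = q.1 - p.1 by rewrite /t divfK // gt_eqF.
  pose d : R * R := (q.1, (1 - t) * p.2 + t * r.2).
  have d1 : d.1 = (1 - t) * p.1 + t * r.1.
    by rewrite /d /=; have := tE; rewrite mulrBr mulrBl mul1r; lra.
  have dE : det3 p q r = (r.1 - p.1) * (d.2 - q.2).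
    rewrite /d /= /det3 -tE; ring.
  have dq : d.2 - q.2 != 0 by move: d0; rewrite dE mulf_eq0 => /norP[].
  have dqd : q.2 != d.2 by rewrite eq_sym -subr_eq0.
  have E1 c : mu2 (tri c q d p) = (`|d.2 - q.2| * (q.1 - p.1) / 2)%:E.
    rewrite measure_tri_vertical // ?lt_eqF //.
    have -> : det3 q d p = (d.2 - q.2) * (q.1 - p.1) by rewrite /det3 /d /=; ring.
    by rewrite normrM [X in _ * X / _]gtr0_norm // subr_gt0.
  have E2 c : mu2 (tri c q d r) = (`|d.2 - q.2| * (r.1 - q.1) / 2)%:E.
    rewrite measure_tri_vertical // ?gt_eqF //.
    have -> : det3 q d r = - ((d.2 - q.2) * (r.1 - q.1)) by rewrite /det3 /d /=; ring.
    by rewrite normrN normrM [X in _ * X / _]gtr0_norm // subr_gt0.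
  have m1 c : measurable (tri c q d p).
    apply: measurable_tri; rewrite /det3 {1}/d /= subrr mul0r sub0r oppr_eq0.
    by rewrite mulf_neq0 // subr_eq0 lt_eqF.
  have m2 c : measurable (tri c q d r).
    apply: measurable_tri; rewrite /det3 {1}/d /= subrr mul0r sub0r oppr_eq0.
    by rewrite mulf_neq0 // subr_eq0 gt_eqF.
  have mT c : measurable (tri c p q r) by exact: measurable_tri.
  have mU c : measurable (tri c q d p `|` tri c q d r).
    by apply: measurableU; [exact: m1|exact: m2].
  have EE c : (`|det3 p q r| / 2)%:E = (mu2 (tri c q d p) + mu2 (tri c q d r))%E.
    by rewrite E1 E2 -EFinD dE normrM gtr0_norm //; congr EFin; field.
  have up : (mu2 (tri true p q r) <= (`|det3 p q r| / 2)%:E)%E.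
    apply: (@le_trans _ _ (mu2 (tri true q d p `|` tri true q d r))).
      apply: le_measure; [exact: (mem_set (mT _))|exact: (mem_set (mU _))|].
      move=> z [a [c [e [a0 c0 e0 ace ->]]]].
      have [h|h] := leP (e * (1 - t)) (a * t).
        left; exists c, (e / t), (a - e * (1 - t) / t).
        split => //=; first by rewrite divr_ge0 // ltW.
        + by rewrite subr_ge0 ler_pdivrMr.
        + by rewrite -[RHS]ace; field; rewrite gt_eqF.
        + rewrite (_ : q.1 = d.1) // d1; congr pair; field; rewrite gt_eqF //.
      right; exists c, (a / (1 - t)), (e - a * t / (1 - t)).
      split => //=; first by rewrite divr_ge0 // ltW.
      + by rewrite subr_ge0 ler_pdivrMr // ltW.
      + by rewrite -[RHS]ace; field; rewrite gt_eqF.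
      + rewrite (_ : q.1 = d.1) // d1; congr pair; field; rewrite gt_eqF //.
    apply: (le_trans (measureU2 _ _ _)); [exact: m1|exact: m2|].
    by rewrite (EE true); exact: lexx.
  have lo : ((`|det3 p q r| / 2)%:E <= mu2 (tri false p q r))%E.
    rewrite (EE false) -measureU; [|exact: m1|exact: m2|]; last first.
      apply/seteqP; split=> // z [[a [c [e [a0 c0 e0 ace ->]]]] [a' [c' [e' [a0' c0' e0' ace' [H _]]]]]].
      have h1 : e * p.1 < e * q.1 by rewrite ltr_pM2l.
      have h2 : e' * q.1 < e' * r.1 by rewrite ltr_pM2l.
      have ha : a = 1 - c - e by lra.
      have ha' : a' = 1 - c' - e' by lra.
      by move: H h1 h2; rewrite ha ha' /d /=; lra.
    apply: le_measure; [exact: (mem_set (mU _))|exact: (mem_set (mT _))|].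
    move=> z [[a [c [e [a0 c0 e0 ace ->]]]]|[a [c [e [a0 c0 e0 ace ->]]]]].
      exists (e + c * (1 - t)), a, (c * t); split=> //=.
      + by rewrite addr_gt0 // mulr_gt0.
      + by rewrite mulr_gt0.
      + by rewrite -[RHS]ace; ring.
      + by rewrite {2}(_ : q.1 = d.1) // d1; congr pair; ring.
    exists (c * (1 - t)), a, (e + c * t); split=> //=.
    + by rewrite mulr_gt0.
    + by rewrite addr_gt0 // mulr_gt0.
    + by rewrite -[RHS]ace; ring.
    + by rewrite {2}(_ : q.1 = d.1) // d1; congr pair; ring.
  have mid : (mu2 (tri false p q r) <= mu2 (tri true p q r))%E.
    by apply: le_measure; [exact: (mem_set (mT _))|exact: (mem_set (mT _))|exact: triS].
  apply/eqP; rewrite eq_le; case: b; rewrite ?up ?lo ?(le_trans mid up) ?(le_trans lo mid) //.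
move=> d0.
have n1 : det3 q p r != 0 by rewrite det3C oppr_eq0.
have n2 : det3 p r q != 0 by rewrite det3CA oppr_eq0.
have n4 : det3 q r p != 0 by rewrite det3CA oppr_eq0.
have n5 : det3 r q p != 0 by rewrite det3C oppr_eq0.
have [pq|/ltW qp] := leP p.1 q.1; have [qr|/ltW rq] := leP q.1 r.1.
- exact: main.
- have [pr|/ltW rp] := leP p.1 r.1.
    by rewrite triCA main // det3CA normrN.
  by rewrite triCA triC main // det3C det3CA opprK.
- have [pr|/ltW rp] := leP p.1 r.1.
    by rewrite triC main // det3C normrN.
  by rewrite triC triCA main // det3CA det3C opprK.
- by rewrite triC triCA triC main // det3C det3CA det3C opprK normrN.
Qed.

End TriangleMeasure.

(** * Regions bounded by closed polygons *)

Section Region.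
Context (R : realType) (V : normedModType R).
Implicit Types (p : seq V) (C : set V).

Lemma cvx_convex_set C : convex_set C <-> cvx C.
Proof.
split=> [cC x y k /andP[k0 k1] Cx Cy|cC x y k /set_mem Cx /set_mem Cy].
  have /set_mem := cC y x (Itv01 k0 k1) (mem_set Cy) (mem_set Cx).
  by rewrite /conv /= addrC.
apply: mem_set; rewrite /conv /= addrC.
have := cC y x k%:inum; apply => //.
by rewrite ge0 le1.
Qed.

Lemma cvx_connected C : cvx C -> connected C.
Proof.
move=> cC; have [->|/set0P[x Cx]] := eqVneq C set0; first exact: connected0.
pose seg y := (fun t : R => x + t *: (y - x)) @` `[0, 1].
have -> : C = \bigcup_(y in C) seg y.
  apply/seteqP; split=> [y Cy|_ [y Cy [t + <-]]].
    by exists y => //; exists 1; rewrite /= ?in_itv /= ?ler01 ?lexx // scale1r addrC subrK.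
  by rewrite /= in_itv /= -conv_shift => t01; exact: cC.
apply: bigcup_connected.
  exists x => y Cy; exists 0; rewrite /= ?in_itv /= ?lexx ?ler01 //.
  by rewrite scale0r addr0.
move=> y Cy; apply: connected_continuous_connected; first exact: segment_connected.
apply: continuous_subspaceT => t.
by apply: cvgD; [exact: cvg_cst|apply: cvgZr_tmp; exact: cvg_id].
Qed.

Lemma cvx_ball (x : V) (r : R) : cvx (ball x r).
Proof.
move=> y z k /andP[k0 k1]; rewrite -ball_normE /= => yr zr.
have -> : x - ((1 - k) *: y + k *: z) = (1 - k) *: (x - y) + k *: (x - z).
  rewrite !scalerBr addrACA -scalerDl subrK scale1r opprD //.
rewrite (le_lt_trans (ler_normD _ _)) // !normrZ !ger0_norm ?subr_ge0 //.
have [->|k1'] := eqVneq k 1; first by rewrite subrr mul0r add0r mul1r.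
have k1'' : 0 < 1 - k by rewrite subr_gt0 lt_neqAle k1'.
rewrite (@lt_le_trans _ _ ((1 - k) * r + k * r)) //; last by rewrite -mulrDl subrK mul1r.
by rewrite ltr_leD ?ltr_pM2l // ler_wpM2l // ltW.
Qed.

Lemma polyline_hull p : polyline p `<=` hull p.
Proof.
move=> x [i [t [ip t01 ->]]]; have p0 : (0 < size p)%N by case: (size p) ip.
by apply: cvx_hull => //; apply: mem_hull; exact: mem_vertex.
Qed.

Lemma polyline_closed p : closed (polyline p).
Proof.
have -> : polyline p = \bigcup_(i in `I_(size p)) (side_point p i @` `[0, 1]).
  apply/seteqP; split=> [x [i [t [ip t01 ->]]]|_ [i ip [t + <-]]].
    by exists i => //; exists t; rewrite //= in_itv.
  by rewrite /= in_itv /= => t01; exists i, t.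
apply: closed_bigcup => // i _; apply: compact_closed; first exact: norm_hausdorff.
apply: continuous_compact; last exact: segment_compact.
apply: continuous_subspaceT => t; rewrite /side_point.
apply: cvgD; apply: cvgZr_tmp; last exact: cvg_id.
by apply: cvgB; [exact: cvg_cst|exact: cvg_id].
Qed.

Lemma hull_bounded p : exists M, forall x, hull p x -> `|x| <= M.
Proof.
exists (\sum_(v <- p) `|v|) => x; apply: (hull_sub (C := [set x | `|x| <= \sum_(v <- p) `|v|])).
  move=> y z k /andP[k0 k1] /= hy hz; rewrite (le_trans (ler_normD _ _)) // !normrZ.
  rewrite !ger0_norm ?subr_ge0 //.
  have -> : \sum_(v <- p) `|v| = (1 - k) * (\sum_(v <- p) `|v|) + k * (\sum_(v <- p) `|v|) by ring.
  by rewrite lerD // ler_wpM2l // subr_ge0.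
by move=> v vp /=; rewrite (big_rem v vp) /= lerDl sumr_ge0.
Qed.

Lemma bounded_setP C : bounded_set C <-> exists M, forall x, C x -> `|x| <= M.
Proof.
split=> [[M [_ h]]|[M h]].
  by exists (M + 1) => x Cx; apply: (h (M + 1)) => //; rewrite ltrDl.
exists M; split; first exact: num_real.
by move=> N MN x Cx; apply: (le_trans (h x Cx)); exact: ltW.
Qed.

(** From a point outside the hull, the ray pointing away from a vertex never meets the hull; it is
    connected and unbounded, hence so is the component containing it. *)
Lemma region_sub_hull p : (0 < size p)%N -> region p `<=` hull p.
Proof.
move=> p0 x [/polyline_hull //|[npx /bounded_setP[M bM]]].
apply: contrapT => nhx; pose y := vertex p 0.
have hy : hull p y by apply: mem_hull; exact: mem_vertex.
have d0 : x - y != 0 by rewrite subr_eq0; apply: contra_not_neq nhx => ->.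
pose ray := [set z | exists2 t : R, 0 <= t & z = x + t *: (x - y)].
have rayC : ray `<=` ~` polyline p.
  move=> _ [t t0 ->] /polyline_hull hz; apply: nhx.
  have t1 : 0 < 1 + t by rewrite ltr_pwDl.
  have -> : x = (1 - t / (1 + t)) *: (x + t *: (x - y)) + (t / (1 + t)) *: y.
    rewrite conv_shift; have -> : y - (x + t *: (x - y)) = - ((1 + t) *: (x - y)).
      by rewrite scalerDl scale1r opprD addrA [RHS]opprD opprB.
    by rewrite scalerN scalerA divfK ?gt_eqF // addrK.
  apply: cvx_hull => //; rewrite divr_ge0 ?(ltW t1) //=.
  by rewrite ler_pdivrMr // mul1r lerDr.
have rayx : ray x by exists 0; rewrite ?scale0r ?addr0.
have conv_ray (d : V) s t k :
    (1 - k) *: (x + s *: d) + k *: (x + t *: d) = x + ((1 - k) * s + k * t) *: d.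
  by rewrite !scalerDr addrACA -scalerDl subrK scale1r !scalerA -scalerDl.
have ray_conn : connected ray.
  apply: cvx_connected => _ _ k /andP[k0 k1] [s s0 ->] [t t0 ->].
  exists ((1 - k) * s + k * t); first by rewrite addr_ge0 ?mulr_ge0 ?subr_ge0.
  exact: conv_ray.
have /(_ (x + ((`|M| + `|x| + 1) / `|x - y|) *: (x - y))) := @connected_component_max _ _ _ _ rayx rayC ray_conn.
move=> h; have {h}/bM : connected_component (~` polyline p) x (x + ((`|M| + `|x| + 1) / `|x - y|) *: (x - y)).
  by apply: h; exists ((`|M| + `|x| + 1) / `|x - y|) => //; rewrite divr_ge0 ?addr_ge0.
set w := _ *: (x - y) => le.
have wn : `|w| = `|M| + `|x| + 1.
  by rewrite /w normrZ ger0_norm ?divr_ge0 ?addr_ge0 // divfK // normr_eq0.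
have := ler_normB (x + w) x; rewrite [x + w]addrC addrK wn => h.
have := ler_norm M; move: le h; rewrite [x + w]addrC; lra.
Qed.

(** A ball that avoids the closed polyline lies in a single component. *)
Lemma region_nbhd p z : ~ polyline p z ->
  exists2 r : R, 0 < r & forall w, ball z r w -> (~ polyline p w) /\ (region p w <-> region p z).
Proof.
move=> npz; have : open (~` polyline p) by apply: closed_openC; exact: polyline_closed.
rewrite openE => /(_ z npz) /nbhs_ballP[r /= r0 rb]; exists r => // w wr.
have zz : ball z r z by exact: ballxx.
have cw : connected_component (~` polyline p) z w.
  by apply: (@connected_component_max _ _ _ _ zz rb) => //; apply/cvx_connected/cvx_ball.
have npw := rb _ wr; split=> //.
rewrite /region /= /setU /= -(same_connected_component cw).
by split=> -[//|[_ bd]]; right.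
Qed.

Lemma region_closed p : closed (region p).
Proof.
rewrite -[region p]setCK; apply: open_closedC; rewrite openE => z nz.
have npz : ~ polyline p z by move=> h; apply: nz; left.
have [r r0 rP] := region_nbhd npz.
apply/nbhs_ballP; exists r => //= w /rP[_ e] /e; exact: nz.
Qed.

Lemma region_convex p : (0 < size p)%N -> cvx (region p) -> region p = hull p.
Proof.
move=> p0 cr; apply/seteqP; split; first exact: region_sub_hull.
apply: hull_sub => // v /vertexP[i ip <-]; left; exists i, 0.
by split; rewrite ?lexx ?ler01 // /side_point subr0 scale1r scale0r addr0.
Qed.

End Region.

(** * Simple polygons with a convex region *)

Section ConvexRegion.
Context (R : realType) (V : normedModType R) (e1 e2 : V).
Hypothesis basis_e : is_basis2 e1 e2.
Context (om : {biscalar V}).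
Hypothesis om_alt : forall x : V, om x x = 0.
Hypothesis om_nondeg : forall x : V, (forall y : V, om x y = 0) -> x = 0.

Let omE := (omDl om, omDr om, omZl om, omZr om, omNl om, omNr om, om_alt).
Let omC := omC om_alt.
Let om_cont x := om_continuous basis_e om_alt om_nondeg (x := x).

Let om_affine_continuous (d w : V) : continuous (fun z => om d (z - w)).
Proof.
move=> z; apply: (@continuous_comp _ _ _ (fun z => z - w) (om d)); last exact: om_cont.
by apply: cvgB; [exact: cvg_id|exact: cvg_cst].
Qed.

Section Ccw.
Context (q : seq V).
Hypothesis q_ccw : ccw om q.
Local Notation m := (size q).
Local Notation w := (vertex q).
Local Notation g i := (vertex q i.+1 - vertex q i).

Let m_gt0 : (0 < m)%N. Proof. by case: q_ccw => /(ltn_trans _) -> //. Qed.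

Lemma closed_halfplanes : closed (halfplanes om q).
Proof.
have -> : halfplanes om q = \bigcap_(i in [set: nat]) [set z | 0 <= om (g i) (z - w i)].
  by apply/seteqP; split=> z h i; [move=> _; exact: h|exact: (h i I)].
apply: closed_bigI => i _; apply: (@closed_comp _ _ (fun z => om (g i) (z - w i)) [set x | 0 <= x]).
  by move=> z _; exact: om_affine_continuous.
exact: closed_ge.
Qed.

Lemma open_interior_halfplanes : open (interior_halfplanes om q).
Proof.
have -> : interior_halfplanes om q =
    ~` \bigcup_(i in `I_m) [set z | om (g i) (z - w i) <= 0].
  apply/seteqP; split=> z /= h.
    by move=> [i _ /=]; rewrite leNgt h.
  move=> i; rewrite ltNge; apply/negP => le; apply: h.
  exists (i %% m)%N; first by rewrite /= ltn_pmod.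
  by rewrite /= vertexS_mod vertex_mod.
apply: closed_openC; apply: closed_bigcup => // i _.
apply: (@closed_comp _ _ (fun z => om (g i) (z - w i)) [set x | x <= 0]).
  by move=> z _; exact: om_affine_continuous.
exact: closed_le.
Qed.

Lemma interior_halfplanesW : interior_halfplanes om q `<=` halfplanes om q.
Proof. by move=> z zU i; apply/ltW/zU. Qed.

(** Off the polyline the closed and the open half-plane conditions agree, so the part of a component
    inside the polygon is both open and closed in it. A component that meets the inside therefore
    stays in the bounded hull. *)
Lemma region_ccw : region q = hull q.
Proof.
apply/seteqP; split; first exact: region_sub_hull.
move=> z; rewrite (hull_halfplanes basis_e om_alt om_nondeg q_ccw) => zH.
have [pz|npz] := pselect (polyline q z); [by left|right]; split=> //.
have zU := halfplanes_boundary basis_e om_alt om_nondeg q_ccw zH npz.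
set C := connected_component _ _.
have Cz : C z by exact: connected_component_refl.
have CU : C `&` interior_halfplanes om q = C.
  apply: (@component_connected _ (~` polyline q) z); first by exists z.
    by exists (interior_halfplanes om q) => //; exact: open_interior_halfplanes.
  exists (halfplanes om q); first exact: closed_halfplanes.
  apply/seteqP; split=> x [Cx xU]; split=> //; first exact: interior_halfplanesW.
  apply: (halfplanes_boundary basis_e om_alt om_nondeg q_ccw xU).
  exact: connected_component_sub Cx.
have [M hM] := hull_bounded q; apply/bounded_setP; exists M => x Cx.
apply: hM; rewrite (hull_halfplanes basis_e om_alt om_nondeg q_ccw).
by apply: interior_halfplanesW; move: Cx; rewrite -CU => -[].
Qed.

Lemma interior_centroid : interior_halfplanes om q (centroid q).
Proof. by move=> i; exact: (centroid_gt0 om_alt q_ccw). Qed.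

Lemma ccw_ngon n : (m <= n)%N -> ngon n q.
Proof.
move=> mn; split; first by rewrite mn andbT; case: q_ccw.
  exact: (ccw_simple_closed om_alt q_ccw).
exists (centroid q); rewrite region_ccw (hull_halfplanes basis_e om_alt om_nondeg q_ccw).
apply: (@filterS _ _ _ (interior_halfplanes om q)); first exact: interior_halfplanesW.
by apply: open_nbhs_nbhs; split; [exact: open_interior_halfplanes|exact: interior_centroid].
Qed.

Definition ccw_boundary (z : V) := halfplanes om q z /\ exists j, om (g j) (z - w j) = 0.

Lemma side_point_boundary j t : 0 <= t <= 1 -> ccw_boundary (side_point q j t).
Proof.
move=> t01; split; last first.
  by exists j; rewrite /side_point om_convB subrr om0r om_alt !mulr0 addr0.
by apply: cvx_halfplanes => // i; exact: (ccw_support om_alt q_ccw).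
Qed.

(** Inside a side these are its two senses; at a vertex, the outgoing side and the reversed incoming
    one, which a strict turn keeps off a common ray. *)
Lemma ccw_boundary_directions z : ccw_boundary z -> exists j1 j2 d1 d2 (r : R),
  [/\ 0 < r, (forall e, 0 <= e <= r -> ccw_boundary (z + e *: d1)),
     (forall e, 0 <= e <= r -> ccw_boundary (z + e *: d2)),
     [/\ d1 != 0, d2 != 0 & forall a b, 0 < a -> 0 < b -> a *: d1 <> b *: d2] &
     [/\ om (g j1) d1 = 0, om (g j1) (z - w j1) = 0,
       om (g j2) d2 = 0 & om (g j2) (z - w j2) = 0]].
Proof.
move=> [zH [j0 zj0]].
have [j [t [jm t01 zE]]] : polyline q z.
  apply: contrapT => /(halfplanes_boundary basis_e om_alt om_nondeg q_ccw zH).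
  by move=> /(_ j0); rewrite zj0 ltxx.
have {jm t01 zE} [j' [t' [/andP[t0 t1] zE]]] : exists j t, 0 <= t < 1 /\ z = side_point q j t.
  have [t1|t1] := eqVneq t 1; last first.
    by exists j, t; split=> //; case/andP: t01 => -> h; rewrite lt_neqAle t1.
  exists j.+1, 0; rewrite lexx ltr01; split=> //.
  by rewrite zE t1 /side_point subrr scale0r add0r scale1r subr0 scale1r scale0r addr0.
move: j' t' t0 t1 zE => {}j {}t t0 t1 zE.
have gj k : g k != 0 by exact: (ccw_edge_neq0 om_alt q_ccw).
have zw : z = w j + t *: g j by rewrite zE /side_point conv_shift.
have fwd e : 0 <= e <= 1 - t -> ccw_boundary (z + e *: g j).
  move=> /andP[e0 e1']; have -> : z + e *: g j = side_point q j (t + e).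
    by rewrite /side_point conv_shift zw scalerDl addrA.
  by apply: side_point_boundary; rewrite addr_ge0 //=; lra.
have zj : om (g j) (z - w j) = 0 by rewrite zw addrAC subrr add0r omZr om_alt mulr0.
have [t00|t_neq0] := eqVneq t 0; last first.
  exists j, j, (g j), (- g j), (Num.min t (1 - t)); split.
  - have tp : 0 < t by rewrite lt_neqAle eq_sym t_neq0.
    by rewrite lt_min tp subr_gt0.
  - by move=> e; rewrite le_min => /and3P[e0 _ er]; apply: fwd; rewrite e0.
  - move=> e; rewrite le_min => /and3P[e0 e1' _].
    have -> : z + e *: - g j = side_point q j (t - e).
      by rewrite /side_point conv_shift zw scalerBl scalerN addrA.
    by apply: side_point_boundary; rewrite subr_ge0 e1' /=; lra.
  - split; rewrite ?oppr_eq0 // => a b a0 b0 /eqP; rewrite scalerN -subr_eq0 opprK -scalerDl scaler_eq0.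
    by rewrite (negPf (gj j)) orbF gt_eqF // addr_gt0.
  - by rewrite omNr om_alt oppr0.
(* The preceding side; adding [m] first keeps the predecessor meaningful for [j = 0]. *)
pose k := (j + m).-1.
have kS : k.+1 = (j + m)%N by rewrite /k prednK // addn_gt0 m_gt0 orbT.
have wk : w k.+1 = w j by rewrite kS vertexD.
have gk : g j = w k.+2 - w k.+1 by rewrite wk kS -addSn vertexD.
have {zw}zw : z = w j by rewrite zw t00 scale0r addr0.
exists j, k, (g j), (- g k), (1 - t); split.
- by rewrite subr_gt0.
- by move=> e; exact: fwd.
- move=> e; rewrite t00 subr0 => /andP[e0 e1'].
  have -> : z + e *: - g k = side_point q k (1 - e).
    by rewrite /side_point conv_shift zw -wk scalerBl scale1r scalerN addrA addrCA subrr addr0.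
  by apply: side_point_boundary; rewrite subr_ge0 e1' /=; lra.
- split; rewrite ?oppr_eq0 // => a b a0 b0 /(congr1 (om (g k))).
  rewrite omZr omZr omNr om_alt oppr0 mulr0 gk => /eqP.
  by rewrite mulf_eq0 (gt_eqF a0) (gt_eqF (ccw_turn om_alt q_ccw k)).
- by split; [exact: om_alt|exact: zj|rewrite omNr om_alt oppr0|rewrite zw -wk om_alt].
Qed.

End Ccw.

Lemma side_closed (p : seq V) i : closed (side_point p i @` `[0, 1]).
Proof.
apply: compact_closed; first exact: norm_hausdorff.
apply: continuous_compact; last exact: segment_compact.
apply: continuous_subspaceT => t; rewrite /side_point.
apply: cvgD; apply: cvgZr_tmp; last exact: cvg_id.
by apply: cvgB; [exact: cvg_cst|exact: cvg_id].
Qed.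

Lemma side_avoid (p : seq V) k (x d : V) : ~ (side_point p k @` `[0, 1]) x ->
  exists2 r : R, 0 < r & forall e, 0 <= e <= r -> ~ (side_point p k @` `[0, 1]) (x + e *: d).
Proof.
move=> nx; have := closed_openC (@side_closed p k); rewrite openE => /(_ x nx).
move=> /nbhs_ballP[r /= r0 rb]; have d1 : 0 < `|d| + 1 by rewrite ltr_wpDl.
exists (r / 2 / (`|d| + 1)); first by rewrite !divr_gt0.
move=> e /andP[e0 er]; apply: rb; rewrite -ball_normE /= opprD addrA subrr add0r normrN.
rewrite normrZ ger0_norm // (@le_lt_trans _ _ (e * (`|d| + 1))) //.
  by rewrite ler_wpM2l // lerDl.
by rewrite (@le_lt_trans _ _ (r / 2)) -?ler_pdivlMr //; lra.
Qed.

(** The sides are finitely many closed sets, so for a small step the side containing the displaced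
    point also contains the vertex itself; a simple path has only two such sides. *)
Lemma polyline_direction (p : seq V) i (d : V) (r : R) : (1 < size p)%N ->
  simple_closed p -> d != 0 -> 0 < r ->
  (forall e, 0 <= e <= r -> polyline p (vertex p i.+1 + e *: d)) ->
  exists2 a : R, 0 < a & d = a *: (vertex p i.+2 - vertex p i.+1) \/
                         d = - (a *: (vertex p i.+1 - vertex p i)).
Proof.
move=> p1 ps d0 r0 pd; set x := vertex p i.+1 in pd *.
have p0 : (0 < size p)%N by exact: ltnW.
have [e [e0 er eP]] : exists e : R, [/\ 0 < e, e <= r & forall k, (k < size p)%N ->
    (side_point p k @` `[0, 1]) (x + e *: d) -> (side_point p k @` `[0, 1]) x].
  suff H : forall n, exists2 e : R, 0 < e & e <= r /\ forall k, (k < n)%N -> forall e',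
      0 <= e' <= e ->
      (side_point p k @` `[0, 1]) (x + e' *: d) -> (side_point p k @` `[0, 1]) x.
    have [e e0 [er eP]] := H (size p); exists e; split=> // k kp; apply: eP => //.
    by rewrite lexx ltW.
  elim=> [|n [e e0 [er eP]]]; first by exists r.
  have [nx|/(side_avoid d)[r' r'0 r'P]] := pselect ((side_point p n @` `[0, 1]) x).
    exists e => //; split=> // k; rewrite ltnS leq_eqVlt => /predU1P[-> //|]; exact: eP.
  exists (Num.min e r'); first by rewrite lt_min e0.
  split; first by rewrite ge_min er.
  move=> k; rewrite ltnS leq_eqVlt => /predU1P[-> e'|kn e'].
    by rewrite le_min => /and3P[h0 _ h2] /r'P []; rewrite h0.
  by rewrite le_min => /and3P[h0 h1 _]; apply: eP => //; rewrite h0.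
have /pd [k [t [kp t01 xE]]] : 0 <= e <= r by rewrite ltW.
have [s s01 sx] : (side_point p k @` `[0, 1]) x.
  by apply: eP kp _; exists t => //=; rewrite in_itv.
move: s01; rewrite /= in_itv /= => /andP[s0 s1].
have xi : x = side_point p (i.+1 %% size p) 0.
  by rewrite /side_point subr0 scale1r scale0r addr0 vertex_mod.
(* For [s = 1] side [k] ends at the vertex and is the incoming one; otherwise simplicity forces
   [s = 0], and it is the outgoing one. *)
have [s1'|s_neq1] := eqVneq s 1.
  have kx : x = side_point p (k.+1 %% size p) 0.
    rewrite -sx s1' /side_point subrr scale0r add0r scale1r subr0 scale1r scale0r addr0.
    by rewrite vertex_mod.
  have [ik _] : (i.+1 %% size p = k.+1 %% size p)%N /\ 0 = 0 :> R.
    by apply: ps; rewrite ?ltn_pmod ?lexx ?ltr01 // -xi -kx.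
  have ki : vertex p k = vertex p i.
    have /eqP : (i + 1 = k + 1 %[mod size p])%N by rewrite !addn1.
    by rewrite eqn_modDr /vertex => /eqP ->.
  have xk : x = vertex p k.+1 by rewrite /x -(vertex_mod p i.+1) ik vertex_mod.
  have dE : e *: d = - ((1 - t) *: (x - vertex p i)).
    apply: (om_ext om_nondeg) => z; move/(congr1 (fun u => om u z)): xE.
    rewrite /side_point -xk ki !omE; lra.
  exists ((1 - t) / e); last first.
    right; rewrite mulrC -scalerA -scalerN -dE scalerA mulVf ?scale1r //.
    by rewrite gt_eqF.
  rewrite divr_gt0 // subr_gt0 lt_neqAle; case/andP: t01 => _ ->; rewrite andbT.
  apply: contraNneq d0 => t1; move/eqP: dE; rewrite t1 subrr scale0r oppr0 scaler_eq0.
  by rewrite gt_eqF.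
have [ik s00] : (i.+1 %% size p)%N = k /\ 0 = s.
  apply: ps; rewrite ?ltn_pmod ?lexx ?ltr01 // ?s0 ?lt_neqAle ?s_neq1 //.
  by rewrite -xi sx.
have dE : e *: d = t *: (vertex p i.+2 - x).
  move: xE; rewrite /side_point conv_shift -ik vertexS_mod vertex_mod => /addrI ->.
  by [].
exists (t / e); last first.
  left; rewrite mulrC -scalerA -dE scalerA mulVf ?scale1r //.
  by rewrite gt_eqF.
rewrite divr_gt0 // lt_neqAle; case/andP: t01 => -> _; rewrite andbT eq_sym.
apply: contraNneq d0 => t1; move/eqP: dE; rewrite t1 scale0r scaler_eq0.
by rewrite gt_eqF.
Qed.

Context (p q : seq V).
Hypothesis q_ccw : ccw om q.
Hypothesis p_simple : simple_closed p.
Hypothesis p_region : region p = hull q.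
Hypothesis p_size : (1 < size p)%N.
Hypothesis q_sub : forall v, v \in q -> v \in p.
Hypothesis p_sub : forall v, v \in p -> hull q v.

(** Off the polyline of [p] membership in the region is locally constant, whereas a small push
    across its side takes a boundary point out of the hull. *)
Lemma boundary_polyline z : ccw_boundary q z -> polyline p z.
Proof.
move=> [zH [j zj]]; apply: contrapT => npz.
have [r r0 rP] := region_nbhd npz.
have gj := ccw_edge_neq0 om_alt q_ccw j.
have [h gh] := om_exists om_nondeg gj.
pose e := r / 2 / (`|h| + 1); have e0 : 0 < e by rewrite !divr_gt0.
have /rP[_] : ball z r (z - e *: h).
  rewrite -ball_normE /= opprB addrCA subrr addr0 normrZ gtr0_norm //.
  rewrite (@le_lt_trans _ _ (e * (`|h| + 1))) //.
    by rewrite ler_wpM2l ?(ltW e0) // lerDl.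
  by rewrite /e divfK ?gt_eqF //; lra.
rewrite p_region (hull_halfplanes basis_e om_alt om_nondeg q_ccw) => -[_ /(_ zH) /(_ j)].
rewrite addrAC omDr zj add0r omNr omZr gh mulr1 oppr_ge0 leNgt => /negP; exact.
Qed.

(* The boundary of the hull is covered by the polyline of [p] and leaves a boundary
   vertex of [p] in two different directions, so that one of them is the direction
   of the outgoing side of [p]: by induction all of [p] runs along the boundary. *)
Lemma convex_region_side i : exists j,
  om (vertex q j.+1 - vertex q j) (vertex p i.+1 - vertex p i) = 0 /\
  om (vertex q j.+1 - vertex q j) (vertex p i - vertex q j) = 0.
Proof.
have p0 : (0 < size p)%N by exact: ltnW.
have step k : ccw_boundary q (vertex p k.+1) -> exists j,
    om (vertex q j.+1 - vertex q j) (vertex p k.+2 - vertex p k.+1) = 0 /\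
    om (vertex q j.+1 - vertex q j) (vertex p k.+1 - vertex q j) = 0.
  move=> bk; have [j1 [j2 [d1 [d2 [r [r0 b1 b2 [d10 d20 ndir] [gd1 gz1 gd2 gz2]]]]]]] :=
    ccw_boundary_directions q_ccw bk.
  have [a1 a10 [e1'|e1']] := polyline_direction p_size p_simple d10 r0
    (fun e er => boundary_polyline (b1 e er)).
    exists j1; split=> //; move: gd1; rewrite e1' omZr => /eqP.
    by rewrite mulf_eq0 gt_eqF // => /eqP.
  have [a2 a20 [e2'|e2']] := polyline_direction p_size p_simple d20 r0
    (fun e er => boundary_polyline (b2 e er)).
    exists j2; split=> //; move: gd2; rewrite e2' omZr => /eqP.
    by rewrite mulf_eq0 gt_eqF // => /eqP.
  (* Both directions would be opposite to the incoming side, hence on one ray. *)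
  by exfalso; apply: (ndir a2 a1) => //; rewrite e1' e2' !scalerN !scalerA mulrC.
have q0 : (0 < size q)%N by have [q3 _ _] := q_ccw; exact: ltn_trans q3.
have [i0 i0p i0E] := vertexP (q_sub (mem_vertex 0 q0)).
have b0 n : ccw_boundary q (vertex p (i0 + size p + n)%N).
  elim: n => [|n IH].
    rewrite addn0 vertexD i0E.
    have -> : vertex q 0 = side_point q 0 0.
      by rewrite /side_point subr0 scale1r scale0r addr0.
    by apply: side_point_boundary; rewrite ?lexx ?ler01.
  have kS : ((i0 + size p + n).-1.+1 = i0 + size p + n)%N by lia.
  have [|j [j1 j2]] := step (i0 + size p + n)%N.-1; first by rewrite kS.
  rewrite kS in j1 j2.
  split; last first.
    exists j; rewrite addnS -[vertex p _.+1](subrK (vertex p (i0 + size p + n)%N)) -addrA.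
    by rewrite omDr j1 j2 addr0.
  rewrite -(hull_halfplanes basis_e om_alt om_nondeg q_ccw); apply: p_sub.
  exact: mem_vertex.
(* The same vertex as [i], with an index large enough to be reached by the induction and to have a
   predecessor. *)
pose k := (i + i0.+1 * size p)%N.
have kS : k.-1.+1 = k by rewrite /k; lia.
have kE : k = (i0 + size p + (k - (i0 + size p)))%N.
  by rewrite subnKC // /k mulSn addnCA [(i0 + _)%N]addnC leq_add2l (leq_trans _ (leq_addl _ _)) // leq_pmulr.
have bk : ccw_boundary q (vertex p k.-1.+1) by rewrite kS kE.
have [j [j1 j2]] := step _ bk; exists j.
rewrite kS in j1 j2.
have vk l : vertex p (l + i0.+1 * size p)%N = vertex p l.
  by rewrite /vertex addnC modnMDl.
by rewrite -(vk i) -(vk i.+1) addSn.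
Qed.

End ConvexRegion.

(** * Areas of polygons *)

(** This links the product topology to the product sigma-algebra: an open set is the union of the
    countably many rational boxes that it contains. *)
Lemma open_measurable_plane (R : realType) (U : set (R * R)) : open U -> measurable U.
Proof.
move=> oU.
pose box (k : rat * rat * (rat * rat)) : set (R * R) :=
  `]ratr k.1.1, ratr k.1.2[%classic `*` `]ratr k.2.1, ratr k.2.2[%classic.
pose F k := if pselect (box k `<=` U) then box k else set0.
have -> : U = \bigcup_k F k.
  apply/seteqP; split=> [z Uz|z [k _]]; last first.
    by rewrite /F; case: pselect => // h /h.
  have /nbhs_ballP[r /= r0 rb] : nbhs z U by move: oU; rewrite openE; exact.
  have rr (x : R) : exists a b : rat, x - r < ratr a < x /\ x < ratr b < x + r.
    have lx : x - r < x by rewrite ltrBlDr ltrDl.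
    have xl : x < x + r by rewrite ltrDl.
    move: (rat_in_itvoo lx) (rat_in_itvoo xl) => [a' xa] [b' xb].
    by exists a', b'; move: xa xb; rewrite !in_itv.
  have [a [b [/andP[a1 a2] /andP[b1 b2]]]] := rr z.1.
  have [c [d [/andP[c1 c2] /andP[d1 d2]]]] := rr z.2.
  have bU : box ((a, b), (c, d)) `<=` U.
    move=> y [/=]; rewrite !in_itv /= => /andP[y1 y2] /andP[y3 y4]; apply: rb.
    by split; rewrite /= /ball /= ltr_norml; apply/andP; split; lra.
  exists ((a, b), (c, d)) => //; rewrite /F; case: pselect => [h|/(_ bU) //].
  by rewrite /box /= !in_itv /= a2 b1 c2 d1.
have mB k : measurable (box k) by apply: measurableX; exact: measurable_itv.
apply: countable_bigcupT_measurable => // k.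
by rewrite /F; case: pselect => [h|nh]; [exact: mB|exact: measurable0].
Qed.

Section Area.
Context (R : realType) (V : normedModType R) (e1 e2 : V).
Hypothesis basis_e : is_basis2 e1 e2.
Context (om : {biscalar V}).
Hypothesis om_alt : forall x : V, om x x = 0.
Hypothesis om_nondeg : forall x : V, (forall y : V, om x y = 0) -> x = 0.

Let omE := (omDl om, omDr om, omZl om, omZr om, omNl om, omNr om, om_alt).
Let omC := omC om_alt.
Let D := om e1 e2.
Let D0 : D != 0. Proof. exact: (basis_om_neq0 basis_e om_alt om_nondeg). Qed.

Local Notation mu2 := (@lebesgue_measure R \x @lebesgue_measure R)%E.
Local Notation lc := (lincomb2 e1 e2).

Definition plane_measurable (A : set V) := measurable (lc @^-1` A).

Definition coords (v : V) : R * R := (om v e2 / D, om e1 v / D).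

Lemma lincomb2_coords v : lc (coords v) = v.
Proof. by rewrite /lincomb2 /coords /= -(om_coord basis_e om_alt v D0). Qed.

Lemma coords_lincomb2 s : coords (lc s) = s.
Proof.
rewrite /lincomb2 /coords !omE !mulr0 addr0 add0r -/D !mulfK //.
by case: s.
Qed.

Lemma lincomb2_continuous : continuous lc.
Proof.
move=> s; rewrite /lincomb2; apply: cvgD; apply: cvgZr_tmp; first exact: cvg_fst.
exact: cvg_snd.
Qed.

Lemma open_plane_measurable A : open A -> plane_measurable A.
Proof.
move=> oA; apply: open_measurable_plane; apply: open_comp => // s _.
exact: lincomb2_continuous.
Qed.

Lemma closed_plane_measurable A : closed A -> plane_measurable A.
Proof.
move=> cA; rewrite /plane_measurable -[A]setCK preimage_setC; apply: measurableC.
exact: (open_plane_measurable (closed_openC cA)).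
Qed.

Lemma le_area A B : plane_measurable A -> plane_measurable B -> A `<=` B ->
  (area e1 e2 om A <= area e1 e2 om B)%E.
Proof.
move=> mA mB AB; rewrite /area lee_pmul2l ?fin_numE ?lte_fin ?normr_gt0 //.
by apply: le_measure; [exact: mem_set mA|exact: mem_set mB|move=> s; exact: AB].
Qed.

Definition triangle (b : bool) (x y z : V) : set V :=
  [set u | exists l1 l2 l3 : R, [/\ 0 < l1 ?<= if b, 0 < l2 ?<= if b, 0 < l3 ?<= if b,
    l1 + l2 + l3 = 1 & u = l1 *: x + l2 *: y + l3 *: z]].

Lemma preimage_triangle b x y z :
  lc @^-1` (triangle b x y z) = tri b (coords x) (coords y) (coords z).
Proof.
have C l1 l2 l3 : coords (l1 *: x + l2 *: y + l3 *: z) =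
   (l1 * (coords x).1 + l2 * (coords y).1 + l3 * (coords z).1,
    l1 * (coords x).2 + l2 * (coords y).2 + l3 * (coords z).2).
  by rewrite /coords !omE /=; congr pair; field.
apply/seteqP; split=> s [l1 [l2 [l3 [h1 h2 h3 h4 e]]]]; exists l1, l2, l3; split=> //.
  by rewrite -C -e coords_lincomb2.
by rewrite e -C lincomb2_coords.
Qed.

Lemma det3_coords x y z :
  det3 (coords x) (coords y) (coords z) = om (y - x) (z - x) / D.
Proof.
have P := om_plucker basis_e om_alt (y - x) (z - x) e1 e2.
have -> : om (y - x) (z - x) / D = (om (y - x) e2 * om e1 (z - x) - om e1 (y - x) * om (z - x) e2) / (D * D).
  rewrite invfM mulrA; congr (_ / _); apply: (mulIf D0); rewrite divfK //.
  move: P; rewrite -/D (omC e1 (z - x)) (omC e1 (y - x)); lra.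
by rewrite /det3 /coords !omE /=; field.
Qed.

Lemma triangle_measurable b x y z : om (y - x) (z - x) != 0 ->
  plane_measurable (triangle b x y z).
Proof.
move=> d0; rewrite /plane_measurable preimage_triangle; apply: measurable_tri.
by rewrite det3_coords mulf_neq0 // invr_eq0.
Qed.

Lemma area_triangle b x y z : om (y - x) (z - x) != 0 ->
  area e1 e2 om (triangle b x y z) = (`|om (y - x) (z - x)| / 2)%:E.
Proof.
move=> d0; rewrite /area preimage_triangle measure_tri; last first.
  by rewrite det3_coords mulf_neq0 // invr_eq0.
rewrite det3_coords -EFinM -/D normrM normfV; congr EFin; field.
by rewrite normr_eq0.
Qed.

Lemma area_bigsetU_le n (F : nat -> set V) : (forall i, (i < n)%N -> plane_measurable (F i)) ->
  plane_measurable (\big[setU/set0]_(i < n) F i) /\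
  (area e1 e2 om (\big[setU/set0]_(i < n) F i) <= \sum_(i < n) area e1 e2 om (F i))%E.
Proof.
elim: n => [|n IH] mF.
  rewrite !big_ord0; split; first by rewrite /plane_measurable preimage_set0.
  by rewrite /area preimage_set0 measure0 mule0.
have [i_n|m1 le1] := IH; first by move=> ?; apply: mF; exact: ltnW.
rewrite !big_ord_recr /=; split.
  by rewrite /plane_measurable preimage_setU; apply: measurableU => //; exact: mF.
apply: (@le_trans _ _ (area e1 e2 om (\big[setU/set0]_(i < n) F i) + area e1 e2 om (F n))%E);
  last exact: leeD2r.
rewrite /area -ge0_muleDr // lee_pmul2l ?fin_numE ?lte_fin ?normr_gt0 // preimage_setU.
by apply: measureU2 => //; exact: mF.
Qed.

Lemma area_disjointU_ge n (F : nat -> set V) (K : set V) :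
  plane_measurable K -> (forall i, (i < n)%N -> plane_measurable (F i)) ->
  (forall i, (i < n)%N -> F i `<=` K) ->
  (forall i j, (i < n)%N -> (j < n)%N -> (F i `&` F j) !=set0 -> i = j) ->
  (\sum_(i < n) area e1 e2 om (F i) <= area e1 e2 om K)%E.
Proof.
move=> mK mF FK dF.
have mU : measurable (\big[setU/set0]_(i < n) (lc @^-1` F i)).
  by apply: bigsetU_measurable => i _; exact: mF.
rewrite /area -ge0_sume_distrr //.
rewrite lee_pmul2l ?fin_numE ?lte_fin ?normr_gt0 //.
have tU : trivIset `I_n (fun i => lc @^-1` F i).
  by move=> i j im jm [s [si sj]]; apply: dF => //; exists (lc s).
apply: (@le_trans _ _ (mu2 (\big[setU/set0]_(i < n) (lc @^-1` F i)))).
  have -> : mu2 (\big[setU/set0]_(i < n) (lc @^-1` F i)) = (\sum_(i < n) mu2 (lc @^-1` F i))%E.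
    pose mm : {measure set _ -> \bar R} := mu2.
    exact: (@measure_semi_additive_ord_I _ _ _ mm (fun i => lc @^-1` F i) n mF tU mU).
  exact: lexx.
apply: le_measure; [exact: mem_set mU|exact: mem_set mK|].
elim/big_ind: _ => [s //|X Y XK YK s [/XK|/YK] //|i _ s]; exact: FK.
Qed.

Definition shoelace (q : seq V) : R := (\sum_(i < size q) om (vertex q i) (vertex q i.+1)) / 2.

(* The open triangles with apex [c] over the sides of [p] are disjoint: if two of
   them meet, then comparing the distances to both sides shows that [c] has the same
   weight in both representations, hence their sides meet. *)
Lemma fan_area_le (p : seq V) (c : V) (K : set V) : simple_closed p ->
  plane_measurable K -> cvx K -> K c -> (forall i, K (vertex p i)) ->
  (forall i, om (vertex p i.+1 - vertex p i) (c - vertex p i) != 0) ->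
  (forall i, (forall z, K z -> 0 <= om (vertex p i.+1 - vertex p i) (z - vertex p i)) \/
             (forall z, K z -> om (vertex p i.+1 - vertex p i) (z - vertex p i) <= 0)) ->
  ((\sum_(i < size p) `|om (vertex p i.+1 - vertex p i) (c - vertex p i)| / 2)%:E
    <= area e1 e2 om K)%E.
Proof.
move=> ps mK cK Kc Kp cn0 sup.
pose T i := triangle false c (vertex p i) (vertex p i.+1).
have fan i : om (vertex p i - c) (vertex p i.+1 - c) = om (vertex p i.+1 - vertex p i) (c - vertex p i).
  by rewrite !omE (omC c) (omC (vertex p i) (vertex p i.+1)) (omC (vertex p i) c); ring.
have ne i : om (vertex p i - c) (vertex p i.+1 - c) != 0 by rewrite fan.
have -> : (\sum_(i < size p) `|om (vertex p i.+1 - vertex p i) (c - vertex p i)| / 2)%:E =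
    (\sum_(i < size p) area e1 e2 om (T i))%E.
  by rewrite -sumEFin; apply: eq_bigr => i _; rewrite area_triangle // fan.
apply: (area_disjointU_ge mK).
- by move=> i _; exact: triangle_measurable.
- move=> i _ z [l1 [l2 [l3 [h1 h2 h3 h4 ->]]]].
  have h23 : 0 < l2 + l3 by rewrite addr_gt0.
  have -> : l1 *: c + l2 *: vertex p i + l3 *: vertex p i.+1 =
     (1 - (l2 + l3)) *: c + (l2 + l3) *: ((1 - l3 / (l2 + l3)) *: vertex p i +
       (l3 / (l2 + l3)) *: vertex p i.+1).
    have -> : l1 = 1 - (l2 + l3) by lra.
    rewrite scalerDr !scalerA addrA; congr (_ + _ *: _ + _ *: _); field; exact: lt0r_neq0.
  have h1' : 0 < l1 := h1.
  apply: (cK) => //; first by apply/andP; split; [exact: ltW|lra].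
  apply: cK => //; apply/andP; split; first by rewrite divr_ge0 // ltW.
  by rewrite ler_pdivrMr // mul1r lerDr ltW.
- have le i j z : T i z -> T j z -> exists l1 l2 l3 l1' l2' l3', [/\
      [/\ 0 < l2, 0 < l3 & l1 + l2 + l3 = 1], [/\ 0 < l2', 0 < l3' & l1' + l2' + l3' = 1],
      z = l1 *: c + l2 *: vertex p i + l3 *: vertex p i.+1,
      z = l1' *: c + l2' *: vertex p j + l3' *: vertex p j.+1 & l1 = l1'].
    move=> [l1 [l2 [l3 [h1 h2 h3 h4 e]]]] [l1' [l2' [l3' [h1' h2' h3' h4' e']]]].
    exists l1, l2, l3, l1', l2', l3'; split=> //.
    have key a b a1 a2 a3 b1 b2 b3 : 0 < a1 -> 0 < a2 -> 0 < a3 -> a1 + a2 + a3 = 1 ->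
        b1 + b2 + b3 = 1 ->
        a1 *: c + a2 *: vertex p a + a3 *: vertex p a.+1 =
        b1 *: c + b2 *: vertex p b + b3 *: vertex p b.+1 -> a1 <= b1.
      move=> a10 a20 a30 aE bE /(congr1 (fun z => om (vertex p b.+1 - vertex p b) (z - vertex p b))).
      have X (x1 x2 x3 : R) (y1 y2 y3 f y : V) : x1 + x2 + x3 = 1 ->
          om f (x1 *: y1 + x2 *: y2 + x3 *: y3 - y) =
          x1 * om f (y1 - y) + x2 * om f (y2 - y) + x3 * om f (y3 - y).
        by move=> xE; rewrite (_ : x1 = 1 - x2 - x3); [rewrite !omE; ring|lra].
      rewrite !X // subrr om0r om_alt !mulr0 !addr0.
      have := cn0 b; move: (sup b) (Kc) (Kp a) (Kp a.+1) => [] s /s + /s + /s.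
        move=> s1 s2 s3 n0 E; have s0 : 0 < om (vertex p b.+1 - vertex p b) (c - vertex p b).
          by rewrite lt_neqAle eq_sym n0.
        rewrite -(ler_pM2r s0) -E -addrA lerDl addr_ge0 // mulr_ge0 // ltW //.
      move=> s1 s2 s3 n0 E; have s0 : om (vertex p b.+1 - vertex p b) (c - vertex p b) < 0.
        by rewrite lt_neqAle n0.
      by rewrite -(ler_nM2r s0) -E -addrA gerDl -oppr_ge0 opprD addr_ge0 // -mulrN mulr_ge0 ?oppr_ge0 // ltW.
    apply/eqP; rewrite eq_le (key i j l1 l2 l3 l1' l2' l3') -?e //=.
    by rewrite (key j i l1' l2' l3' l1 l2 l3) -?e'.
  move=> i j im jm [z [Ti Tj]].
  have [l1 [l2 [l3 [l1' [l2' [l3' [[p2 p3 s1] [p2' p3' s1'] e e' ll]]]]]]] := le _ _ _ Ti Tj.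
  suff [] : i = j /\ l3 / (l2 + l3) = l3' / (l2' + l3') by [].
  apply: ps => //.
  + by rewrite divr_ge0 ?ltr_pdivrMr ?mul1r ?ltrDr ?addr_gt0 // ltW ?addr_gt0.
  + by rewrite divr_ge0 ?ltr_pdivrMr ?mul1r ?ltrDr ?addr_gt0 // ltW ?addr_gt0.
  + have sp k a b : 0 < a -> 0 < b -> a *: vertex p k + b *: vertex p k.+1 =
        (a + b) *: side_point p k (b / (a + b)).
      move=> a0 b0; rewrite /side_point scalerDr !scalerA; congr (_ *: _ + _ *: _); field;
        by rewrite lt0r_neq0 // addr_gt0.
    have : l2 + l3 = l2' + l3' by lra.
    move: e; rewrite e' -ll -!addrA !sp // => /addrI E h; rewrite h in E *.
    by apply/esym; apply: scalerI E; rewrite lt0r_neq0 // addr_gt0.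
Qed.

(** The closed fan triangles at the centroid cover the hull, the open ones are disjoint in it, and
    their total is the shoelace sum because the terms with the centroid telescope. *)
Lemma area_hull_ccw (q : seq V) : ccw om q ->
  area e1 e2 om (hull q) = (shoelace q)%:E.
Proof.
move=> qc; have q0 : (0 < size q)%N by case: qc => /(ltn_trans _) ->.
pose c := centroid q; pose v := vertex q.
have cpos i : 0 < om (v i.+1 - v i) (c - v i) by exact: (centroid_gt0 om_alt qc).
have mH : plane_measurable (hull q).
  apply: closed_plane_measurable; rewrite (hull_halfplanes basis_e om_alt om_nondeg qc).
  exact: (closed_halfplanes basis_e om_alt om_nondeg).
have S2 : shoelace q = \sum_(i < size q) `|om (v i.+1 - v i) (c - v i)| / 2.
  rewrite -mulr_suml; congr (_ / _).
  transitivity (\sum_(i < size q) (om (v i.+1) c - om (v i) c + om (v i) (v i.+1))).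
    rewrite big_split /= (@sum_cyclic_telescope _ _ (fun i => om (v i) c)) ?add0r //.
    by rewrite /v -[size q]add0n vertexD.
  apply: eq_bigr => i _; rewrite gtr0_norm //; move: (v i.+1) (v i) (c) => a b d.
  by rewrite !omE (omC a b); ring.
have cH : hull q c by exact: (hull_centroid qc).
have vH i : hull q (v i) by apply: mem_hull; exact: mem_vertex.
apply: le_anti; apply/andP; split; last first.
  rewrite S2; apply: fan_area_le => //; first exact: (ccw_simple_closed om_alt qc).
  - exact: cvx_hull.
  - by move=> i; rewrite gt_eqF.
  - by move=> i; left=> z; rewrite (hull_halfplanes basis_e om_alt om_nondeg qc); apply.
have fan i : om (v i - c) (v i.+1 - c) = om (v i.+1 - v i) (c - v i) := om_fan om_alt q i.
have ne i : om (v i - c) (v i.+1 - c) != 0 by rewrite fan gt_eqF.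
pose T i := triangle true c (v i) (v i.+1).
have [mU leU] := @area_bigsetU_le (size q) T (fun i _ => triangle_measurable true (ne i)).
apply: (@le_trans _ _ (area e1 e2 om (\big[setU/set0]_(i < size q) T i))).
  apply: le_area => // z; rewrite (hull_halfplanes basis_e om_alt om_nondeg qc).
  move=> /(fan_cover basis_e om_alt om_nondeg qc)[i [a [b [im a0 b0 ab zE]]]].
  rewrite -bigcup_mkord; exists i => //; exists (1 - a - b), a, b; split=> //=.
  - by lra.
  - by ring.
  - move: zE; rewrite -/c -/v; move: (v i) (v i.+1) (c) => x y d zE.
    apply: (om_ext om_nondeg) => u; move/(congr1 (fun z => om z u)): zE.
    rewrite !omE; lra.
apply: (le_trans leU); rewrite S2 -sumEFin lee_sum // => i _.
by rewrite area_triangle // fan.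
Qed.

End Area.

(** * Areas, homotheties and supporting lines of antidiscs *)

Section AreaOfPolygons.
Context (R : realType) (V : normedModType R) (e1 e2 : V).
Hypothesis basis_e : is_basis2 e1 e2.
Context (om : {biscalar V}).
Hypothesis om_alt : forall x : V, om x x = 0.
Hypothesis om_nondeg : forall x : V, (forall y : V, om x y = 0) -> x = 0.

Let omE := (omDl om, omDr om, omZl om, omZr om, omNl om, omNr om, om_alt).
Let omC := omC om_alt.
Let D0 : om e1 e2 != 0. Proof. exact: (basis_om_neq0 basis_e om_alt om_nondeg). Qed.
Let e10 : e1 != 0.
Proof. by apply/eqP => h; move: D0; rewrite h om0l eqxx. Qed.

Local Notation ar := (area e1 e2 om).

Lemma areaU A B : plane_measurable e1 e2 A -> plane_measurable e1 e2 B ->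
  A `&` B = set0 -> ar (A `|` B) = (ar A + ar B)%E.
Proof.
move=> mA mB AB; rewrite /area -ge0_muleDr // preimage_setU measureU //.
by rewrite -preimage_setI AB preimage_set0.
Qed.

(** [W] contains a small triangle of positive area, disjoint from [A]; the comparison is strict
    because the areas are finite. *)
Lemma area_lt A K W : plane_measurable e1 e2 A -> plane_measurable e1 e2 K ->
  A `<=` K -> W `<=` K -> open W -> W !=set0 -> A `&` W = set0 ->
  (ar K < +oo)%E -> (ar A < ar K)%E.
Proof.
move=> mA mK AK WK oW [z Wz] AW Kfin.
have /nbhs_ballP[r /= r0 rW] : nbhs z W by move: oW; rewrite openE; exact.
pose d := r / (`|e1| + `|e2| + 1).
have d0 : 0 < d by rewrite divr_gt0.
have dr : d * (`|e1| + `|e2|) < r.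
  have : d * (`|e1| + `|e2| + 1) = r by rewrite /d divfK // gt_eqF.
  by rewrite mulrDr mulr1; lra.
pose T := triangle false z (z + d *: e1) (z + d *: e2).
have omT : om (z + d *: e1 - z) (z + d *: e2 - z) = d ^+ 2 * om e1 e2.
  by rewrite ![z + _]addrC !addrK !omE; ring.
have omT0 : om (z + d *: e1 - z) (z + d *: e2 - z) != 0.
  by rewrite omT mulf_neq0 // expf_neq0 // gt_eqF.
have TW : T `<=` W.
  move=> _ [l1 [l2 [l3 [h1 h2 h3 h4 ->]]]]; apply: rW; rewrite -ball_normE /=.
  have h1' : 0 < l1 := h1; have h2' : 0 < l2 := h2; have h3' : 0 < l3 := h3.
  have -> : z - (l1 *: z + l2 *: (z + d *: e1) + l3 *: (z + d *: e2)) =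
      - ((l2 * d) *: e1 + (l3 * d) *: e2).
    apply: (om_ext om_nondeg) => u; rewrite !omE (_ : l1 = 1 - l2 - l3); [ring|lra].
  rewrite normrN (le_lt_trans (ler_normD _ _)) // !normrZ !gtr0_norm ?mulr_gt0 //.
  apply: le_lt_trans dr; rewrite mulrDr; apply: lerD; apply: ler_wpM2r => //;
    by rewrite ler_piMl ?(ltW d0) //; lra.
have mT : plane_measurable e1 e2 T.
  exact: (triangle_measurable basis_e om_alt om_nondeg).
have : (ar (A `|` T) <= ar K)%E.
  apply: (le_area basis_e om_alt om_nondeg) => //; first exact: measurableU.
  by move=> x [/AK|/TW/WK].
rewrite areaU //; last first.
  by apply/seteqP; split=> // x [Ax /TW Wx]; rewrite -AW.
rewrite (area_triangle basis_e om_alt om_nondeg) // => h; apply: lt_le_trans h.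
rewrite lteDl ?lte_fin ?divr_gt0 ?normr_gt0 // ge0_fin_numE; last first.
  by rewrite /area mule_ge0.
apply: le_lt_trans Kfin.
exact: (le_area basis_e om_alt om_nondeg).
Qed.

(** Vertices on one line would confine the hull, and with it the region, to that line, against the
    ball inside the region. *)
Lemma ngon_spanning n p : ngon n p -> forall d k, d != 0 ->
  exists2 x, x \in p & om d x != k.
Proof.
move=> [/andP[p3 _] _ [z /nbhs_ballP[r /= r0 rP]]] d k d0; apply: contrapT => h.
have pk x : x \in p -> om d x = k.
  by move=> xp; apply/eqP; apply: contrapT => /negP nk; apply: h; exists x.
have cK : cvx [set x | om d x = k].
  by move=> x y l _ /= hx hy; rewrite !omE hx hy; ring.
have rk x : region p x -> om d x = k.
  move=> /(region_sub_hull (ltn_trans (isT : (0 < 2)%N) p3)); exact: (hull_sub cK pk).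
have [w dw] := om_exists om_nondeg d0.
pose e := r / 2 / (`|w| + 1); have e0 : 0 < e by rewrite !divr_gt0.
have /rP/rk : ball z r (z + e *: w).
  rewrite -ball_normE /= opprD addrA subrr add0r normrN normrZ gtr0_norm //.
  rewrite (@le_lt_trans _ _ (e * (`|w| + 1))) //; first by rewrite ler_wpM2l ?(ltW e0) // lerDl.
  by rewrite /e divfK ?gt_eqF //; lra.
rewrite omDr (rk z) ?omZr ?dw; first by move/eqP; rewrite mulr1 -subr_eq0 addrC addKr gt_eqF.
by apply: rP; exact: ballxx.
Qed.

Lemma ngon_hull_polygon n p : ngon n p -> exists q,
  [/\ ccw om q, (size q <= n)%N, perimeter q <= perimeter p,
      (forall v, v \in q -> v \in p) & hull p = hull q].
Proof.
move=> pn; have [/andP[p3 pn'] _ _] := pn.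
have [q [q1 q2 q3 q4 q5]] :=
  exists_hull_polygon basis_e om_alt om_nondeg (ngon_spanning pn).
exists q; split=> //; first exact: leq_trans q4 pn'.
apply/seteqP; split; first exact: hull_le.
by apply: hull_le => v /q2; exact: mem_hull.
Qed.

(** A point of the hull missing from the region has a whole ball outside the region, and this ball
    meets the interior of the hull; equal areas leave no such point. *)
Lemma region_area_le n p q : ngon n p -> ccw om q -> hull p = hull q ->
  (ar (region p) <= (shoelace om q)%:E)%E /\
  (ar (region p) = (shoelace om q)%:E -> region p = hull q).
Proof.
move=> [/andP[p3 _] _ _] qc pq; have p0 : (0 < size p)%N by exact: ltn_trans p3.
have mr : plane_measurable e1 e2 (region p).
  exact: closed_plane_measurable (@region_closed _ _ p).
have cH : closed (hull q).
  rewrite (hull_halfplanes basis_e om_alt om_nondeg qc).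
  exact: (closed_halfplanes basis_e om_alt om_nondeg).
have mh : plane_measurable e1 e2 (hull q) by exact: closed_plane_measurable.
have rh : region p `<=` hull q by rewrite -pq; exact: region_sub_hull.
rewrite -(area_hull_ccw basis_e om_alt om_nondeg qc); split.
  exact: (le_area basis_e om_alt om_nondeg).
move=> E; apply/seteqP; split=> // z zh; apply: contrapT => nz.
have npz : ~ polyline p z by move=> h; apply: nz; left.
have [r r0 rP] := region_nbhd npz.
suff : (ar (region p) < ar (hull q))%E by rewrite E ltxx.
apply: (@area_lt _ _ (ball z r `&` interior_halfplanes om q)) => //.
- move=> x [_ /interior_halfplanesW]; rewrite (hull_halfplanes basis_e om_alt om_nondeg qc) //.
- apply: openI; first exact: ball_open.
  exact: (open_interior_halfplanes basis_e om_alt om_nondeg).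
- pose c := centroid q; have n0 : 0 < `|c - z| + 1 by rewrite ltr_wpDl.
  (* A short step from [z] towards the centroid stays in the ball and enters the open
     half-planes. *)
  pose e := Num.min 1 (r / 2 / (`|c - z| + 1)).
  have e0 : 0 < e by rewrite lt_min ltr01 !divr_gt0.
  have e1' : e <= 1 by rewrite ge_min lexx.
  have er : e <= r / 2 / (`|c - z| + 1) by rewrite ge_min lexx orbT.
  exists (z + e *: (c - z)); split.
    rewrite -ball_normE /= opprD addrA subrr add0r normrN normrZ gtr0_norm //.
    rewrite (@le_lt_trans _ _ (e * (`|c - z| + 1))) //; first by rewrite ler_wpM2l ?(ltW e0) // lerDl.
    by rewrite (@le_lt_trans _ _ (r / 2)) -?ler_pdivlMr //; lra.
  move: zh; rewrite (hull_halfplanes basis_e om_alt om_nondeg qc) => zh i.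
  rewrite -conv_shift om_convB ltr_wpDl //; first by rewrite mulr_ge0 ?subr_ge0.
  by rewrite mulr_gt0 // (centroid_gt0 om_alt qc).
- by apply/seteqP; split=> // x [rx [/rP[_ /iffLR h] _]]; exact: nz (h rx).
- by rewrite (area_hull_ccw basis_e om_alt om_nondeg qc) ltry.
Qed.

Definition homothety (k : R) (t : V) (q : seq V) : seq V := [seq t + k *: x | x <- q].

Lemma vertex_homothety k t q i : (0 < size q)%N ->
  vertex (homothety k t q) i = t + k *: vertex q i.
Proof. by move=> q0; rewrite /vertex size_map (nth_map 0) // ltn_pmod. Qed.

Lemma edge_homothety k t q i : (0 < size q)%N ->
  vertex (homothety k t q) i.+1 - vertex (homothety k t q) i =
  k *: (vertex q i.+1 - vertex q i).
Proof.
by move=> q0; rewrite !vertex_homothety // scalerBr opprD addrACA subrr add0r.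
Qed.

Lemma ccw_gt0 q : ccw om q -> (0 < size q)%N.
Proof. by case=> q3 _ _; exact: ltn_trans q3. Qed.

Lemma ccw_homothety k t q : 0 < k -> ccw om q -> ccw om (homothety k t q).
Proof.
move=> k0 qc; have q0 := ccw_gt0 qc; have [q3 qu qpos] := qc.
split; rewrite ?size_map //.
  rewrite map_inj_uniq // => x y /addrI; apply: scalerI; exact: lt0r_neq0.
move=> i j ji ji1; rewrite edge_homothety //.
have -> : vertex (homothety k t q) j - vertex (homothety k t q) i =
    k *: (vertex q j - vertex q i).
  by rewrite !vertex_homothety // scalerBr opprD addrACA subrr add0r.
by rewrite omZl omZr !mulr_gt0 // qpos.
Qed.

Lemma perimeter_homothety k t q : 0 < k -> (0 < size q)%N ->
  perimeter (homothety k t q) = k * perimeter q.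
Proof.
move=> k0 q0; rewrite /perimeter size_map mulr_sumr; apply: eq_bigr => i _.
by rewrite edge_homothety // normrZ gtr0_norm.
Qed.

Lemma shoelace_homothety k t q : (0 < size q)%N ->
  shoelace om (homothety k t q) = k ^+ 2 * shoelace om q.
Proof.
move=> q0; rewrite /shoelace size_map mulrA; congr (_ / _).
transitivity (\sum_(i < size q) (k * (om t (vertex q i.+1) - om t (vertex q i))
    + k ^+ 2 * om (vertex q i) (vertex q i.+1))).
  apply: eq_bigr => i _; rewrite !vertex_homothety //.
  move: (vertex q i.+1) (vertex q i) => y x.
  by rewrite !omE (omC x t); ring.
rewrite big_split /= -!mulr_sumr (@sum_cyclic_telescope _ _ (fun i => om t (vertex q i))).
  by rewrite mulr0 add0r.
by rewrite -[size q]add0n vertexD.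
Qed.

Lemma perimeter_gt0 q : ccw om q -> 0 < perimeter q.
Proof.
move=> qc; have q0 := ccw_gt0 qc; rewrite /perimeter.
rewrite (bigD1 (Ordinal q0)) //= ltr_pwDl ?sumr_ge0 // normr_gt0.
exact: (ccw_edge_neq0 om_alt qc).
Qed.

Lemma shoelace_gt0 q : ccw om q -> 0 < shoelace om q.
Proof.
move=> qc; have q0 := ccw_gt0 qc; rewrite divr_gt0 //.
have E : \sum_(i < size q) om (vertex q i) (vertex q i.+1) =
    \sum_(i < size q) om (vertex q i.+1 - vertex q i) (centroid q - vertex q i).
  symmetry; transitivity (\sum_(i < size q) (om (vertex q i.+1) (centroid q) -
     om (vertex q i) (centroid q) + om (vertex q i) (vertex q i.+1))).
    apply: eq_bigr => i _; move: (vertex q i.+1) (vertex q i) (centroid q) => a b d.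
    by rewrite !omE (omC a b); ring.
  rewrite big_split /= (@sum_cyclic_telescope _ _ (fun i => om (vertex q i) (centroid q))) ?add0r //.
  by rewrite -[size q]add0n vertexD.
rewrite E (bigD1 (Ordinal q0)) //= ltr_pwDl //; first exact: (centroid_gt0 om_alt qc).
by apply: sumr_ge0 => i _; apply/ltW; exact: (centroid_gt0 om_alt qc).
Qed.

Lemma ccw_area q : ccw om q -> ar (region q) = (shoelace om q)%:E.
Proof.
move=> qc; rewrite (region_ccw basis_e om_alt om_nondeg qc).
exact: (area_hull_ccw basis_e om_alt om_nondeg).
Qed.

(** [sup] is informative only for a nonempty set bounded above; the normalized [e1] and [om_bounded]
    provide these two facts. *)
Lemma antinorm_leP x rho :
  antinorm om x <= rho <-> forall y, `|y| = 1 -> om x y <= rho.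
Proof.
have [M hM] := om_bounded basis_e om_alt om_nondeg x.
have ub : ubound [set om x y | y in [set y : V | `|y| = 1]] M.
  by move=> _ [y /= y1 <-]; rewrite (le_trans (ler_norm _)) // -[M]mulr1 -y1.
have ne : [set om x y | y in [set y : V | `|y| = 1]] !=set0.
  exists (om x (`|e1|^-1 *: e1)), (`|e1|^-1 *: e1) => //=.
  by rewrite normrZ normfV normr_id mulVf // normr_eq0.
split=> [le y y1|h]; last first.
  by apply: ge_sup => // _ [y /= y1 <-]; exact: h.
apply: le_trans le; apply: ub_le_sup; first by exists M.
by exists y.
Qed.

(** Homogeneity passes from unit vectors to all [f] and presents the antidisc as an intersection of
    half-planes; the sign from exchanging the arguments is absorbed by the symmetry of the norm. *)
Lemma antidiscP c rho z : 0 < rho ->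
  antidisc om c rho z <-> forall f, om f (z - c) <= rho * `|f|.
Proof.
move=> r0; rewrite /antidisc /=; split=> [/antinorm_leP h f|h]; last first.
  by apply/antinorm_leP => y y1; rewrite omC -omNl -[rho]mulr1 -y1 -normrN.
have [->|f0] := eqVneq f 0; first by rewrite om0l normr0 mulr0.
have n0 : 0 < `|f| by rewrite normr_gt0.
have := h (- `|f|^-1 *: f); rewrite normrZ normrN normfV normr_id mulVf ?gt_eqF //.
move=> /(_ erefl); rewrite omZr mulNr -mulrN -omC mulrC ler_pdivrMr //.
Qed.

(** A dual vector [w] of [f = b - a] gives the points [c + rho *: w] and [c - rho *: w] of the
    antidisc at which [om f] is extreme; the equation puts one of them on the line. *)
Lemma line_supportsP c rho a b : 0 < rho -> a != b ->
  line_supports om a b (antidisc om c rho) <-> `|om (b - a) (c - a)| = rho * `|b - a|.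
Proof.
move=> r0 ab; have [f fE] : exists f, f = b - a by exists (b - a).
have f0 : f != 0 by rewrite fE subr_eq0 eq_sym.
rewrite /line_supports -fE; have [w [fw wb]] := om_dual_norm basis_e om_alt om_nondeg f.
have memw (s : R) : `|s| = rho -> antidisc om c rho (c + s *: w).
  move=> s1; apply/antidiscP => // g; rewrite addrC addKr omZr.
  by rewrite (le_trans (ler_norm _)) // normrM s1 ler_wpM2l ?(ltW r0) // omC normrN.
have cr (s : R) : om f (c + s *: w - a) = om f (c - a) + s * `|f|.
  by rewrite !omE fw; ring.
have up z : antidisc om c rho z -> `|om f (z - c)| <= rho * `|f|.
  move=> /(antidiscP _ _ r0) h; rewrite ler_norml h andbT lerNl -omNl -[`|f|]normrN.
  exact: h.
have sp z : om f (z - a) = om f (z - c) + om f (c - a) by rewrite !omE; ring.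
have rn : `|rho| = rho by rewrite gtr0_norm.
split=> [[[t At] side]|E].
  have le1 : `|om f (c - a)| <= rho * `|f|.
    have := up _ At; suff -> : om f ((1 - t) *: a + t *: b - c) = - om f (c - a).
      by rewrite normrN.
    by rewrite -[RHS]omNr opprB conv_shift -addrA [t *: _ + _]addrC addrA omDr -fE omZr om_alt mulr0 addr0.
  apply/eqP; rewrite eq_le le1 /=; case: side => H.
    have := H _ (memw (- rho) _); rewrite normrN rn => /(_ erefl).
    by rewrite cr mulNr subr_ge0 => /le_trans; apply; exact: ler_norm.
  have := H _ (memw rho rn); rewrite cr -lerBrDl sub0r => /le_trans -> //.
  by rewrite -normrN ler_norm.
have online z : om f (z - a) = 0 -> exists t : R, (1 - t) *: a + t *: b = z.
  move=> /(om_parallel basis_e om_alt om_nondeg f0)[l hl]; exists l.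
  by rewrite conv_shift -fE -hl addrC subrK.
have [p0|p0] := leP 0 (om f (c - a)).
  rewrite ger0_norm // in E; split.
    have [|t tE] := online (c + (- rho) *: w); first by rewrite cr E mulNr subrr.
    by exists t; rewrite tE; apply: memw; rewrite normrN.
  by left=> z /up; rewrite ler_norml sp E => /andP[]; lra.
rewrite ltr0_norm // in E; split.
  have [|t tE] := online (c + rho *: w); first by rewrite cr -E subrr.
  by exists t; rewrite tE; exact: memw.
by right=> z /up; rewrite ler_norml sp -E => /andP[]; lra.
Qed.

End AreaOfPolygons.

(** * Circumscribed polygons *)

Section Zenodorus.
Context (R : realType) (V : normedModType R) (e1 e2 : V).
Hypothesis basis_e : is_basis2 e1 e2.
Context (om : {biscalar V}).
Hypothesis om_alt : forall x : V, om x x = 0.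
Hypothesis om_nondeg : forall x : V, (forall y : V, om x y = 0) -> x = 0.

Let omE := (omDl om, omDr om, omZl om, omZr om, omNl om, omNr om, om_alt).
Let omC := omC om_alt.
Local Notation ar := (area e1 e2 om).
Local Notation edge q i := (vertex q i.+1 - vertex q i).

(** [s] is twice the area bounded by the possibly degenerate list of the [y i], which is also its
    perimeter. The hull construction yields a polygon [h] of perimeter at most [s], so the
    inequality is stated with [s]. *)
Lemma polar_polygon (q : seq V) : ccw om q -> exists h (s : R),
  [/\ ccw om h, (size h <= size q)%N, 0 < s, perimeter h <= s &
   [/\ forall j, om (edge h j) (vertex h j) = - `|edge h j|,
     shoelace om h = perimeter h / 2,
     2 * shoelace om q * s <= perimeter q ^+ 2 &
     2 * shoelace om q * s = perimeter q ^+ 2 -> exists r t,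
       [/\ 0 < r, r * s = perimeter q &
         forall i, om (edge q i) (t - vertex q i) = r * `|edge q i|]]].
Proof.
move=> qc; have q0 := ccw_gt0 qc; set m := size q.
have [f fE] : exists f, forall i, f i = edge q i by exists (fun i => edge q i).
have turn i : 0 < om (f i) (f i.+1) by rewrite !fE; exact: (ccw_turn om_alt qc).
have supp i k : 0 <= om (f i) (vertex q k - vertex q i).
  by rewrite fE; exact: (ccw_support om_alt qc).
have v_per i : vertex q (i + m)%N = vertex q i by exact: vertexD.
have [y [yE yES]] : exists y : nat -> V, (forall i, om (f i) (y i) = - `|f i|) /\
    forall i, om (f i.+1) (y i) = - `|f i.+1|.
  (* The intersection of the two lines of directions [f i] and [f i.+1] that support the unit
     anticircle. *)
  exists (fun i => (om (f i) (f i.+1))^-1 *: (`|f i.+1| *: f i - `|f i| *: f i.+1)).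
  split=> i; rewrite omZr omDr omNr !omZr om_alt mulr0.
    by rewrite add0r mulrN mulrCA mulVf ?mulr1 // lt0r_neq0.
  by rewrite oppr0 addr0 (omC (f i.+1)) !mulrN mulrCA mulVf ?mulr1 // lt0r_neq0.
have y_per := polar_vertex_per basis_e om_alt v_per fE turn yE yES.
have [s0 [smink seq]] := minkowski_polar basis_e om_alt om_nondeg q0 v_per fE turn supp yE yES.
have sper := polar_perimeter basis_e om_alt om_nondeg m fE turn supp yE yES.
have ysup := polar_vertex_support basis_e om_alt fE turn supp yE yES.
set s := \sum_(i < m) om (y i) (y i.+1) in s0 smink seq sper.
have perE : \sum_(i < m) `|f i| = perimeter q.
  by rewrite /perimeter; apply: eq_bigr => i _; rewrite fE.
have shE : \sum_(i < m) om (vertex q i) (vertex q i.+1) = 2 * shoelace om q.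
  by rewrite /shoelace mulrC divfK // pnatr_eq0.
rewrite perE shE in smink seq.
(* [om g] is least over [q] at the vertex [k.+1]. Its two neighbours are no lower, which puts [g] in
   the cone of [f k] and [f k.+1]. *)
have cone g : g != 0 -> exists k (a b : R), [/\ 0 <= a, 0 <= b,
    g = a *: f k + b *: f k.+1 & om g (y k) < 0].
  move=> g0; have [w wq wmin] := exists_min_seq (om g) (mem_vertex 0 q0).
  have [j jm wE] := vertexP wq; pose k := (j + m).-1.
  have kS : k.+1 = (j + m)%N by rewrite /k prednK // addn_gt0 orbC q0.
  have vk : vertex q k.+1 = w by rewrite kS v_per.
  have mn i : om g w <= om g (vertex q i) by apply: wmin; exact: mem_vertex.
  have a0 : 0 <= om g (f k.+1) by rewrite fE vk omDr omNr subr_ge0.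
  have b0 : 0 <= om (f k) g by rewrite omC oppr_ge0 fE vk omDr omNr subr_le0.
  have sk := turn k.
  have [a [b [gE a0' b0']]] : exists a b : R,
      [/\ g = a *: f k + b *: f k.+1, 0 <= a & 0 <= b].
    exists (om g (f k.+1) / om (f k) (f k.+1)), (om (f k) g / om (f k) (f k.+1)).
    split; [exact: (om_coord basis_e om_alt g (lt0r_neq0 sk))| |];
      by rewrite divr_ge0 // ltW.
  have fn i : 0 < `|f i|.
    rewrite normr_gt0; apply/eqP => h.
    by have := turn i; rewrite h om0l ltxx.
  exists k, a, b; split=> //.
  have -> : om g (y k) = - (a * `|f k| + b * `|f k.+1|).
    by rewrite {1}gE omDl !omZl yE yES; ring.
  have ge0 : 0 <= a * `|f k| + b * `|f k.+1| by rewrite addr_ge0 // mulr_ge0.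
  rewrite oppr_lt0 lt0r ge0 andbT.
  rewrite (paddr_eq0 (mulr_ge0 a0' (ltW (fn k))) (mulr_ge0 b0' (ltW (fn k.+1)))).
  rewrite !mulf_eq0 !(gt_eqF (fn _)) !orbF.
  apply: contraNN g0 => /andP[/eqP a00 /eqP b00].
  by rewrite gE a00 b00 !scale0r addr0.
pose ys := mkseq y m.
have ysz : size ys = m by rewrite size_mkseq.
have yv i : vertex ys i = y i.
  by rewrite /vertex ysz nth_mkseq ?ltn_pmod // (periodic_modn y_per).
have yin i : y i \in ys by rewrite -yv mem_vertex // ysz.
have ysP x : x \in ys -> exists i, x = y i by move=> /vertexP[i _ <-]; exists i.
have spanning d k : d != 0 -> exists2 x, x \in ys & om d x != k.
  move=> d0; have [i [_ [_ [_ _ _ i0]]]] := cone _ d0.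
  have [|j [_ [_ [_ _ _ j0]]]] := cone (- d); first by rewrite oppr_eq0.
  have [e|ne] := eqVneq (om d (y i)) k; last by exists (y i).
  exists (y j) => //; rewrite gt_eqF // -e (lt_trans i0) //.
  by move: j0; rewrite omNl oppr_lt0.
have [h [hc h_ys ys_h hsz hper]] := exists_hull_polygon basis_e om_alt om_nondeg spanning.
have hperE : perimeter h <= s.
  rewrite -sper (le_trans hper) // /cper ysz le_eqVlt; apply/orP; left; apply/eqP.
  by apply: eq_bigr => i _; rewrite !yv.
have h0 := ccw_gt0 hc.
(* Both ends of side [j] of [h] are among the [y i] and minimize [om g], where
   [g = a *: f k + b *: f k.+1]. If [a] and [b] were both positive, these ends would coincide; so
   [g] is a multiple of a single [f], and its norm is the weighted sum. *)
have edgeh j : om (edge h j) (vertex h j) = - `|edge h j|.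
  have g0 := ccw_edge_neq0 om_alt hc j.
  have [k [a [b [a0 b0 gE _]]]] := cone _ g0.
  have gy : om (edge h j) (vertex h j) <= om (edge h j) (y k).
    rewrite -subr_ge0 -omNr -omDr.
    have := ys_h _ (yin k); rewrite (hull_halfplanes basis_e om_alt om_nondeg hc).
    exact.
  have gy1 : om (edge h j) (vertex h j.+1) = om (edge h j) (vertex h j).
    by apply/eqP; rewrite -subr_eq0 -omNr -omDr om_alt.
  have [a' aE] := ysP _ (h_ys _ (mem_vertex j h0)).
  have [b' bE] := ysP _ (h_ys _ (mem_vertex j.+1 h0)).
  set g := edge h j in g0 gE gy gy1 *.
  have eqs l : om g (y l) <= om g (y k) ->
      a * (om (f k) (y l) + `|f k|) = 0 /\ b * (om (f k.+1) (y l) + `|f k.+1|) = 0.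
    have n1 : 0 <= a * (om (f k) (y l) + `|f k|).
      by rewrite mulr_ge0 // -lerBlDr sub0r.
    have n2 : 0 <= b * (om (f k.+1) (y l) + `|f k.+1|).
      by rewrite mulr_ge0 // -lerBlDr sub0r.
    by rewrite gE !(omDl om, omZl om) yE yES => le; split; apply: le_anti; lra.
  have [ea1 ea2] : a * (om (f k) (y a') + `|f k|) = 0 /\
      b * (om (f k.+1) (y a') + `|f k.+1|) = 0 by apply: eqs; rewrite -aE.
  have [eb1 eb2] : a * (om (f k) (y b') + `|f k|) = 0 /\
      b * (om (f k.+1) (y b') + `|f k.+1|) = 0 by apply: eqs; rewrite -bE gy1.
  have val : om g (vertex h j) = - (a * `|f k| + b * `|f k.+1|).
    by rewrite aE gE !(omDl om, omZl om); lra.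
  rewrite val; congr (- _).
  have [a00|an0] := eqVneq a 0.
    by rewrite gE a00 scale0r mul0r !add0r normrZ ger0_norm.
  have [b00|bn0] := eqVneq b 0.
    by rewrite gE b00 scale0r mul0r !addr0 normrZ ger0_norm.
  have cancel (u : R) w : u != 0 -> u * w = 0 -> w = 0.
    by move=> u0 /eqP; rewrite mulf_eq0 (negPf u0) => /eqP.
  have ab : y a' = y b'.
    have tk := lt0r_neq0 (turn k); apply: (om_inj basis_e om_alt tk).
      by have := cancel _ _ an0 ea1; have := cancel _ _ an0 eb1; lra.
    by have := cancel _ _ bn0 ea2; have := cancel _ _ bn0 eb2; lra.
  by move: g0; rewrite /g aE bE ab subrr eqxx.
exists h, s; split=> //; first by rewrite -ysz.
split=> //.
  rewrite /shoelace; congr (_ / _); rewrite /perimeter; apply: eq_bigr => j _.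
  rewrite -[X in om _ X](subrK (vertex h j)) omDr om_alt addr0 omC edgeh opprK //.
(* The homothety carries the supporting numbers of the [y i] about the origin to those of [q] about
   [t]. The index [(i + m).-1] is the predecessor of [i], also for [i = 0]. *)
move=> /seq[r [t [r0 rs vE]]]; exists r, t; split=> // i.
have kS : (i + m).-1.+1 = (i + m)%N by rewrite prednK // addn_gt0 orbC q0.
have fp : f (i + m)%N = f i by rewrite !fE -addSn !v_per.
have dE : t - vertex q i = - (r *: y (i + m).-1).
  by have := vE (i + m).-1; rewrite kS v_per => ->; rewrite opprD addrA subrr add0r.
have := yES (i + m).-1; rewrite kS fp => ye.
by rewrite -fE dE omNr omZr ye mulrN opprK.
Qed.

Lemma simple_edge_neq0 (p : seq V) i : (0 < size p)%N -> simple_closed p ->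
  vertex p i != vertex p i.+1.
Proof.
move=> p0 ps; apply/eqP => e.
have ip : (i %% size p < size p)%N by rewrite ltn_pmod.
have half : 0 <= (1 / 2 : R) < 1 by apply/andP; split; lra.
have [] := ps _ _ 0 (1 / 2) ip ip; rewrite ?lexx ?ltr01 //.
  rewrite /side_point !conv_shift vertexS_mod vertex_mod -e subrr !scaler0 //.
by move=> _; lra.
Qed.

(** A side of [p] may be only a piece of a side of [q], run in either sense; the factor [l] records
    both. *)
Lemma convex_region_edge (p q : seq V) : ccw om q -> simple_closed p ->
  region p = hull q -> (1 < size p)%N -> (forall v, v \in q -> v \in p) ->
  (forall v, v \in p -> hull q v) ->
  forall i, exists j (l : R), edge p i = l *: edge q j /\
    forall z, om (edge p i) (z - vertex p i) = l * om (edge q j) (z - vertex q j).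
Proof.
move=> qc ps rp p1 qp pq i.
have [j [j1 j2]] := convex_region_side basis_e om_alt om_nondeg qc ps rp p1 qp pq i.
have [l lE] := om_parallel basis_e om_alt om_nondeg (ccw_edge_neq0 om_alt qc j) j1.
exists j, l; split=> // z; rewrite lE omZl; congr (_ * _).
rewrite (_ : z - vertex q j = (z - vertex p i) + (vertex p i - vertex q j)).
  by rewrite [RHS]omDr j2 addr0.
by rewrite addrA subrK.
Qed.

(** The support condition fixes the area of the triangle with apex [c] over each side; these
    triangles are disjoint whatever the orientation of [p]. *)
Lemma region_perimeter_le n (p : seq V) c (rho : R) : 0 < rho -> ngon n p ->
  circumscribed om p (antidisc om c rho) ->
  ((rho * perimeter p / 2)%:E <= ar (region p))%E.
Proof.
move=> r0 pn [cr Ip sup]; have [/andP[p3 _] ps _] := pn.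
have p0 : (0 < size p)%N by exact: ltn_trans p3.
have [q [qc _ _ qp pq]] := ngon_hull_polygon basis_e om_alt om_nondeg pn.
have rp : region p = hull q.
  by rewrite -pq; apply: region_convex => //; apply/cvx_convex_set.
have pH v : v \in p -> hull q v by move=> vp; rewrite -pq; exact: mem_hull.
have side := convex_region_edge qc ps rp (ltnW p3) qp pH.
have supE i : `|om (edge p i) (c - vertex p i)| = rho * `|edge p i|.
  rewrite -vertexS_mod -(vertex_mod p i).
  apply/(line_supportsP basis_e om_alt om_nondeg c r0).
    by rewrite vertexS_mod vertex_mod simple_edge_neq0.
  by have := sup (i %% size p)%N; rewrite ltn_pmod // => /(_ isT).
have -> : rho * perimeter p / 2 = \sum_(i < size p) `|om (edge p i) (c - vertex p i)| / 2.
  by rewrite /perimeter mulr_sumr mulr_suml; apply: eq_bigr => i _; rewrite supE.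
have qH := hull_halfplanes basis_e om_alt om_nondeg qc.
rewrite rp; apply: (fan_area_le basis_e om_alt om_nondeg ps).
- apply: closed_plane_measurable; rewrite qH.
  exact: (closed_halfplanes basis_e om_alt om_nondeg).
- exact: cvx_hull.
- rewrite -rp; apply: Ip; apply/(antidiscP basis_e om_alt om_nondeg _ _ r0) => f.
  by rewrite subrr om0r mulr_ge0 // ltW.
- by move=> i; apply: pH; exact: mem_vertex.
- move=> i; rewrite -normr_eq0 supE mulf_neq0 ?gt_eqF // normr_gt0 subr_eq0 eq_sym.
  exact: simple_edge_neq0.
- move=> i; have [j [l [_ lE]]] := side i.
  have [l0|l0] := leP 0 l; [left|right] => z; rewrite qH => zH; rewrite lE.
    by rewrite mulr_ge0 // zH.
  by rewrite mulr_le0_ge0 ?zH // ltW.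
Qed.

(** The support equation is homogeneous in the side, so it passes from a side of [q] to every side
    of [p] on the same line. *)
Lemma circumscribed_antidisc (p q : seq V) c (rho : R) : 0 < rho -> ccw om q ->
  simple_closed p -> region p = hull q -> (1 < size p)%N ->
  (forall v, v \in q -> v \in p) -> (forall v, v \in p -> hull q v) ->
  (forall i, om (edge q i) (c - vertex q i) = rho * `|edge q i|) ->
  circumscribed om p (antidisc om c rho).
Proof.
move=> r0 qc ps rp p1 qp pq qE; split.
- by rewrite rp; apply/cvx_convex_set; exact: cvx_hull.
- move=> z /(antidiscP basis_e om_alt om_nondeg _ _ r0) h.
  rewrite rp (hull_halfplanes basis_e om_alt om_nondeg qc) => i.
  rewrite (_ : z - vertex q i = (c - vertex q i) + (z - c)); last first.
    by rewrite [RHS]addrC addrA subrK.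
  rewrite omDr qE -[om _ (z - c)]opprK subr_ge0 -omNl.
  by rewrite -[in leRHS]normrN h.
- move=> i _; have e0 := simple_edge_neq0 i (ltnW p1) ps.
  apply/(line_supportsP basis_e om_alt om_nondeg c r0 e0).
  have [j [l [eE lE]]] := convex_region_edge qc ps rp p1 qp pq i.
  by rewrite lE qE eE !normrM normr_id (gtr0_norm r0) normrZ mulrCA.
Qed.

End Zenodorus.

(** * Comparison of areas at a fixed perimeter *)

Theorem corollary13 (R : realType) (V : normedModType R)
    (e1 e2 : V) (basis_e : is_basis2 e1 e2)
    (om : {biscalar V})
    (om_alternating : forall x : V, om x x = 0)
    (om_nondegenerate : forall x : V, (forall y : V, om x y = 0) -> x = 0)
    (n : nat) (n_ge3 : (3 <= n)%N) (L : R) (L_gt0 : 0 < L)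
    (p : seq V) (p_ngon : ngon n p) (p_per : perimeter p = L) :
  (forall q : seq V, ngon n q -> perimeter q = L ->
     (area e1 e2 om (region q) <= area e1 e2 om (region p))%E) <->
  zenodorus e1 e2 om n p.
Proof.
have [/andP[p3 pn] ps _] := p_ngon.
have [q [qc qn qper qp pq]] := ngon_hull_polygon basis_e om_alternating om_nondegenerate p_ngon.
have [area_p area_p_eq] := region_area_le basis_e om_alternating om_nondegenerate p_ngon qc pq.
have pH v : v \in p -> hull q v by move=> vp; rewrite -pq; exact: mem_hull.
have pg h := perimeter_gt0 om_alternating (q := h).
have sg h := shoelace_gt0 om_alternating (q := h).
have resize h : ccw om h -> (size h <= n)%N -> exists h', [/\ ngon n h', perimeter h' = L &
    area e1 e2 om (region h') = ((L / perimeter h) ^+ 2 * shoelace om h)%:E].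
  move=> hc hn; have h0 := ccw_gt0 hc.
  have k0 : 0 < L / perimeter h by rewrite divr_gt0 // pg.
  have h'c := ccw_homothety 0 k0 hc; exists (homothety (L / perimeter h) 0 h); split.
  - by apply: (ccw_ngon basis_e om_alternating om_nondegenerate h'c); rewrite size_map.
  - by rewrite perimeter_homothety // divfK // gt_eqF // pg.
  - by rewrite (ccw_area basis_e om_alternating om_nondegenerate h'c) shoelace_homothety.
split=> [pmax|[c [rho [r0 _ pcirc pmin]]] q0 q0n q0per].
- have [h1 [h1n h1per h1area]] := resize q qc qn.
  have := le_trans (pmax _ h1n h1per) area_p; rewrite h1area lee_fin => le1.
  (* If [q] were shorter than [p], its enlargement to perimeter [L] would have more area than
     [p]. *)
  have qL : perimeter q = L.
    apply: le_anti; rewrite -{1}p_per qper /=.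
    move: le1; rewrite ger_pMl ?sg // => le1.
    have : L / perimeter q <= 1.
      by rewrite -(@expr_le1 _ 2) // divr_ge0 // ltW // pg.
    by rewrite ler_pdivrMr ?pg // mul1r.
  have area_pE : area e1 e2 om (region p) = (shoelace om q)%:E.
    apply: le_anti; rewrite area_p /=.
    have := pmax _ h1n h1per; rewrite h1area qL divff ?gt_eqF // expr1n mul1r //.
  have rp := area_p_eq area_pE.
  have [h [s [hc hq s0 hs [hE hS mink minkE]]]] :=
    polar_polygon basis_e om_alternating om_nondegenerate qc.
  have [h2 [h2n h2per h2area]] := resize h hc (leq_trans hq qn).
  have := pmax _ h2n h2per; rewrite h2area area_pE lee_fin hS => le2.
  have Ph := pg _ hc.
  (* The area of [h] is half its perimeter, so [h] resized to perimeter [L] has area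
     [L ^+ 2 / (2 * perimeter h)]. Maximality of [p] thus gives the reverse of Minkowski's
     inequality, and equality follows. *)
  have le3 : L ^+ 2 <= 2 * perimeter h * shoelace om q.
    have E : (L / perimeter h) ^+ 2 * (perimeter h / 2) * (2 * perimeter h) = L ^+ 2.
      by field; rewrite gt_eqF.
    by rewrite -E [leRHS]mulrC ler_pM2r ?mulr_gt0.
  rewrite qL in mink minkE.
  have S2 : 0 < 2 * shoelace om q by rewrite pmulr_rgt0 ?sg.
  have tight : 2 * shoelace om q * s = L ^+ 2.
    by apply: le_anti; rewrite mink (le_trans le3) // mulrAC ler_pM2l.
  have [r [t [r0 rs tE]]] := minkE tight.
  have Sq : shoelace om q = r * L / 2.
    move: tight; rewrite -rs => E; apply: (mulIf (lt0r_neq0 s0)); lra.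
  exists t, r; split; [exact: r0|exact: p_ngon| |].
    exact: (circumscribed_antidisc basis_e om_alternating om_nondegenerate r0 qc ps rp (ltnW p3) qp pH tE).
  move=> q' q'n q'circ; have [cr _ _] := q'circ.
  have [/andP[q'3 _] _ _] := q'n.
  have [g [gc gn gper _ q'g]] := ngon_hull_polygon basis_e om_alternating om_nondegenerate q'n.
  have rq' : region q' = hull g.
    rewrite -q'g; apply: region_convex; first exact: ltn_trans q'3.
    exact/cvx_convex_set.
  have := region_perimeter_le basis_e om_alternating om_nondegenerate r0 q'n q'circ.
  rewrite rq' area_pE (area_hull_ccw basis_e om_alternating om_nondegenerate gc) !lee_fin => le4.
  have [h3 [h3n h3per h3area]] := resize g gc gn.
  have := pmax _ h3n h3per; rewrite h3area area_pE lee_fin => le5.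
  have Pg := pg _ gc.
  have le6 : r * perimeter g / 2 <= shoelace om g.
    by apply: le_trans le4; rewrite ler_pM2r // ler_pM2l.
  (* Under resizing the area grows quadratically but its lower bound only linearly; if [g] were
     shorter than [L], its enlargement would have more area than [p]. *)
  have LP : L <= perimeter g.
    have : (L / perimeter g) ^+ 2 * (r * perimeter g / 2) <= r * L / 2.
      by rewrite -Sq; apply: le_trans le5; rewrite ler_wpM2l // sqr_ge0.
    have -> : (L / perimeter g) ^+ 2 * (r * perimeter g / 2) = (r * L / 2) * (L / perimeter g).
      by field; rewrite gt_eqF.
    by rewrite ger_pMr ?divr_gt0 ?mulr_gt0 // ler_pdivrMr // mul1r.
  by apply: le_trans le6; rewrite Sq ler_pM2r // ler_pM2l.
- have [cr _ _] := pcirc.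
  have rp : region p = hull q.
    rewrite -pq; apply: region_convex; first exact: ltn_trans p3.
    exact/cvx_convex_set.
  have := region_perimeter_le basis_e om_alternating om_nondegenerate r0 p_ngon pcirc.
  rewrite rp (area_hull_ccw basis_e om_alternating om_nondegenerate qc) lee_fin p_per => le1.
  have [g [gc gn gper _ q0g]] := ngon_hull_polygon basis_e om_alternating om_nondegenerate q0n.
  have [area_q0 _] := region_area_le basis_e om_alternating om_nondegenerate q0n gc q0g.
  apply: (le_trans area_q0); rewrite lee_fin.
  have [h [s [hc hg s0 hs [hE hS mink _]]]] :=
    polar_polygon basis_e om_alternating om_nondegenerate gc.
  (* Minimality of [p] is applied to this polygon: it is circumscribed about the anticircle of [p],
     but its shape comes from the competitor [g]. *)
  pose h' := homothety rho c h.
  have h0 := ccw_gt0 hc; have h'c : ccw om h' := ccw_homothety c r0 hc.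
  have h'n : ngon n h'.
    apply: (ccw_ngon basis_e om_alternating om_nondegenerate h'c).
    by rewrite size_map (leq_trans hg).
  have h'circ : circumscribed om h' (antidisc om c rho).
    have [h'3 _ _] := h'c.
    apply: (circumscribed_antidisc basis_e om_alternating om_nondegenerate r0 h'c) => //.
    - exact: (ccw_simple_closed om_alternating h'c).
    - exact: (region_ccw basis_e om_alternating om_nondegenerate h'c).
    - exact: ltnW.
    - by move=> v; exact: mem_hull.
    - move=> i; rewrite edge_homothety // vertex_homothety // opprD addrA subrr add0r.
      by rewrite omZl omNr omZr hE !mulrN opprK normrZ gtr0_norm.
  have := pmin _ h'n h'circ.
  rewrite (ccw_area basis_e om_alternating om_nondegenerate h'c) shoelace_homothety //.
  rewrite rp (area_hull_ccw basis_e om_alternating om_nondegenerate qc) lee_fin hS => le2.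
  have Sq := sg _ qc; have Sg := sg _ gc; have Pg := pg _ gc.
  rewrite q0per in gper.
  have a1 : perimeter g ^+ 2 <= L ^+ 2 by rewrite ler_sqr // nnegrE ltW.
  have a2 : shoelace om q <= rho ^+ 2 * (s / 2).
    by rewrite (le_trans le2) // ler_wpM2l ?sqr_ge0 // ler_pM2r.
  (* The product of the two areas is bounded through Minkowski's inequality for [g], and then, by
     [le1], through the square of the area of [q], which cancels. *)
  have a3 : shoelace om g * (4 * shoelace om q) <= rho ^+ 2 * L ^+ 2.
    rewrite (@le_trans _ _ (shoelace om g * (4 * (rho ^+ 2 * (s / 2))))) //.
      by rewrite ler_pM2l // ler_pM2l.
    rewrite (_ : _ * _ = rho ^+ 2 * (2 * shoelace om g * s)); last by field.
    by rewrite ler_wpM2l ?sqr_ge0 // (le_trans mink).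
  have a4 : rho ^+ 2 * L ^+ 2 <= shoelace om q * (4 * shoelace om q).
    rewrite -exprMn; have : (rho * L) ^+ 2 <= (2 * shoelace om q) ^+ 2.
      by rewrite ler_sqr ?nnegrE; [lra|apply/ltW/mulr_gt0|lra].
    by rewrite exprMn; lra.
  by have := le_trans a3 a4; rewrite ler_pM2r // mulr_gt0.
Qed.
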